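(* Consider a network of $N$ agents running the quantized decentralized strategy (Q) described in the context, under the assumptions (on the costs, the gradient noise and the quantizers) listed in the context, with a combination matrix $\mathcal A$ satisfying $\mathcal A\,\mathcal U=\mathcal U$, $\mathcal U^\top\mathcal A=\mathcal U^\top$ and $\rho(\mathcal A-\mathcal U\mathcal U^\top)<1$ for an $M\times P$ (with $P\ll M$) full-column rank semi-unitary matrix $\mathcal U$. Let $\gamma\in(0,1]$ be such that $$0<\gamma<\min\left\{1,\ \frac{1-(\rho(\mathcal J_\epsilon)+\epsilon)}{4v_1^2v_2^2\,\beta_{q,\max}^2\,(\rho(I-\mathcal J_\epsilon)+\epsilon)^2}\right\},$$ where $v_1=\|\mathcal V_\epsilon^{-1}\|$, $v_2=\|\mathcal V_\epsilon\|$ and $\beta_{q,\max}^2=\max_{1\le k\le N}\beta_{q,k}^2$. Then the network is mean-square-error stable for sufficiently small step-size $\mu$, namely, for $k=1,\dots,N$, $$\limsup_{i\to\infty}\mathbb E\|w_k^o-\boldsymbol w_{k,i}\|^2=\delta\,O(\mu)+\overline\sigma_q^2\,O(\mu^{-1}),$$ where $$\delta=2v_1^2\overline\sigma_s^2+\frac{3\|\check b\|^2}{1-\|\mathcal J'_\epsilon\|}+\beta_{q,\max}^2v_1^2v_2^2\left(2v_1^2\overline\sigma_s^2+12\|\check b\|^2\right),\qquad \overline\sigma_s^2=\sum_{k=1}^N\sigma_{s,k}^2,\qquad \overline\sigma_q^2=\sum_{k=1}^N\sigma_{q,k}^2,$$ and $\check b=O(1)$; that is, there exist constants $C,\mu_0>0$,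 independent of $\mu$ and of the $\sigma_{q,k}^2$, such that for all $0<\mu\le\mu_0$ and all $k$ the limit superior is at most $C(\delta\mu+\overline\sigma_q^2\mu^{-1})$. Moreover, convergence to this steady-state value is linear, at a rate given by the spectral radius $\rho(\Gamma)$ of the $2\times2$ matrix $\Gamma$ defined in the context, which satisfies $$\rho(\Gamma)\le\max\left\{1-\mu\sigma_{11}+O(\mu^2),\ \|\mathcal J'_\epsilon\|+\kappa\|I-\mathcal J'_\epsilon\|^2+O(\mu)\right\}<1$$ for some positive constants $\sigma_{11}$ (the one appearing in $\Gamma$) and $\kappa$ independent of $\mu$. Here linear convergence at rate $\rho(\Gamma)$ means that for each sufficiently small $\mu$ there is a finite constant $C'$ (depending on $\mu$ and on the initial condition) with $\mathbb E\|w_k^o-\boldsymbol w_{k,i}\|^2\le C'\rho(\Gamma)^i+C(\delta\mu+\overline\sigma_q^2\mu^{-1})$ for all $i\ge0$ and all $k$.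
   Context: **Notation.** Random quantities are in boldface. $\rho(\cdot)$ is the spectral radius; $\|\cdot\|$ is the Euclidean norm of vectors and the induced $2$-norm of matrices; $\mathrm{col}\{\cdot\}$ stacks vectors; $\mathrm{diag}\{\cdot\}$ forms a block diagonal matrix; $\preceq$ between vectors is entrywise. $\alpha=O(\mu^p)$ means there are positive constants $c,\mu_0$, independent of $\mu$, with $|\alpha|\le c\mu^p$ for all $0<\mu\le\mu_0$. **Problem.** Agent $k\in\{1,\dots,N\}$ has a cost $J_k:\mathbb R^{M_k}\to\mathbb R$ and a neighborhood $\mathcal N_k$ (with $k\in\mathcal N_k$). Let $M=\sum_kM_k$. $\mathcal U$ is a real $M\times P$ matrix with $\mathcal U^\top\mathcal U=I_P$. The vector $w^o=\mathrm{col}\{w_1^o,\dots,w_N^o\}$, $w_k^o\in\mathbb R^{M_k}$, is the (unique) minimizer of $\sum_{k=1}^NJ_k(w_k)$ over $\mathrm{col}\{w_1,\dots,w_N\}\in\mathrm{Range}(\mathcal U)$. $\mathcal A$ is the real $N\times N$ block matrix with $(k,\ell)$ block $A_{k\ell}\in\mathbb R^{M_k\times M_\ell}$, with $A_{k\ell}=0$ if $\ell\notin\mathcal N_k$. **Strategy (Q).** With step-size $\mu>0$ and mixing parameter $\gamma\in(0,1]$, for $i\ge1$ and every $k$: $$\boldsymbol\psi_{k,i}=\boldsymbol w_{k,i-1}-\mu\,\widehat{\nabla J_k}(\boldsymbol w_{k,i-1}),$$ $$\boldsymbol\phi_{k,i}=\boldsymbol\phi_{k,i-1}+\boldsymbol{\mathcal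 Q}_k(\boldsymbol\psi_{k,i}-\boldsymbol\phi_{k,i-1}),$$ $$\boldsymbol w_{k,i}=(1-\gamma)\boldsymbol\phi_{k,i}+\gamma\sum_{\ell\in\mathcal N_k}A_{k\ell}\boldsymbol\phi_{\ell,i},$$ where $\widehat{\nabla J_k}$ is a stochastic approximation (at iteration $i$) of the gradient $\nabla J_k$ and $\boldsymbol{\mathcal Q}_k$ is a randomized quantizer on $\mathbb R^{M_k}$. The initial vectors $\boldsymbol\phi_{k,0}$ have finite second moments, and $\boldsymbol w_{k,0}$ is given by the third equation with $i=0$. **Assumption on the costs.** The $J_k$ are twice differentiable and convex with $\lambda_{k,\min}I_{M_k}\le\nabla^2J_k(w_k)\le\lambda_{k,\max}I_{M_k}$, $\lambda_{k,\min}\ge0$, for all $w_k$; and for some $0<\lambda_{\min}\le\lambda_{\max}$ and all $\{w_k\}$, $$0<\lambda_{\min}I_P\le\mathcal U^\top\mathrm{diag}\{\nabla^2J_k(w_k)\}_{k=1}^N\,\mathcal U\le\lambda_{\max}I_P.$$ **Assumption on the gradient noise.** Let $\boldsymbol s_{k,i}(w_k)=\nabla J_k(w_k)-\widehat{\nabla J_k}(w_k)$. For each $k$ there are $\beta_{s,k}^2,\sigma_{s,k}^2\ge0$ with $$\mathbb E[\boldsymbol s_{k,i}(\boldsymbol w_{k,i-1})\mid\{\boldsymbol\phi_{\ell,i-1}\}_{\ell=1}^N]=0,$$ $$\mathbb E[\|\boldsymbol s_{k,i}(\boldsymbol w_{k,i-1})\|^2\mid\{\boldsymbol\phi_{\ell,i-1}\}_{\ell=1}^N]\le\beta_{s,k}^2\|w_k^o-\boldsymbol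 w_{k,i-1}\|^2+\sigma_{s,k}^2.$$ **Assumption on the quantizers.** There are $\beta_{q,k}^2,\sigma_{q,k}^2\ge0$ such that for every deterministic $x$, $\mathbb E[x-\boldsymbol{\mathcal Q}_k(x)]=0$ and $\mathbb E\|x-\boldsymbol{\mathcal Q}_k(x)\|^2\le\beta_{q,k}^2\|x\|^2+\sigma_{q,k}^2$. Given the past, the quantization randomness depends only on the quantizer input: with $\boldsymbol\chi_{k,i}=\boldsymbol\psi_{k,i}-\boldsymbol\phi_{k,i-1}$ and $\boldsymbol h_i$ collecting $\{\{\boldsymbol\phi_{\ell,j}\}_{j=0}^{i-1},\{\boldsymbol\psi_{\ell,j}\}_{j=1}^{i}\}_{\ell=1}^N$, $$\mathbb E[\boldsymbol\chi_{k,i}-\boldsymbol{\mathcal Q}_k(\boldsymbol\chi_{k,i})\mid\boldsymbol h_i]=\mathbb E[\boldsymbol\chi_{k,i}-\boldsymbol{\mathcal Q}_k(\boldsymbol\chi_{k,i})\mid\boldsymbol\chi_{k,i}]=0,$$ $$\mathbb E[\|\boldsymbol\chi_{k,i}-\boldsymbol{\mathcal Q}_k(\boldsymbol\chi_{k,i})\|^2\mid\boldsymbol h_i]=\mathbb E[\|\boldsymbol\chi_{k,i}-\boldsymbol{\mathcal Q}_k(\boldsymbol\chi_{k,i})\|^2\mid\boldsymbol\chi_{k,i}]\le\beta_{q,k}^2\|\boldsymbol\chi_{k,i}\|^2+\sigma_{q,k}^2.$$ **Jordan decomposition.** A matrix $\mathcal A$ with the stated properties can be written $\mathcal A=\mathcal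 V_\epsilon\Lambda_\epsilon\mathcal V_\epsilon^{-1}$ with $$\mathcal V_\epsilon=[\,\mathcal U\mid\mathcal V_{R,\epsilon}\,],\quad\Lambda_\epsilon=\begin{bmatrix}I_P&0\\ 0&\mathcal J_\epsilon\end{bmatrix},\quad\mathcal V_\epsilon^{-1}=\begin{bmatrix}\mathcal U^\top\\ \mathcal V_{L,\epsilon}^\top\end{bmatrix},$$ where $\mathcal J_\epsilon$ is a Jordan matrix with the eigenvalues (possibly complex, of magnitude less than one) on the diagonal and $\epsilon>0$ on the super-diagonal; $\epsilon$ is fixed small enough that $\rho(\mathcal J_\epsilon)+\epsilon\in(0,1)$. Set $\mathcal J'_\epsilon=(1-\gamma)I_{M-P}+\gamma\mathcal J_\epsilon$ and $\check b=\mathcal V_{L,\epsilon}^\top\,\mathrm{col}\{\nabla J_1(w_1^o),\dots,\nabla J_N(w_N^o)\}$. When $\beta_{q,\max}^2=0$, the fraction in the condition on $\gamma$ is read as $+\infty$. **The matrix $\Gamma$.** Let $\tilde{\boldsymbol\phi}_i=\mathrm{col}\{w_k^o-\boldsymbol\phi_{k,i}\}_{k=1}^N$, $\bar{\boldsymbol\phi}_i=\mathcal U^\top\tilde{\boldsymbol\phi}_i$, $\check{\boldsymbol\phi}_i=\mathcal V_{L,\epsilon}^\top\tilde{\boldsymbol\phi}_i$. $\Gamma$ is the $2\times2$ matrix with nonnegative entries (for small $\mu$) that governs the coupled recursion $$\begin{bmatrix}\mathbb E\|\bar{\boldsymbol\phi}_i\|^2\\ \mathbb E\|\check{\boldsymbol\phi}_i\|^2\end{bmatrix}\preceq\Gamma\begin{bmatrix}\mathbb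 E\|\bar{\boldsymbol\phi}_{i-1}\|^2\\ \mathbb E\|\check{\boldsymbol\phi}_{i-1}\|^2\end{bmatrix}+\begin{bmatrix}e+v_1^2\overline\sigma_q^2\\ f+v_1^2\overline\sigma_q^2\end{bmatrix},\qquad\Gamma=\begin{bmatrix}a&b\\ c&d\end{bmatrix},$$ with, for a constant $\sigma_{11}>0$ independent of $\mu$, $a=1-\mu\sigma_{11}+O(\mu^2)$, $b=2v_1^2v_2^2\beta_{q,\max}^2\|I-\mathcal J'_\epsilon\|^2+O(\mu)$, $c=O(\mu^2)$, $d=\|\mathcal J'_\epsilon\|+2v_1^2v_2^2\beta_{q,\max}^2\|I-\mathcal J'_\epsilon\|^2+O(\mu^2)$, $e=\mu^2\big(6\|\check b\|^2v_1^2v_2^2\beta_{q,\max}^2+v_1^4v_2^2\overline\sigma_s^2\beta_{q,\max}^2+v_1^2\overline\sigma_s^2\big)$, $f=\mu^2\big(\tfrac{3\|\check b\|^2}{1-\|\mathcal J'_\epsilon\|}+6v_1^2v_2^2\beta_{q,\max}^2\|\check b\|^2+v_1^4v_2^2\overline\sigma_s^2\beta_{q,\max}^2+v_1^2\overline\sigma_s^2\big)$. *)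

(* Defs.v *)
From HB Require Import structures.
From mathcomp Require Import all_boot all_order all_algebra.
From mathcomp Require Import complex.
From mathcomp Require Import all_classical all_reals all_analysis.
From mathcomp Require Import measurable_realfun.
Set Implicit Arguments.
Unset Strict Implicit.
Unset Printing Implicit Defensive.
Import Order.TTheory GRing.Theory Num.Theory.
Import numFieldNormedType.Exports.
Import ComplexField.Normc.
Local Open Scope classical_set_scope.
Local Open Scope ring_scope.

Section LinearAlgebra.
Variable R : realType.

(* The norm that the library puts on matrices is the max norm; mean-square
   errors are measured with the Euclidean one. *)
Definition enorm n (x : 'cV[R]_n) : R := Num.sqrt (\sum_i x i 0 ^+ 2).

Definition cenorm n (x : 'cV[R[i]]_n) : R :=
  Num.sqrt (\sum_i normc (x i 0) ^+ 2).

Definition opnorm m n (A : 'M[R[i]]_(m, n)) : R :=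
  sup [set cenorm (A *m x) | x in [set x : 'cV[R[i]]_n | cenorm x <= 1]].

Definition toC m n (A : 'M[R]_(m, n)) : 'M[R[i]]_(m, n) :=
  map_mx (real_complex R) A.

Definition rho n (A : 'M[R[i]]_n) : R :=
  sup [set normc a | a in [set a | eigenvalue A a]].

(* The Loewner order compares symmetric matrices. It is only used below when
   one of the two sides is a multiple of the identity, so that the first clause
   says that the other side is symmetric. *)
Definition loewner_le n (A B : 'M[R]_n) : Prop :=
  (B - A)^T = B - A /\ forall x : 'cV[R]_n, 0 <= (x^T *m (B - A) *m x) 0 0.

(* Direct sum of blocks lambda I + eps N, where N is the nilpotent shift: the
   super-diagonal entry (i, i+1) is eps inside a block, and 0 between two
   consecutive blocks. *)
Definition jordan_matrix n (eps : R) (A : 'M[R[i]]_n) : Prop :=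
  forall i j : 'I_n,
    ((j : nat) != i -> (j : nat) != i.+1 -> A i j = 0) /\
    ((j : nat) = i.+1 ->
       A i j = 0 \/ A i j = (real_complex R) eps /\ A i i = A j j).

Definition gradient n (f : 'cV[R]_n -> R) (x : 'cV[R]_n) : 'cV[R]_n :=
  \col_i 'D_(delta_mx i 0 : 'cV[R]_n) (f : _ -> R^o) x.

Definition hessian n (f : 'cV[R]_n -> R) (x : 'cV[R]_n) : 'M[R]_n :=
  \matrix_(i, j)
    'D_(delta_mx j 0 : 'cV[R]_n) ((fun y => gradient f y i 0) : _ -> R^o) x.

Definition twice_differentiable n (f : 'cV[R]_n -> R) : Prop :=
  (forall x, differentiable (f : _ -> R^o) x) /\
  (forall x, differentiable (gradient f) x).

(* alpha(mu) = O(mu^p) as mu -> 0+ *)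
Definition is_bigO (p : nat) (alpha : R -> R) : Prop :=
  exists c mu0 : R, [/\ 0 < c, 0 < mu0 &
    forall mu, 0 < mu -> mu <= mu0 -> `|alpha mu| <= c * mu ^+ p].

End LinearAlgebra.

Section Conditioning.
Context d (T : measurableType d) (R : realType) (Pr : probability T R).

Definition random_vector n (X : T -> 'cV[R]_n) : Prop :=
  forall j, measurable_fun [set: T] (fun t => X t j 0).

(* [<<s events X >>] is the sigma-algebra generated by the random vector X *)
Definition events n (X : T -> 'cV[R]_n) : set (set T) :=
  [set E | exists (j : 'I_n) (B : set R),
             measurable B /\ E = (fun t => X t j 0) @^-1` B].

Definition quasi_integrable (X : T -> \bar R) : Prop :=
  Pr.-integrable [set: T] X \/
  (measurable_fun [set: T] X /\ forall t, (0 <= X t)%E).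

(* Z is a version of E[X | G]; nonnegative variables are allowed to have an
   infinite expectation. *)
Definition is_condexp (G : set (set T)) (X Z : T -> \bar R) : Prop :=
  [/\ quasi_integrable X, quasi_integrable Z,
      forall B : set (\bar R), measurable B -> G (Z @^-1` B) &
      forall E, G E -> (\int[Pr]_(t in E) Z t = \int[Pr]_(t in E) X t)%E].

Definition condexp_vec0 n (G : set (set T)) (X : T -> 'cV[R]_n) : Prop :=
  forall j, is_condexp G (fun t => (X t j 0)%:E) (fun _ => 0%E).

End Conditioning.

Section Network.
Variables (R : realType) (N : nat) (m : 'I_N -> nat) (P : nat).
Local Notation M := (\sum_k m k)%N.
Local Notation Q := (M - P)%N.

(* max_k beta_{q,k}^2; the coefficients are nonnegative *)
Definition maxcoef (b2 : 'I_N -> R) : R := \big[Num.max/0]_k b2 k.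

Definition cost_assumption (J : forall k, 'cV[R]_(m k) -> R)
    (U : 'M[R]_(M, P)) (lkmin lkmax : 'I_N -> R) (lmin lmax : R) : Prop :=
  [/\ forall k, twice_differentiable (J k) /\ convex_function setT (J k),
      forall k, 0 <= lkmin k /\ forall x : 'cV[R]_(m k),
        loewner_le (lkmin k)%:M (hessian (J k) x) /\
        loewner_le (hessian (J k) x) (lkmax k)%:M,
      0 < lmin <= lmax &
      forall x : forall k, 'cV[R]_(m k),
        let H := U^T *m (\mxdiag_k hessian (J k) (x k)) *m U in
        loewner_le lmin%:M H /\ loewner_le H lmax%:M].

Definition in_range (U : 'M[R]_(M, P)) (w : forall k, 'cV[R]_(m k)) : Prop :=
  exists x : 'cV[R]_P, \mxcol_k w k = U *m x.

Definition unique_minimizer (J : forall k, 'cV[R]_(m k) -> R)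
    (U : 'M[R]_(M, P)) (wo : forall k, 'cV[R]_(m k)) : Prop :=
  in_range U wo /\
  forall w : forall k, 'cV[R]_(m k), in_range U w ->
    \mxcol_k w k <> \mxcol_k wo k ->
    \sum_k J k (wo k) < \sum_k J k (w k).

Definition combination_matrix (nbh : 'I_N -> {set 'I_N})
    (U : 'M[R]_(M, P)) (A : 'M[R]_M) : Prop :=
  [/\ forall k l, l \notin nbh k -> submxblock A k l = 0,
      A *m U = U, U^T *m A = U^T & rho (toC (A - U *m U^T)) < 1].

Definition Veps (U : 'M[R]_(M, P)) (VR : 'M[R[i]]_(M, Q)) :
  'M[R[i]]_(M, P + Q) := row_mx (toC U) VR.

Definition Vinv (U : 'M[R]_(M, P)) (VL : 'M[R[i]]_(M, Q)) :
  'M[R[i]]_(P + Q, M) := col_mx (toC U)^T VL^T.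

Definition jordan_decomposition (U : 'M[R]_(M, P)) (A : 'M[R]_M) (eps : R)
    (VR VL : 'M[R[i]]_(M, Q)) (Jeps : 'M[R[i]]_Q) : Prop :=
  [/\ Veps U VR *m Vinv U VL = 1%:M, Vinv U VL *m Veps U VR = 1%:M,
      jordan_matrix eps Jeps &
      toC A = Veps U VR *m block_mx 1%:M 0 0 Jeps *m Vinv U VL].

(* J'_eps *)
Definition Jprime (gamma : R) (Jeps : 'M[R[i]]_Q) : 'M[R[i]]_Q :=
  (real_complex R) (1 - gamma) *: 1%:M + (real_complex R) gamma *: Jeps.

Definition gamma_bound (v1 v2 b2 eps : R) (Jeps : 'M[R[i]]_Q) : \bar R :=
  if b2 == 0 then +oo%E
  else ((1 - (rho Jeps + eps)) /
        (4 * v1 ^+ 2 * v2 ^+ 2 * b2 * (rho (1%:M - Jeps) + eps) ^+ 2))%:E.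

Definition bcheck (J : forall k, 'cV[R]_(m k) -> R)
    (wo : forall k, 'cV[R]_(m k)) (VL : 'M[R[i]]_(M, Q)) : 'cV[R[i]]_Q :=
  VL^T *m toC (\mxcol_k gradient (J k) (wo k)).

Section Run.
Context d (T : measurableType d) (Pr : probability T R).
Implicit Types (phi psi w : forall k : 'I_N, nat -> T -> 'cV[R]_(m k)).

(* [ghat k i t] and [q k i t] are the realizations at iteration i of the
   approximate gradient map and of the randomized quantizer of agent k;
   psi, ghat and q are only meaningful for i >= 1. *)
Definition strategyQ (mu gamma : R) (nbh : 'I_N -> {set 'I_N}) (A : 'M[R]_M)
    (ghat q : forall k : 'I_N, nat -> T -> 'cV[R]_(m k) -> 'cV[R]_(m k))
    phi psi w : Prop :=
  forall k i t,
  [/\ psi k i.+1 t = w k i t - mu *: ghat k i.+1 t (w k i t),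
      phi k i.+1 t = phi k i t + q k i.+1 t (psi k i.+1 t - phi k i t) &
      w k i t = (1 - gamma) *: phi k i t +
                gamma *: \sum_(l in nbh k) submxblock A k l *m phi l i t].

Definition noise_assumption (J : forall k, 'cV[R]_(m k) -> R)
    (wo : forall k, 'cV[R]_(m k)) (bs2 ss2 : 'I_N -> R)
    (ghat : forall k : 'I_N, nat -> T -> 'cV[R]_(m k) -> 'cV[R]_(m k))
    phi w : Prop :=
  forall k i,
  let s t := gradient (J k) (w k i t) - ghat k i.+1 t (w k i t) in
  let G := <<s \bigcup_(l in [set: 'I_N]) events (phi l i) >> in
  [/\ random_vector s, condexp_vec0 Pr G s &
      exists2 Z, is_condexp Pr G (fun t => (enorm (s t) ^+ 2)%:E) Z &
        {ae Pr, forall t,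
          (Z t <= (bs2 k * enorm (wo k - w k i t) ^+ 2 + ss2 k)%:E)%E}].

Definition quantizer_assumption (bq2 sq2 : 'I_N -> R)
    (q : forall k : 'I_N, nat -> T -> 'cV[R]_(m k) -> 'cV[R]_(m k))
    phi psi : Prop :=
  (forall k i (x : 'cV[R]_(m k)),
    [/\ random_vector (fun t => q k i.+1 t x),
        forall j, 'E_Pr[fun t => ((x - q k i.+1 t x) j 0)%R]%E = 0%E &
        ('E_Pr[fun t => (enorm (x - q k i.+1 t x) ^+ 2)%R]
          <= (bq2 k * enorm x ^+ 2 + sq2 k)%:E)%E]) /\
  (forall k i,
    let chi t := psi k i.+1 t - phi k i t in
    let z t := chi t - q k i.+1 t (chi t) in
    let h := <<s
      (\bigcup_(l in [set: 'I_N])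
         \bigcup_(j in [set j | (j <= i)%N]) events (phi l j)) `|`
      (\bigcup_(l in [set: 'I_N])
         \bigcup_(j in [set j | (1 <= j <= i.+1)%N]) events (psi l j)) >> in
    let G := <<s events chi >> in
    [/\ random_vector z, condexp_vec0 Pr h z, condexp_vec0 Pr G z &
        exists Z,
        [/\ is_condexp Pr h (fun t => (enorm (z t) ^+ 2)%:E) Z,
            is_condexp Pr G (fun t => (enorm (z t) ^+ 2)%:E) Z &
            {ae Pr, forall t,
              (Z t <= (bq2 k * enorm (chi t) ^+ 2 + sq2 k)%:E)%E}]]).

Definition admissible_init phi : Prop :=
  forall k, random_vector (phi k 0%N) /\
            ('E_Pr[fun t => (enorm (phi k 0%N t) ^+ 2)%R] < +oo)%E.

(* mean-square values of bar-phi_i, check-phi_i and of w_k^o - w_{k,i} *)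
Definition ms_bar (wo : forall k, 'cV[R]_(m k)) (U : 'M[R]_(M, P))
    phi (i : nat) : \bar R :=
  'E_Pr[fun t => (enorm (U^T *m \mxcol_k (wo k - phi k i t)) ^+ 2)%R]%E.

Definition ms_check (wo : forall k, 'cV[R]_(m k)) (VL : 'M[R[i]]_(M, Q))
    phi (i : nat) : \bar R :=
  'E_Pr[fun t =>
    (cenorm (VL^T *m toC (\mxcol_k (wo k - phi k i t))) ^+ 2)%R]%E.

Definition msd (wo : forall k, 'cV[R]_(m k)) w (k : 'I_N) (i : nat) : \bar R :=
  'E_Pr[fun t => (enorm (wo k - w k i t) ^+ 2)%R]%E.

End Run.
End Network.

(* Main.v *)
Require Import Defs.
From HB Require Import structures.
From mathcomp Require Import all_boot all_order all_algebra.
From mathcomp Require Import complex.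
From mathcomp Require Import all_classical all_reals all_analysis.
From mathcomp Require Import measurable_realfun.
From mathcomp Require Import ring lra.
Set Implicit Arguments.
Unset Strict Implicit.
Unset Printing Implicit Defensive.
Import Order.TTheory GRing.Theory Num.Theory.
Import numFieldNormedType.Exports.
Local Open Scope classical_set_scope.
Local Open Scope ring_scope.

(** Write x for the stacked error of the quantized iterates phi. Mixing fixes the
    component U^T x along Range(U) and multiplies the component VL^T x along the
    complementary invariant subspace by Jprime, so the two are followed
    separately, through the energies barsq x and checksq x.

    One iteration replaces x by adapt mu x, perturbed by the gradient noise and then
    by the quantization error. Each perturbation has conditional mean zero given
    what precedes it, so that it is uncorrelated with it (condexp0_orth), and second
    moments add up (msq_step). Three deterministic facts remain. Along Range(U) the
    aggregate cost is strongly convex and stationary at the minimizer, so adapt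
    contracts by 1 - mu * lmin (stacked_gradient_contract, barsq_adapt). On the
    complement Jprime contracts (checksq_adapt). The quantizer input is small along
    Range(U), and is dominated by (I - Jprime) applied to the other component
    (enorm_adapt_sub), which is how quantization feeds back with the factor
    norm (I - Jprime) ^ 2. The Hessian enters only through the mean value theorem
    tested against one direction (mean_value_gradient), which turns bounds on
    quadratic forms into bounds on gradient increments without integrating.

    Together these give bar_recursion and check_recursion, that is, the coupled
    recursion with a Gamma whose entries have explicit perturbations K mu and
    K mu ^ 2. The bound on gamma, with the fact that the norm of a bidiagonal matrix
    exceeds its spectral radius by at most the super-diagonal entry
    (opnorm_bidiagonal), keeps the limit of the lower right entry below 1
    (stability_margin).

    The rest concerns a 2 x 2 matrix with positive off-diagonal entries. Weighted
    column sums bound its spectral radius by the stated maximum (rho_mx2_bounds). For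
    the trajectory, subtract a supersolution of the affine recursion and keep
    positive parts: testing them against Perron's left eigenvector gives decay at
    the rate rho Gamma exactly (decay2, recursion_rate). The supersolution is of
    the order of the driving term divided by mu, the gap 1 - Gamma11 being of order
    mu (small_steps). As the driving terms add up to
    mu ^ 2 * delta + 2 * v1 ^ 2 * sq, the steady state is of order
    delta * mu + sq / mu (steady_scalar). *)

(** * Euclidean norms of real vectors *)

Section RealVectors.
Variable R : realType.

Lemma quadratic_discriminant (p q r : R) :
  (forall t, 0 <= p + 2 * t * q + t ^+ 2 * r) -> q ^+ 2 <= p * r.
Proof.
move=> h; have p0 : 0 <= p by have := h 0; rewrite !(mulr0, mul0r, expr0n, addr0).
have [r0|r0] := eqVneq r 0.
  have [->|q0] := eqVneq q 0; first by rewrite expr0n /= r0 mulr0.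
  have := h (- (p + 1) / (2 * q)).
  rewrite r0 mulr0 addr0 -[2 * _ * q]mulrAC [2 * q * _]mulrC divfK ?mulf_neq0 ?pnatr_eq0 //.
  lra.
have rp : 0 < r.
  rewrite lt0r r0 /=; rewrite leNgt; apply/negP => rn.
  have := h ((p + q ^+ 2 + 1) / (- r) + 1).
  have := h (- ((p + q ^+ 2 + 1) / (- r) + 1)).
  set t := _ + 1 => h1 h2.
  have t1 : 1 <= t by rewrite lerDr divr_ge0 // ?oppr_ge0 ?(ltW rn) // !addr_ge0 ?sqr_ge0.
  have : t * - r > p + q ^+ 2.
    by rewrite /t mulrDl mul1r divfK ?oppr_eq0 // ; lra.
  nra.
have := h (- q / r).
have -> : p + 2 * (- q / r) * q + (- q / r) ^+ 2 * r = p - q ^+ 2 / r by field.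
by rewrite subr_ge0 ler_pdivrMr.
Qed.

Lemma dotE n (x y : 'cV[R]_n) : (x^T *m y) 0 0 = \sum_i x i 0 * y i 0.
Proof. by rewrite mxE; apply: eq_bigr => i _; rewrite mxE. Qed.

Lemma enorm_ge0 n (x : 'cV[R]_n) : 0 <= enorm x.
Proof. exact: sqrtr_ge0. Qed.

Lemma enorm_sqr n (x : 'cV[R]_n) : enorm x ^+ 2 = \sum_i x i 0 ^+ 2.
Proof. by rewrite sqr_sqrtr // sumr_ge0 // => i _; exact: sqr_ge0. Qed.

Lemma enorm_dot n (x : 'cV[R]_n) : enorm x ^+ 2 = (x^T *m x) 0 0.
Proof. by rewrite enorm_sqr dotE. Qed.

Lemma dotC n (x y : 'cV[R]_n) : (x^T *m y) 0 0 = (y^T *m x) 0 0.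
Proof. by rewrite !dotE; apply: eq_bigr => i _; rewrite mulrC. Qed.

Let addmx_coef m n (A B : 'M[R]_(m, n)) i j : (A + B) i j = A i j + B i j.
Proof. by rewrite mxE. Qed.

Let scalemx_coef m n a (A : 'M[R]_(m, n)) i j : (a *: A) i j = a * A i j.
Proof. by rewrite mxE. Qed.

(** Nonnegativity of the form along the line x + t y is a sign condition on a
    quadratic polynomial in t. *)
Lemma psd_cauchy_schwarz n (S : 'M[R]_n) (x y : 'cV[R]_n) :
  S^T = S -> (forall z : 'cV[R]_n, 0 <= (z^T *m S *m z) 0 0) ->
  (x^T *m S *m y) 0 0 ^+ 2 <= (x^T *m S *m x) 0 0 * (y^T *m S *m y) 0 0.
Proof.
move=> sS pS; apply: quadratic_discriminant => t.
have := pS (x + t *: y).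
have yx : (y^T *m S *m x) 0 0 = (x^T *m S *m y) 0 0.
  have <- : (y^T *m S *m x)^T = x^T *m S *m y by rewrite !trmx_mul trmxK sS mulmxA.
  by rewrite [RHS]mxE.
rewrite [(x + _)^T]linearD /= [(t *: y)^T]linearZ /= !mulmxDl !mulmxDr -!scalemxAl -!scalemxAr.
rewrite !(addmx_coef, scalemx_coef) yx.
by move=> h; apply: le_trans h _; rewrite le_eqVlt; apply/orP; left; apply/eqP; ring.
Qed.

(** A symmetric matrix with quadratic form between 0 and c has operator norm at
    most c: Cauchy-Schwarz for its semi-inner product. *)
Lemma psd_bilinear_le n (S : 'M[R]_n) (c : R) (x y : 'cV[R]_n) :
  S^T = S -> (forall z : 'cV[R]_n, 0 <= (z^T *m S *m z) 0 0 <= c * enorm z ^+ 2) ->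
  0 <= c -> `|(x^T *m S *m y) 0 0| <= c * enorm x * enorm y.
Proof.
move=> sS pS c0; have ps (z : 'cV[R]_n) : 0 <= (z^T *m S *m z) 0 0 by case/andP: (pS z).
rewrite -(@ler_pXn2r _ 2) ?nnegrE ?mulr_ge0 ?enorm_ge0 //.
rewrite real_normK ?num_real //; apply: le_trans (psd_cauchy_schwarz _ _ sS ps) _.
have /andP[? h1] := pS x; have /andP[? h2] := pS y.
by apply: le_trans (ler_pM _ _ h1 h2) _ => //; rewrite le_eqVlt; apply/orP; left; apply/eqP; ring.
Qed.

Lemma cauchy_schwarz n (x y : 'cV[R]_n) : `|(x^T *m y) 0 0| <= enorm x * enorm y.
Proof.
have := @psd_bilinear_le n 1%:M 1 x y (trmx1 _ _) _ ler01.
rewrite mulmx1 mul1r; apply => w; rewrite mulmx1 mul1r -enorm_dot lexx andbT.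
exact: sqr_ge0.
Qed.

Lemma enormD n (x y : 'cV[R]_n) : enorm (x + y) <= enorm x + enorm y.
Proof.
rewrite -(@ler_pXn2r _ 2) ?nnegrE ?addr_ge0 ?enorm_ge0 //.
rewrite enorm_dot [(x + y)^T]linearD /= mulmxDl !mulmxDr !addmx_coef.
rewrite -!enorm_dot (dotC y x).
have := le_trans (ler_norm _) (cauchy_schwarz x y).
set a := _ 0 0; nra.
Qed.

Lemma enormZ n a (x : 'cV[R]_n) : enorm (a *: x) = `|a| * enorm x.
Proof.
rewrite /enorm -sqrtr_sqr -sqrtrM ?sqr_ge0 // mulr_sumr; congr Num.sqrt.
by apply: eq_bigr => i _; rewrite mxE exprMn.
Qed.

Lemma enormN n (x : 'cV[R]_n) : enorm (- x) = enorm x.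
Proof. by rewrite -scaleN1r enormZ normrN normr1 mul1r. Qed.

Lemma enormB n (x y : 'cV[R]_n) : enorm (x - y) <= enorm x + enorm y.
Proof. by rewrite -[in leRHS](enormN y) enormD. Qed.

End RealVectors.

(** * Complex vectors and operator norms *)

Section ComplexVectors.
Variable R : realType.
Local Notation C := (R[i]).
Import ComplexField.Normc.

(** The complex component of the error becomes a real linear image of it, so that
    all moments below are moments of real random vectors. *)
Definition realify m n (A : 'M[C]_(m, n)) : 'M[R]_(m + m, n) :=
  col_mx (map_mx (@complex.Re R) A) (map_mx (@complex.Im R) A).

Lemma sqr_normc (a : C) : normc a ^+ 2 = complex.Re a ^+ 2 + complex.Im a ^+ 2.
Proof. by case: a => x y /=; rewrite sqr_sqrtr // addr_ge0 ?sqr_ge0. Qed.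

Lemma cenorm_realify n (x : 'cV[C]_n) : cenorm x = enorm (realify x).
Proof.
rewrite /cenorm /enorm; congr Num.sqrt; rewrite big_split_ord /=.
rewrite (eq_bigr _ (fun i _ => sqr_normc (x i 0))) big_split /=.
by congr (_ + _); apply: eq_bigr => i _; rewrite ?col_mxEu ?col_mxEd mxE.
Qed.

Lemma realify_mul m n (A : 'M[C]_(m, n)) (x : 'cV[R]_n) :
  realify (A *m toC x) = realify A *m x.
Proof.
rewrite mul_col_mx; congr col_mx; apply/matrixP => i j; rewrite !mxE raddf_sum;
  apply: eq_bigr => k _; rewrite !mxE; case: (A i k) => a b /=; simpc => /=; ring.
Qed.

Lemma cenorm_sqr n (x : 'cV[C]_n) : cenorm x ^+ 2 = \sum_i normc (x i 0) ^+ 2.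
Proof. by rewrite sqr_sqrtr // sumr_ge0 // => i _; exact: sqr_ge0. Qed.

Lemma cenorm_ge0 n (x : 'cV[C]_n) : 0 <= cenorm x.
Proof. exact: sqrtr_ge0. Qed.

Lemma cenormD n (x y : 'cV[C]_n) : cenorm (x + y) <= cenorm x + cenorm y.
Proof.
rewrite !cenorm_realify; have -> : realify (x + y) = realify x + realify y.
  by rewrite /realify !map_mxD add_col_mx.
exact: enormD.
Qed.

Lemma normc_ge0 (a : C) : 0 <= normc a.
Proof. by case: a => x y; exact: sqrtr_ge0. Qed.

Lemma normc_real (a : R) : normc (real_complex R a) = `|a|.
Proof. by rewrite /= expr0n addr0 sqrtr_sqr. Qed.

Lemma cenormZ n (a : C) (x : 'cV[C]_n) : cenorm (a *: x) = normc a * cenorm x.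
Proof.
rewrite /cenorm -[in RHS](ger0_norm (normc_ge0 a)) -sqrtr_sqr -sqrtrM ?sqr_ge0 //.
rewrite mulr_sumr; congr Num.sqrt.
by apply: eq_bigr => i _; rewrite mxE normcM exprMn.
Qed.

Lemma cenormN n (x : 'cV[C]_n) : cenorm (- x) = cenorm x.
Proof. by rewrite -scaleN1r cenormZ normcN normc1 mul1r. Qed.

Lemma cenormB n (x y : 'cV[C]_n) : cenorm (x - y) <= cenorm x + cenorm y.
Proof. by rewrite -[in leRHS](cenormN y) cenormD. Qed.

Lemma cenorm0 n : cenorm (0 : 'cV[C]_n) = 0.
Proof. by rewrite -(scale0r 0) cenormZ normc0 mul0r. Qed.

Lemma cenorm0_eq0 n (x : 'cV[C]_n) : cenorm x = 0 -> x = 0.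
Proof.
move=> h; have : cenorm x ^+ 2 == 0 by rewrite h expr0n.
rewrite cenorm_sqr psumr_eq0 => [/allP h0|i _]; last exact: sqr_ge0.
apply/matrixP => i j; rewrite ord1 mxE; apply: eq0_normc.
by have := h0 i (mem_index_enum _); rewrite sqrf_eq0 => /eqP.
Qed.

Lemma cenorm_toC n (x : 'cV[R]_n) : cenorm (toC x) = enorm x.
Proof.
rewrite /cenorm /enorm; congr Num.sqrt; apply: eq_bigr => i _.
by rewrite mxE normc_real real_normK ?num_real.
Qed.

Lemma cenorm_col_mx n1 n2 (x : 'cV[C]_n1) (y : 'cV[C]_n2) :
  cenorm (col_mx x y) ^+ 2 = cenorm x ^+ 2 + cenorm y ^+ 2.
Proof.
rewrite !cenorm_sqr big_split_ord /=; congr (_ + _); apply: eq_bigr => i _.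
  by rewrite col_mxEu.
by rewrite col_mxEd.
Qed.

Lemma cenorm_sum n I (r : seq I) (F : I -> 'cV[C]_n) :
  cenorm (\sum_(i <- r) F i) <= \sum_(i <- r) cenorm (F i).
Proof.
elim/big_ind2 : _ => [|x a y b h1 h2|//]; first by rewrite cenorm0.
exact: le_trans (cenormD _ _) (lerD h1 h2).
Qed.

Lemma normc_le_cenorm n (x : 'cV[C]_n) i : normc (x i 0) <= cenorm x.
Proof.
rewrite -(@ler_pXn2r _ 2) ?nnegrE ?normc_ge0 ?cenorm_ge0 // cenorm_sqr.
by rewrite (bigD1 i) //= lerDl sumr_ge0 // => j _; exact: sqr_ge0.
Qed.

(** Crude, but it makes the supremum that defines the operator norm finite. *)
Lemma mulmx_bounded m n (A : 'M[C]_(m, n)) (x : 'cV[C]_n) :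
  cenorm (A *m x) <= (\sum_j cenorm (col j A)) * cenorm x.
Proof.
have -> : A *m x = \sum_j x j 0 *: col j A.
  apply/matrixP => i j; rewrite ord1 mxE summxE; apply: eq_bigr => k _.
  by rewrite !mxE mulrC.
apply: le_trans (cenorm_sum _ _) _; rewrite mulr_suml; apply: ler_sum => j _.
by rewrite cenormZ mulrC ler_wpM2l ?cenorm_ge0 ?normc_le_cenorm.
Qed.

Lemma opnorm_has_sup m n (A : 'M[C]_(m, n)) :
  has_sup [set cenorm (A *m x) | x in [set x : 'cV[C]_n | cenorm x <= 1]].
Proof.
split; first by exists (cenorm (A *m 0)), 0 => //=; rewrite cenorm0.
exists (\sum_j cenorm (col j A)) => _ [x /= x1 <-].
apply: le_trans (mulmx_bounded _ _) _; rewrite ler_piMr //.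
by apply: sumr_ge0 => j _; exact: cenorm_ge0.
Qed.

Lemma opnorm_ge0 m n (A : 'M[C]_(m, n)) : 0 <= opnorm A.
Proof.
apply: le_trans (cenorm_ge0 (A *m 0)) _; apply: ub_le_sup.
  by case: (opnorm_has_sup A).
by exists 0 => //=; rewrite cenorm0.
Qed.

Lemma cenorm_mulmx m n (A : 'M[C]_(m, n)) (x : 'cV[C]_n) :
  cenorm (A *m x) <= opnorm A * cenorm x.
Proof.
have [x0|x0] := eqVneq (cenorm x) 0.
  by rewrite (cenorm0_eq0 x0) mulmx0 !cenorm0 mulr0.
have xp : 0 < cenorm x by rewrite lt0r x0 cenorm_ge0.
rewrite -ler_pdivrMr //.
have -> : cenorm (A *m x) / cenorm x =
    cenorm (A *m (real_complex R (cenorm x)^-1 *: x)).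
  by rewrite -scalemxAr cenormZ normc_real ger0_norm ?invr_ge0 ?cenorm_ge0 // mulrC.
apply: ub_le_sup; first by case: (opnorm_has_sup A).
exists (real_complex R (cenorm x)^-1 *: x) => //=.
by rewrite cenormZ normc_real ger0_norm ?invr_ge0 ?cenorm_ge0 // mulVf.
Qed.

Lemma opnorm_le m n (A : 'M[C]_(m, n)) (c : R) :
  0 <= c -> (forall x, cenorm (A *m x) <= c * cenorm x) -> opnorm A <= c.
Proof.
move=> c0 h; apply: ge_sup; first by case: (opnorm_has_sup A).
by move=> _ [x /= x1 <-]; apply: le_trans (h x) _; rewrite ler_piMr.
Qed.

Lemma opnorm_lin n (a b : R) (A : 'M[C]_n) :
  0 <= a -> 0 <= b ->
  opnorm (real_complex R a *: 1%:M + real_complex R b *: A) <= a + b * opnorm A.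
Proof.
move=> a0 b0; apply: opnorm_le => [|x].
  by rewrite addr_ge0 ?mulr_ge0 ?opnorm_ge0.
rewrite mulmxDl -!scalemxAl mul1mx; apply: le_trans (cenormD _ _) _.
rewrite !cenormZ !normc_real !ger0_norm // mulrDl lerD2l -mulrA.
by rewrite ler_wpM2l ?cenorm_mulmx.
Qed.

(** * Spectral radius *)

(** Eigenvectors are row vectors, whereas the operator norm acts on columns; hence
    the transpose. *)
Lemma normc_eigenvalue_le n (A : 'M[C]_n) (c : R) (a : C) :
  (forall x : 'cV[C]_n, cenorm (A^T *m x) <= c * cenorm x) ->
  eigenvalue A a -> normc a <= c.
Proof.
move=> h /eigenvalueP[v Av v0].
have x0 : 0 < cenorm v^T.
  rewrite lt0r cenorm_ge0 andbT; apply: contra v0 => /eqP/cenorm0_eq0 h0.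
  by rewrite -(trmxK v) h0 trmx0.
rewrite -(ler_pM2r x0) -cenormZ.
by have := h v^T; rewrite -trmx_mul Av linearZ.
Qed.

Lemma rho_has_ubound n (A : 'M[C]_n) :
  has_ubound [set normc a | a in [set a | eigenvalue A a]].
Proof.
exists (opnorm A^T) => _ [a /= Aa <-].
by apply: normc_eigenvalue_le Aa => x; exact: cenorm_mulmx.
Qed.

Lemma normc_le_rho n (A : 'M[C]_n) a : eigenvalue A a -> normc a <= rho A.
Proof. by move=> Aa; apply: ub_le_sup (rho_has_ubound A) _ _; exists a. Qed.

Lemma char_poly_tr n (A : 'M[C]_n) : char_poly A^T = char_poly A.
Proof.
rewrite /char_poly -det_tr; congr (\det _); apply/matrixP => i j.
by rewrite !mxE eq_sym.
Qed.

Lemma eigenvalue_diag n (A : 'M[C]_n) i :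
  (forall i j : 'I_n, (j < i)%N -> A i j = 0) -> eigenvalue A (A i i).
Proof.
move=> h; rewrite eigenvalue_root_char -char_poly_tr char_poly_trig; last first.
  by apply/is_trig_mxP => j k jk; rewrite mxE h.
by rewrite rootE horner_prod (bigD1 i) //= !hornerE mxE subrr mul0r.
Qed.

(** A bidiagonal matrix is its diagonal, whose norm is the spectral radius,
    plus a weighted shift, whose norm is at most the largest weight. *)
Lemma opnorm_bidiagonal n (A : 'M[C]_n) (eps : R) :
  (0 < n)%N -> 0 <= eps ->
  (forall i j : 'I_n, (j : nat) != i -> (j : nat) != i.+1 -> A i j = 0) ->
  (forall i j : 'I_n, (j : nat) = i.+1 -> normc (A i j) <= eps) ->
  0 <= rho A /\ opnorm A <= rho A + eps.
Proof.
move=> n0 e0 h0 h1.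
have ev i : eigenvalue A (A i i).
  apply: eigenvalue_diag => {}i j ji; apply: h0; first by rewrite ltn_eqF.
  by rewrite ltn_eqF // ltnS ltnW.
have r0 : 0 <= rho A by apply: le_trans (normc_le_rho (ev (Ordinal n0))); exact: normc_ge0.
split=> //; apply: opnorm_le => [|x]; first exact: addr_ge0.
pose D := \matrix_(i, j) (if i == j then A i j else 0).
pose E := \matrix_(i, j) (if (j : nat) == i.+1 then A i j else 0).
have AE : A = D + E.
  apply/matrixP => i j; rewrite !mxE; have [->|ij] := eqVneq i j.
    by rewrite ltn_eqF // addr0.
  case: eqVneq => [_|ij']; first by rewrite add0r.
  by rewrite addr0 h0 // eq_sym.
rewrite [in leLHS]AE mulmxDl mulrDl; apply: le_trans (cenormD _ _) _; apply: lerD.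
  rewrite -(@ler_pXn2r _ 2) ?nnegrE ?mulr_ge0 ?cenorm_ge0 //.
  rewrite exprMn !cenorm_sqr mulr_sumr; apply: ler_sum => i _.
  have -> : (D *m x) i 0 = A i i * x i 0.
    rewrite mxE (bigD1 i) //= mxE eqxx big1 ?addr0 // => j ji.
    by rewrite mxE eq_sym (negbTE ji) mul0r.
  rewrite normcM exprMn ler_wpM2r ?sqr_ge0 // ler_pXn2r ?nnegrE ?normc_ge0 //.
  exact: normc_le_rho.
rewrite -(@ler_pXn2r _ 2) ?nnegrE ?mulr_ge0 ?cenorm_ge0 //.
rewrite exprMn !cenorm_sqr mulr_sumr.
case: n => [|n] in A n0 h0 h1 ev r0 x D E AE *; first by [].
rewrite big_ord_recr [in leRHS]big_ord_recl /=.
have -> : (E *m x) ord_max 0 = 0.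
  rewrite mxE big1 // => j _; rewrite mxE ltn_eqF ?mul0r //=.
rewrite normc0 expr0n addr0 -[leLHS]add0r; apply: lerD.
  by rewrite mulr_ge0 ?sqr_ge0.
apply: ler_sum => i _; set i' := widen_ord _ i; set j' := lift ord0 i.
have -> : (E *m x) i' 0 = A i' j' * x j' 0.
  rewrite mxE (bigD1 j') //= mxE /= /bump add1n eqxx big1 ?addr0 // => j jj.
  rewrite mxE; case: eqVneq => [jE|_]; last by rewrite mul0r.
  by case/eqP: jj; apply: val_inj; rewrite /= jE.
rewrite normcM exprMn ler_wpM2r ?sqr_ge0 // ler_pXn2r ?nnegrE ?normc_ge0 //.
exact: h1.
Qed.

End ComplexVectors.

(** * Gradients of the stacked cost *)

Section Gradients.
Variables (R : realType) (N : nat) (m : 'I_N -> nat) (P : nat).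
Local Notation M := (\sum_k m k)%N.
Variable J : forall k, 'cV[R]_(m k) -> R.
Arguments J : clear implicits.

Lemma dot_mxcol (x y : forall k, 'cV[R]_(m k)) :
  ((\mxcol_k x k)^T *m \mxcol_k y k) 0 0 = \sum_k ((x k)^T *m y k) 0 0.
Proof. by rewrite tr_mxcol mul_mxrow_mxcol summxE. Qed.

Lemma enorm_mxcol (x : forall k, 'cV[R]_(m k)) :
  enorm (\mxcol_k x k) ^+ 2 = \sum_k enorm (x k) ^+ 2.
Proof. by rewrite enorm_dot dot_mxcol; apply: eq_bigr => k _; rewrite enorm_dot. Qed.

Lemma enorm_submxcol (x : 'cV[R]_M) :
  enorm x ^+ 2 = \sum_k enorm (submxcol x k) ^+ 2.
Proof. by rewrite -[in LHS](submxcolK x) enorm_mxcol. Qed.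

Lemma submxcolDZ (Z V : 'cV[R]_M) c k :
  submxcol (Z + c *: V) k = submxcol Z k + c *: submxcol V k.
Proof. by apply/matrixP => i j; rewrite !mxE. Qed.

Definition stacked_gradient (Z : 'cV[R]_M) : 'cV[R]_M := \mxcol_k gradient (J k) (submxcol Z k).

Definition stacked_hessian (Z : 'cV[R]_M) : 'M[R]_M := \mxdiag_k hessian (J k) (submxcol Z k).

Lemma is_derive_line n (f : 'cV[R]_n -> R) (x v : 'cV[R]_n) (t : R) :
  differentiable (f : _ -> R^o) (x + t *: v) ->
  is_derive t (1 : R) (fun s : R => f (x + s *: v) : R^o)
    (\sum_j v j 0 * 'D_(delta_mx j 0 : 'cV[R]_n) (f : _ -> R^o) (x + t *: v)).
Proof.
move=> df.
have E : (fun h : R => h^-1 *: (((fun s : R => f (x + s *: v) : R^o) \o shift t)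
            (h *: (1 : R)) - (f (x + t *: v) : R^o))) =
         (fun h : R => h^-1 *: (((f : _ -> R^o) \o shift (x + t *: v))
            (h *: v) - f (x + t *: v))).
  apply/funext => h /=; congr (_ *: (f _ - _)).
  by rewrite [h *: _]mulr1 scalerDl addrCA.
have dv : derivable (f : _ -> R^o) (x + t *: v) v by exact: diff_derivable.
apply: DeriveDef; first by rewrite /derivable E.
transitivity ('D_v (f : _ -> R^o) (x + t *: v)); first by rewrite /derive E.
have lin (D : {linear 'cV[R]_n -> R^o}) : D v = \sum_j v j 0 *: D (delta_mx j 0).
  rewrite {1}(matrix_sum_delta v) linear_sum; apply: eq_bigr => i _.
  by rewrite big_ord1 linearZ.
by rewrite deriveE // lin; apply: eq_bigr => j _; rewrite deriveE.
Qed.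

(** Stacking the agents and testing the gradient increment against a fixed
    direction Y leaves a real function of one variable, so that a single
    intermediate point serves all agents at once. *)
Lemma mean_value_gradient (Z V Y : 'cV[R]_M) :
  (forall k, twice_differentiable (J k)) ->
  exists X : 'cV[R]_M,
    (Y^T *m (stacked_gradient (Z + V) - stacked_gradient Z)) 0 0 =
    (Y^T *m stacked_hessian X *m V) 0 0.
Proof.
move=> dJ.
pose g (s : R) : R := \sum_k ((submxcol Y k)^T *m
   gradient (J k) (submxcol Z k + s *: submxcol V k)) 0 0.
pose dg (s : R) : R := \sum_k ((submxcol Y k)^T *m
   (hessian (J k) (submxcol Z k + s *: submxcol V k) *m submxcol V k)) 0 0.
have gE (s : R) : g s = (Y^T *m stacked_gradient (Z + s *: V)) 0 0.
  rewrite -[in RHS](submxcolK Y) /stacked_gradient dot_mxcol; apply: eq_bigr => k _.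
  by rewrite submxcolDZ.
have dgP (s : R) : is_derive s (1 : R) (g : R -> R^o) (dg s).
  have -> : (g : R -> R^o) = \sum_k \sum_i (fun s : R => submxcol Y k i 0 *:
      (gradient (J k) (submxcol Z k + s *: submxcol V k) i 0 : R^o)).
    apply/funext => u; rewrite /g fct_sumE; apply: eq_bigr => k _.
    by rewrite fct_sumE dotE; apply: eq_bigr => i _.
  apply: is_derive_sum => k.
  rewrite dotE; apply: is_derive_sum => i.
  apply: is_deriveZ => /=.
  apply: is_derive_eq.
    apply: (@is_derive_line _ (fun y => gradient (J k) y i 0)).
    apply: (@differentiable_comp _ _ _ _ _ (fun N : 'cV[R]_(m k) => N i 0 : R^o)).
      by case: (dJ k).
    exact: differentiable_coord.
  by rewrite [RHS]mxE; apply: eq_bigr => j _; rewrite mulrC [in RHS]mxE.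
have [|c _] := @MVT R g dg 0 1 ltr01 (fun s _ => dgP s).
  apply: continuous_subspaceT => s; apply: differentiable_continuous.
  by apply/derivable1_diffP; apply: ex_derive.
rewrite subr0 mulr1 !gE scale1r scale0r addr0 => h.
exists (Z + c *: V); rewrite mulmxBr mxE [X in _ + X]mxE h.
rewrite -mulmxA -[in RHS](submxcolK Y) /stacked_hessian.
have -> (X : 'cV[R]_M) : \mxdiag_k hessian (J k) (submxcol X k) *m V =
    \mxcol_k (hessian (J k) (submxcol X k) *m submxcol V k).
  by rewrite -[in LHS](submxcolK V) mul_mxdiag_mxcol.
rewrite dot_mxcol; apply: eq_bigr => k _.
by rewrite submxcolDZ.
Qed.

Variables (U : 'M[R]_(M, P)) (lkmin lkmax : 'I_N -> R) (lmin lmax : R).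
Hypothesis hJ : cost_assumption J U lkmin lkmax lmin lmax.

Definition stacked_lipschitz : R := \sum_k `|lkmax k|.

Lemma stacked_lipschitz_ge0 : 0 <= stacked_lipschitz.
Proof. by apply: sumr_ge0 => k _; exact: normr_ge0. Qed.

Let dJ k : twice_differentiable (J k).
Proof. by case: hJ => h _ _ _; case: (h k). Qed.

Lemma loewner_quad n (A B : 'M[R]_n) (x : 'cV[R]_n) :
  loewner_le A B -> (x^T *m A *m x) 0 0 <= (x^T *m B *m x) 0 0.
Proof. by case=> _ /(_ x); rewrite mulmxBr mulmxBl mxE [X in _ + X]mxE subr_ge0. Qed.

Lemma quad_scalar n (c : R) (x : 'cV[R]_n) : (x^T *m c%:M *m x) 0 0 = c * enorm x ^+ 2.
Proof. by rewrite mul_mx_scalar -scalemxAl mxE -enorm_dot. Qed.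

Lemma loewner_sym n (A : 'M[R]_n) c : loewner_le c%:M A -> A^T = A.
Proof.
case=> /(congr1 (fun B => B + c%:M)) h _; move: h.
by rewrite linearB /= tr_scalar_mx !subrK.
Qed.

Lemma stacked_hessian_sym Z : (stacked_hessian Z)^T = stacked_hessian Z.
Proof.
case: hJ => _ hk _ _; rewrite /stacked_hessian tr_mxdiag; congr mxdiag.
by apply: functional_extensionality_dep => k; case: (hk k) => _ /(_ (submxcol Z k))[/loewner_sym].
Qed.

Lemma stacked_hessian_quad Z (y : 'cV[R]_M) :
  0 <= (y^T *m stacked_hessian Z *m y) 0 0 <= stacked_lipschitz * enorm y ^+ 2.
Proof.
case: hJ => _ hk _ _.
rewrite -mulmxA -{1 2 3 4}(submxcolK y) /stacked_hessian mul_mxdiag_mxcol dot_mxcol enorm_submxcol.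
apply/andP; split.
  apply: sumr_ge0 => k _; case: (hk k) => l0 /(_ (submxcol Z k))[+ _].
  move/(loewner_quad (submxcol y k)); rewrite quad_scalar mulmxA; apply: le_trans.
  by rewrite mulr_ge0 ?sqr_ge0.
rewrite mulr_sumr; apply: ler_sum => k _.
case: (hk k) => l0 /(_ (submxcol Z k))[_].
move/(loewner_quad (submxcol y k)); rewrite quad_scalar mulmxA => h; apply: le_trans h _.
rewrite ler_wpM2r ?sqr_ge0 // /stacked_lipschitz (bigD1 k) //=.
by rewrite (le_trans (ler_norm _)) // lerDl; apply: sumr_ge0 => *; exact: normr_ge0.
Qed.

Lemma le_of_sqr_le n (y : 'cV[R]_n) (c : R) :
  0 <= c -> enorm y ^+ 2 <= c * enorm y -> enorm y <= c.
Proof.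
move=> c0 h; have [->//|y0] := eqVneq (enorm y) 0.
by rewrite -(@ler_pM2r _ (enorm y)) ?lt0r ?y0 ?enorm_ge0 // -expr2.
Qed.

(** The mean value theorem tested against the increment itself. *)
Lemma stacked_gradient_lipschitz (Z V : 'cV[R]_M) :
  enorm (stacked_gradient (Z + V) - stacked_gradient Z) <= stacked_lipschitz * enorm V.
Proof.
set y := _ - _; apply: le_of_sqr_le; first by rewrite mulr_ge0 ?stacked_lipschitz_ge0 ?enorm_ge0.
have [X] := mean_value_gradient Z V y dJ; rewrite -/y -enorm_dot => ->.
apply: le_trans (ler_norm _) _.
rewrite mulrAC; apply: psd_bilinear_le; [exact: stacked_hessian_sym|exact: stacked_hessian_quad|].
exact: stacked_lipschitz_ge0.
Qed.

(** One gradient step along Range(U) contracts by the strong convexity of the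
    aggregate cost on that subspace. *)
Lemma stacked_gradient_contract (mu : R) (Z : 'cV[R]_M) (x : 'cV[R]_P) :
  0 <= mu -> mu * lmax <= 1 ->
  enorm (x - mu *: (U^T *m (stacked_gradient Z - stacked_gradient (Z - U *m x)))) <=
    (1 - mu * lmin) * enorm x.
Proof.
case: hJ => _ _ /andP[l0 l1] hU mu0 mu1.
have c0 : 0 <= 1 - mu * lmin.
  by rewrite subr_ge0; apply: le_trans (ler_wpM2l mu0 l1) mu1.
set G := stacked_gradient Z - _; set y := x - _.
have [X hX] := mean_value_gradient (Z - U *m x) (U *m x) (U *m y) dJ.
rewrite subrK -/G in hX.
apply: le_of_sqr_le; first by rewrite mulr_ge0 ?enorm_ge0.
pose S := 1%:M - mu *: (U^T *m stacked_hessian X *m U).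
have -> : enorm y ^+ 2 = (y^T *m S *m x) 0 0.
  rewrite enorm_dot [in X in _ *m X]/y /S !mulmxBr mulmxBl mulmx1.
  rewrite -!scalemxAr -!scalemxAl mxE [in RHS]mxE; congr (_ + _).
  rewrite mxE [in RHS]mxE; congr (- _); rewrite mxE [in RHS]mxE; congr (_ * _).
  by rewrite -mulmxBr -/G; move: hX; rewrite trmx_mul !mulmxA => ->.
have [hl hu] := hU (fun k => submxcol X k); rewrite -/(stacked_hessian X) in hl hu.
apply: le_trans (ler_norm _) _.
rewrite mulrAC; apply: psd_bilinear_le => //.
  by rewrite /S linearB /= trmx1 linearZ /= (loewner_sym hl).
move=> z; rewrite /S mulmxBr mulmx1 mulmxBl -scalemxAr -scalemxAl.
rewrite mxE -enorm_dot [X in _ + X]mxE [X in _ - X]mxE.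
have := loewner_quad z hl; have := loewner_quad z hu; rewrite !quad_scalar.
set q := (z^T *m _ *m _) 0 0; have := sqr_ge0 (enorm z); set e := _ ^+ 2 => e0 q1 q2.
apply/andP; split.
  by rewrite subr_ge0; apply: le_trans (ler_wpM2l mu0 q1) _; rewrite mulrA ler_piMl.
by rewrite mulrBl mul1r lerD2l lerN2 -mulrA ler_wpM2l.
Qed.

(** First-order optimality: along each direction U y the aggregate cost is a
    differentiable function of one variable with a minimum at 0. *)
Lemma stacked_gradient_optimal (wo : forall k, 'cV[R]_(m k)) :
  unique_minimizer J U wo -> U^T *m stacked_gradient (\mxcol_k wo k) = 0.
Proof.
move=> [[x0 wox0] minw].
suff h (y : 'cV[R]_P) : (y^T *m (U^T *m stacked_gradient (\mxcol_k wo k))) 0 0 = 0.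
  have : enorm (U^T *m stacked_gradient (\mxcol_k wo k)) ^+ 2 = 0 by rewrite enorm_dot h.
  rewrite enorm_sqr => /eqP; rewrite psumr_eq0 => [/allP h0|i _]; last exact: sqr_ge0.
  apply/matrixP => i j; rewrite ord1 [RHS]mxE.
  by have := h0 i (mem_index_enum _); rewrite sqrf_eq0 => /eqP.
rewrite mulmxA -trmx_mul; set v := U *m y.
pose f (s : R) : R := \sum_k J k (wo k + s *: submxcol v k).
have df (s : R) : is_derive s (1 : R) (f : R -> R^o)
    (\sum_k \sum_j submxcol v k j 0 *
      'D_(delta_mx j 0 : 'cV[R]_(m k)) (J k : _ -> R^o) (wo k + s *: submxcol v k)).
  have -> : (f : R -> R^o) = \sum_k (fun s => J k (wo k + s *: submxcol v k) : R^o).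
    by apply/funext => u; rewrite fct_sumE.
  apply: is_derive_sum => k; apply: is_derive_line.
  by case: (dJ k).
have : is_derive (0 : R) 1 (f : R -> R^o) (0 : R).
  apply: (@derive1_at_min _ f (-1) 1).
  - by lra.
  - by move=> t _; apply: ex_derive.
  - by rewrite in_itv /=; apply/andP; split; lra.
  - move=> t _; have fE (s : R) : \mxcol_k (wo k + s *: submxcol v k) = \mxcol_k wo k + s *: v.
      by rewrite -[in RHS](submxcolK v); apply/matrixP => i j; rewrite !mxE.
    have f0 : f 0 = \sum_k J k (wo k).
      by apply: eq_bigr => k _; rewrite scale0r addr0.
    rewrite f0.
    have [e|/eqP ne] := eqVneq (\mxcol_k (wo k + t *: submxcol v k)) (\mxcol_k wo k).
      rewrite le_eqVlt; apply/orP; left; apply/eqP; apply: eq_bigr => k _.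
      by have := congr1 (fun X => submxcol X k) e; rewrite !mxcolK => ->.
    apply: ltW; apply: minw => //.
    by rewrite /in_range fE wox0; exists (x0 + t *: y); rewrite mulmxDr -scalemxAr.
move/(@derive_val _ _ _ _ _ _ _); have := df 0; move/(@derive_val _ _ _ _ _ _ _) => -> h.
rewrite -(submxcolK v) /stacked_gradient dot_mxcol -[RHS]h; apply: eq_bigr => k _.
rewrite dotE; apply: eq_bigr => j _; rewrite scale0r addr0 mxcolK; congr (_ * _).
by rewrite mxE.
Qed.

End Gradients.

(** * Continuous functions of random vectors *)

Section ContinuousMeasurable.
Context d (T : measurableType d) (R : realType).

Let grid (n k : nat) (v : 'cV[int]_n) : 'cV[R]_n := \col_j ((v j 0)%:~R / k.+1%:R).

Let cell (n k : nat) (x : 'cV[R]_n) : 'cV[int]_n := \col_j Num.floor (k.+1%:R * x j 0).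

Let grid_cell_close n k (x : 'cV[R]_n) j :
  `|x j 0 - grid k (cell k x) j 0| <= k.+1%:R^-1.
Proof.
rewrite !mxE; have k0 : 0 < k.+1%:R :> R by [].
have -> : x j 0 - (Num.floor (k.+1%:R * x j 0))%:~R / k.+1%:R =
   (k.+1%:R * x j 0 - (Num.floor (k.+1%:R * x j 0))%:~R) / k.+1%:R.
  by rewrite mulrBl [k.+1%:R * _ / _]mulrAC divff ?gt_eqF // mul1r.
rewrite normrM normfV [X in _ / X]gtr0_norm // ler_pdivrMr // mulVf ?gt_eqF //.
have /andP[h1 h2] := floor_itv (k.+1%:R * x j 0).
rewrite ger0_norm ?subr_ge0 // lerBlDr; apply: ltW; apply: lt_le_trans h2 _.
by rewrite intrD addrC.
Qed.

(** Rounding to the grid of mesh 1/(k+1) makes the argument countably valued, so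
    the composite is a pointwise limit of measurable functions. *)
Lemma measurable_continuous_comp n (X : T -> 'cV[R]_n) (g : 'cV[R]_n -> R) :
  (forall j, measurable_fun [set: T] (fun t => X t j 0)) ->
  continuous (g : _ -> R^o) -> measurable_fun [set: T] (fun t => g (X t)).
Proof.
move=> mX cg.
apply: (@measurable_fun_cvg _ _ _ _ (fun k t => g (grid k (cell k (X t))))).
  move=> k _ B mB; rewrite setTI.
  have -> : (fun t => g (grid k (cell k (X t)))) @^-1` B =
      \bigcup_(v : 'cV[int]_n) ([set _ | B (g (grid k v))] `&`
         \bigcap_(j in [set: 'I_n]) [set t | Num.floor (k.+1%:R * X t j 0) = v j 0]).
    apply/seteqP; split=> t /=.
      by move=> Bt; exists (cell k (X t)) => //; split=> // j _ /=; rewrite mxE.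
    move=> [v _ [Bv h]]; suff -> : cell k (X t) = v by [].
    by apply/matrixP => i j; rewrite ord1 mxE; exact: h.
  apply: countable_bigcupT_measurable; first exact: countableP.
  move=> v; apply: measurableI.
    have [Bv|nBv] := pselect (B (g (grid k v))).
      by rewrite (_ : [set _ | _] = setT) //; apply/seteqP; split.
    by rewrite (_ : [set _ | _] = set0) //; apply/seteqP; split.
  apply: fin_bigcap_measurable; first by apply: finite_finset.
  move=> j _.
  have -> : [set t | Num.floor (k.+1%:R * X t j 0) = v j 0] =
     (fun t => X t j 0) @^-1`
       `[(v j 0)%:~R / k.+1%:R, ((v j 0) + 1)%:~R / k.+1%:R[%classic.
    apply/seteqP; split=> t /=; rewrite in_itv /= ler_pdivrMr // ltr_pdivlMr //
       [_ * k.+1%:R]mulrC.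
      by move=> <-; exact: floor_itv.
    by move=> h; apply: floor_def.
  by rewrite -[X in measurable X]setTI; apply: mX => //; exact: measurable_itv.
move=> t _; apply: (@cvg_comp _ _ _ (fun k => grid k (cell k (X t))) (g : _ -> R^o) _
   (nbhs (X t))); last exact: cg.
apply/cvgrPdist_le => /= e e0.
near=> k; rewrite /Num.Def.normr /= mx_normrE; apply: bigmax_le; first exact: ltW.
move=> [i j] _ /=; rewrite ord1 !mxE.
have := grid_cell_close k (X t) i; rewrite !mxE => h; apply: le_trans h _.
apply: ltW; near: k; exact: (near_infty_natSinv_lt (PosNum e0)).
Unshelve. all: by end_near. Qed.

End ContinuousMeasurable.

(** * First and second moments *)

Section Moments.
Context d (T : measurableType d) (R : realType) (Pr : probability T R).

Implicit Types (X Y : T -> R) (c : R).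

Definition integrableR (X : T -> R) := Pr.-integrable [set: T] (EFin \o X).

Definition mean (X : T -> R) : R := Rintegral Pr [set: T] X.

Lemma expectation_mean X : integrableR X -> ('E_Pr[X] = (mean X)%:E)%E.
Proof. by move=> iX; rewrite unlock /mean /Rintegral fineK // integrable_fin_num. Qed.

Lemma integrableR_meas X : integrableR X -> measurable_fun [set: T] X.
Proof. by move=> /measurable_int/measurable_EFinP. Qed.

Lemma eq_integrableR X Y : X =1 Y -> integrableR X -> integrableR Y.
Proof. by move=> /funext ->. Qed.

Lemma eq_mean X Y : X =1 Y -> mean X = mean Y.
Proof. by move=> /funext ->. Qed.

Lemma integrableR_le X Y : measurable_fun [set: T] X -> (forall t, `|X t| <= Y t) ->
  integrableR Y -> integrableR X.
Proof.
move=> mX XY; apply: le_integrable => //; first exact/measurable_EFinP.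
by move=> t _ /=; rewrite lee_fin; apply: le_trans (XY t) (ler_norm _).
Qed.

Lemma integrableR_cst c : integrableR (fun _ => c).
Proof.
apply: (@finite_measure_integrable_cst _ _ _ Pr setT c).
exact: measurableT.
Qed.

Lemma integrableRD X Y : integrableR X -> integrableR Y -> integrableR (fun t => X t + Y t).
Proof. by move=> iX iY; apply: eq_integrable (integrableD _ iX iY). Qed.

Lemma integrableRZ c X : integrableR X -> integrableR (fun t => c * X t).
Proof. by move=> iX; apply: eq_integrable (integrableZl _ c iX). Qed.

Lemma integrableR_sum I (s : seq I) (X : I -> T -> R) :
  (forall i, integrableR (X i)) -> integrableR (fun t => \sum_(i <- s) X i t).
Proof.
move=> iX; apply: (@eq_integrable _ _ _ _ _ _ (fun t => \sum_(i <- s) (X i t)%:E)%E) => //.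
  by move=> t _; rewrite /= sumEFin.
by apply: integrable_sum => // i _; exact: iX.
Qed.

Lemma mean_cst c : mean (fun _ => c) = c.
Proof.
by rewrite /mean Rintegral_cst //= (_ : Pr setT = 1%E) ?mulr1 // probability_setT.
Qed.

Lemma meanD X Y : integrableR X -> integrableR Y -> mean (fun t => X t + Y t) = mean X + mean Y.
Proof. by move=> iX iY; rewrite /mean RintegralD. Qed.

Lemma meanZ c X : integrableR X -> mean (fun t => c * X t) = c * mean X.
Proof. by move=> iX; rewrite /mean RintegralZl. Qed.

Lemma mean_sum I (s : seq I) (X : I -> T -> R) : (forall i, integrableR (X i)) ->
  mean (fun t => \sum_(i <- s) X i t) = \sum_(i <- s) mean (X i).
Proof.
move=> iX; elim: s => [|i s IH].
  by under eq_mean do rewrite big_nil; rewrite mean_cst big_nil.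
under eq_mean do rewrite big_cons.
by rewrite meanD ?IH ?big_cons //; exact: integrableR_sum.
Qed.

Lemma le_mean X Y : integrableR X -> integrableR Y -> (forall t, X t <= Y t) -> mean X <= mean Y.
Proof. by move=> iX iY XY; apply: le_Rintegral. Qed.

Lemma mean_ge0 X : (forall t, 0 <= X t) -> 0 <= mean X.
Proof. by move=> X0; apply: Rintegral_ge0. Qed.

(** * Square-integrable random vectors *)

Definition sqint (X : T -> R) :=
  measurable_fun [set: T] X /\ integrableR (fun t => X t ^+ 2).

Lemma sqint_mul X Y : sqint X -> sqint Y -> integrableR (fun t => X t * Y t).
Proof.
move=> [mX iX] [mY iY]; apply: (@integrableR_le _ (fun t => X t ^+ 2 + Y t ^+ 2)).
- exact: measurable_funM.
- move=> t; rewrite ler_norml; nra.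
- exact: integrableRD.
Qed.

Lemma sqintD X Y : sqint X -> sqint Y -> sqint (fun t => X t + Y t).
Proof.
move=> sX sY; have [[mX iX] [mY iY]] := (sX, sY); split; first exact: measurable_funD.
apply: (@eq_integrableR (fun t => X t ^+ 2 + Y t ^+ 2 + 2 * (X t * Y t))) => [t|]; first ring.
by apply: integrableRD; [exact: integrableRD|apply: integrableRZ; exact: sqint_mul].
Qed.

Lemma sqintZ c X : sqint X -> sqint (fun t => c * X t).
Proof.
move=> [mX iX]; split; first by apply: measurable_funM.
by apply: (@eq_integrableR (fun t => c ^+ 2 * X t ^+ 2)) (integrableRZ _ iX) => t; rewrite exprMn.
Qed.

Lemma sqint_cst c : sqint (fun _ => c).
Proof. by split; [exact: measurable_cst|exact: integrableR_cst]. Qed.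

Lemma sqint_sum I (s : seq I) (X : I -> T -> R) :
  (forall i, sqint (X i)) -> sqint (fun t => \sum_(i <- s) X i t).
Proof.
move=> sX; elim: s => [|i s IH].
  by under eq_fun do rewrite big_nil; exact: sqint_cst.
by under eq_fun do rewrite big_cons; exact: sqintD.
Qed.

Definition sqvec n (X : T -> 'cV[R]_n) := forall j, sqint (fun t => X t j 0).

Lemma sqvec_cst n (x : 'cV[R]_n) : sqvec (fun _ => x).
Proof. by move=> j; exact: sqint_cst. Qed.

Lemma sqvecD n (X Y : T -> 'cV[R]_n) : sqvec X -> sqvec Y -> sqvec (fun t => X t + Y t).
Proof.
move=> sX sY j; have := sqintD (sX j) (sY j).
by congr sqint; apply/funext => t; rewrite mxE.
Qed.

Lemma sqvecZ n c (X : T -> 'cV[R]_n) : sqvec X -> sqvec (fun t => c *: X t).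
Proof.
by move=> sX j; have := sqintZ c (sX j); congr sqint; apply/funext => t; rewrite mxE.
Qed.

Lemma sqvecB n (X Y : T -> 'cV[R]_n) : sqvec X -> sqvec Y -> sqvec (fun t => X t - Y t).
Proof.
move=> sX sY; have := sqvecD sX (sqvecZ (-1) sY).
by congr sqvec; apply/funext => t; rewrite scaleN1r.
Qed.

Lemma sqvec_mul n p (B : 'M[R]_(p, n)) (X : T -> 'cV[R]_n) :
  sqvec X -> sqvec (fun t => B *m X t).
Proof.
move=> sX j; have := sqint_sum (index_enum 'I_n) (fun i => sqintZ (B j i) (sX i)).
by congr sqint; apply/funext => t; rewrite mxE.
Qed.

Lemma sqvec_integrableR n (X : T -> 'cV[R]_n) : sqvec X -> integrableR (fun t => enorm (X t) ^+ 2).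
Proof.
move=> sX; apply: eq_integrableR (integrableR_sum _ (fun j => (sX j).2)) => t.
by rewrite enorm_sqr.
Qed.

Lemma random_vector_enorm n (X : T -> 'cV[R]_n) : random_vector X ->
  measurable_fun [set: T] (fun t => enorm (X t) ^+ 2).
Proof.
move=> mX; under eq_fun do rewrite enorm_sqr.
by apply: measurable_sum => j; apply: measurable_funX.
Qed.

Lemma sqvec_of_integrableR n (X : T -> 'cV[R]_n) : random_vector X ->
  integrableR (fun t => enorm (X t) ^+ 2) -> sqvec X.
Proof.
move=> mX iX j; split; first exact: mX.
apply: integrableR_le iX; first by apply: measurable_funX.
move=> t; rewrite ger0_norm ?sqr_ge0 // enorm_sqr (bigD1 j) //= lerDl.
by apply: sumr_ge0 => i _; exact: sqr_ge0.
Qed.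

Definition uncorrelated n p (X : T -> 'cV[R]_n) (Z : T -> 'cV[R]_p) :=
  forall i j, mean (fun t => X t i 0 * Z t j 0) = 0.

(** Expanding the square, the cross term is a linear combination of the
    correlations of the coordinates. *)
Lemma mean_pythagoras n p (B : 'M[R]_(p, n)) (X Z : T -> 'cV[R]_n) :
  sqvec X -> sqvec Z -> uncorrelated X Z ->
  mean (fun t => enorm (B *m (X t + Z t)) ^+ 2) =
  mean (fun t => enorm (B *m X t) ^+ 2) + mean (fun t => enorm (B *m Z t) ^+ 2).
Proof.
move=> sX sZ XZ.
have sBX := sqvec_mul B sX; have sBZ := sqvec_mul B sZ.
pose c t := \sum_a \sum_i \sum_j (B a i * B a j) * (X t i 0 * Z t j 0).
have ic a i j : integrableR (fun t => (B a i * B a j) * (X t i 0 * Z t j 0)).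
  by apply: integrableRZ; apply: sqint_mul.
have ic1 a i : integrableR (fun t => \sum_j (B a i * B a j) * (X t i 0 * Z t j 0)).
  exact: integrableR_sum.
have ic2 a : integrableR (fun t => \sum_i \sum_j (B a i * B a j) * (X t i 0 * Z t j 0)).
  exact: integrableR_sum.
have ic3 : integrableR c by exact: integrableR_sum.
have c0 : mean c = 0.
  rewrite /c mean_sum // big1 // => a _; rewrite mean_sum // big1 // => i _.
  by rewrite mean_sum // big1 // => j _; rewrite meanZ ?XZ ?mulr0 //; exact: sqint_mul.
have -> : mean (fun t => enorm (B *m (X t + Z t)) ^+ 2) =
  mean (fun t => enorm (B *m X t) ^+ 2 + enorm (B *m Z t) ^+ 2 + 2 * c t).
  apply: eq_mean => t; rewrite mulmxDr !enorm_sqr /c mulr_sumr -!big_split /=.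
  apply: eq_bigr => a _; rewrite mxE sqrrD addrAC; congr (_ + _).
  congr (_ + _); rewrite -mulr_natl; congr (_ * _).
  rewrite !mxE mulr_suml; apply: eq_bigr => i _; rewrite mulr_sumr; apply: eq_bigr => j _.
  by rewrite mulrACA.
have i1 := sqvec_integrableR sBX; have i2 := sqvec_integrableR sBZ.
by rewrite meanD ?meanD ?meanZ ?c0 ?mulr0 ?addr0 //; [exact: integrableRD|exact: integrableRZ].
Qed.

(** * Conditional expectation *)

Section Conditional.
Variable G0 : set (set T).
Hypothesis G0m : <<s G0 >> `<=` (measurable : set (set T)).
Local Notation T' := (g_sigma_algebraType G0).

Definition meas_wrt (Y : T -> R) := measurable_fun [set: T'] (Y : T' -> R).

Lemma meas_wrt_measurable Y : meas_wrt Y -> measurable_fun [set: T] Y.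
Proof.
by move=> mY _ B mB; rewrite setTI; apply: G0m; have := mY measurableT B mB; rewrite setTI.
Qed.

Let orth (X h : T -> R) := integrableR (fun t => h t * X t) /\ mean (fun t => h t * X t) = 0.

Let orth_lin X I (s : seq I) (c : I -> R) (h : I -> T -> R) :
  (forall i, orth X (h i)) -> orth X (fun t => \sum_(i <- s) c i * h i t).
Proof.
move=> oh.
have E : (fun t => (\sum_(i <- s) c i * h i t) * X t) =1
         (fun t => \sum_(i <- s) c i * (h i t * X t)).
  by move=> t; rewrite mulr_suml; apply: eq_bigr => i _; rewrite mulrA.
split.
  apply: eq_integrableR (fsym E) _; apply: integrableR_sum => i; apply: integrableRZ.
  by case: (oh i).
rewrite (eq_mean E) mean_sum => [|i]; last by apply: integrableRZ; case: (oh i).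
by rewrite big1 // => i _; case: (oh i) => h1 h2; rewrite meanZ // h2 mulr0.
Qed.

Let orth_indic X E : integrableR X -> <<s G0 >> E ->
  (\int[Pr]_(t in E) (X t)%:E = 0)%E -> orth X (\1_E).
Proof.
move=> iX GE h; have mE := G0m GE.
have EE : (fun t => (\1_E t * X t)%:E) = (fun t => ((X t)%:E * (\1_E t)%:E)%E).
  by apply/funext => t; rewrite -EFinM mulrC.
split.
  apply: integrableR_le (integrable_norm iX) => [|t].
    by apply: measurable_funM; [exact: measurable_indic|exact: integrableR_meas].
  rewrite normrM ler_piMl // indicE; case: (_ \in _); by rewrite ?normr1 ?normr0.
rewrite /mean /Rintegral EE.
by rewrite integral_mkcond epatch_indic in h; rewrite h.
Qed.

(** Step functions of the conditioning sigma-algebra are orthogonal to X by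
    definition; dominated convergence along dyadic approximations does the rest. *)
Let orth_ge0 (X Y : T -> R) : integrableR X ->
  (forall E, <<s G0 >> E -> (\int[Pr]_(t in E) (X t)%:E = 0)%E) ->
  (forall t, 0 <= Y t) -> meas_wrt Y -> integrableR (fun t => Y t * X t) ->
  mean (fun t => Y t * X t) = 0.
Proof.
move=> iX hX Y0 mY iYX.
pose f : T' -> \bar R := fun t => (Y t)%:E.
have mf : measurable_fun [set: T'] f by exact/measurable_EFinP.
pose a n : T -> R := approx [set: T'] f n.
have f0 (t : T') : [set: T'] t -> (0 <= f t)%E by rewrite lee_fin.
have a_le n t : a n t <= Y t by rewrite -lee_fin; exact: (le_approx n f0).
have a_ge0 n t : 0 <= a n t.
  rewrite /a /approx; apply: addr_ge0.
    by apply: sumr_ge0 => i _; rewrite !mulr_ge0 // ?invr_ge0 ?exprn_ge0.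
  by rewrite mulr_ge0.
have a_cvg t : a ^~ t @ \oo --> Y t by exact: (cvg_approx f0 _ (ltry _)).
have oa n : orth X (a n).
  have -> : a n = (fun t => \sum_(i <- None :: map Some (index_enum 'I_(n * 2 ^ n)%N))
     (if i is Some k then k%:R * 2 ^- n else n%:R) *
     (if i is Some k then \1_(dyadic_approx [set: T'] f n k) t
      else \1_(integer_approx [set: T'] f n) t)).
    by apply/funext => t; rewrite big_cons big_map addrC.
  have gA k : <<s G0 >> (dyadic_approx [set: T'] f n k).
    rewrite /dyadic_approx; case: ifPn => _; last exact: (@measurable0 _ T').
    rewrite -preimage_comp; apply: mf => //; apply/measurable_image_EFin.
    exact: measurable_itv.
  have gB : <<s G0 >> (integer_approx [set: T'] f n).
    by apply: (emeasurable_fun_c_infty (measurableT : measurable [set: T']) mf).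
  by apply: orth_lin => -[k|]; apply: orth_indic => //; apply: hX.
have := @dominated_convergence _ _ _ Pr setT measurableT
  (fun n t => (a n t * X t)%:E) (fun t => (Y t * X t)%:E) (fun t => `|(Y t * X t)%:E|%E).
case.
- by move=> n; have [/measurable_int] := oa n.
- by have /measurable_int := iYX.
- apply: aeW => t _; apply: cvg_EFin; first by near=> n.
  by apply: cvgMl; exact: a_cvg.
- exact: integrable_abse.
- apply: aeW => t n _ /=; rewrite lee_fin !normrM ler_wpM2r //.
  by rewrite !ger0_norm.
move=> _ _; rewrite (_ : [sequence _]_n = (fun _ => 0%E)) => [h|]; last first.
  apply/funext => n /=; have [i1 m0] := oa n.
  by rewrite -[LHS]fineK ?integrable_fin_num //; move: m0; rewrite /mean /Rintegral => ->.
rewrite /mean /Rintegral.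
suff -> : (\int[Pr]_x (Y x * X x)%:E = 0)%E by [].
exact: (cvg_unique _ h (cvg_cst _)).
Unshelve. all: by end_near. Qed.

(** The way in which conditional centering enters: Y is split into its positive and
    negative parts to reduce to orth_ge0. *)
Lemma condexp0_orth (X Y : T -> R) : integrableR X ->
  (forall E, <<s G0 >> E -> (\int[Pr]_(t in E) (X t)%:E = 0)%E) ->
  meas_wrt Y -> integrableR (fun t => Y t * X t) ->
  mean (fun t => Y t * X t) = 0.
Proof.
move=> iX hX mY iYX; have mX := integrableR_meas iX.
pose Yp t := Num.max (Y t) 0; pose Yn t := Num.max (- Y t) 0.
have mYp : meas_wrt Yp by apply: measurable_maxr => //; exact: measurable_cst.
have mYn : meas_wrt Yn.
  by apply: measurable_maxr; [exact: measurableT_comp|exact: measurable_cst].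
have iP (Z : T -> R) : meas_wrt Z -> (forall t, `|Z t| <= `|Y t|) ->
    integrableR (fun t => Z t * X t).
  move=> mZ ZY; apply: integrableR_le (integrable_norm iYX) => [|t].
    by apply: measurable_funM => //; exact: meas_wrt_measurable.
  by rewrite /= !normrM ler_wpM2r.
have ip : integrableR (fun t => Yp t * X t).
  apply: iP => // t; rewrite /Yp; case: (leP (Y t) 0) => h; rewrite ?normr0 //.
have in' : integrableR (fun t => Yn t * X t).
  apply: iP => // t; rewrite /Yn; case: (leP (- Y t) 0) => h; rewrite ?normr0 ?normrN //.
have -> : mean (fun t => Y t * X t) = mean (fun t => Yp t * X t + (-1) * (Yn t * X t)).
  apply: eq_mean => t; rewrite mulN1r -mulrBl; congr (_ * _).
  by rewrite /Yp /Yn; case: (leP (Y t)); case: (leP (- Y t)); lra.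
rewrite meanD ?meanZ //; last exact: integrableRZ.
rewrite !orth_ge0 ?mulr0 ?addr0 //.
  by move=> t; rewrite /Yn le_max lexx orbT.
by move=> t; rewrite /Yp le_max lexx orbT.
Qed.

Lemma condexp_vec0_uncorrelated n p (X : T -> 'cV[R]_n) (Z : T -> 'cV[R]_p) :
  sqvec X -> (forall i, meas_wrt (fun t => X t i 0)) -> sqvec Z ->
  condexp_vec0 Pr <<s G0 >> Z -> uncorrelated X Z.
Proof.
move=> sX mX sZ cZ i j; have [_ _ _ h] := cZ j.
apply: condexp0_orth => //; last exact: sqint_mul.
- apply: eq_integrableR (sqint_mul (sZ j) (sqint_cst 1)) => t; by rewrite mulr1.
- by move=> E GE; rewrite -h // integral0.
Qed.

(** A conditional expectation has the mean of X as its integral over the whole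
    space, finite or not; an integrable bound on it yields finiteness as well. *)
Lemma condexp_le (X B : T -> R) (Z : T -> \bar R) :
  measurable_fun [set: T] X -> (forall t, 0 <= X t) -> (forall t, 0 <= B t) -> integrableR B ->
  is_condexp Pr <<s G0 >> (fun t => (X t)%:E) Z ->
  {ae Pr, forall t, (Z t <= (B t)%:E)%E} ->
  integrableR X /\ mean X <= mean B.
Proof.
move=> mX X0 B0 iB [_ qZ _ hZ] ZB.
have mZ : measurable_fun setT Z by case: qZ => [/measurable_int|[]].
have GT : <<s G0 >> setT by exact: (@measurableT _ T').
have le1 : (\int[Pr]_t (X t)%:E <= \int[Pr]_t (B t)%:E)%E.
  rewrite -hZ // integralE.
  apply: (@le_trans _ _ (\int[Pr]_t (Z ^\+ t))%E).
    rewrite geeDl // oppe_le0; apply: integral_ge0 => t _; exact: funeneg_ge0.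
  apply: ae_ge0_le_integral => //.
  - exact: measurable_funepos.
  - by move=> t _; rewrite lee_fin.
  - by apply/measurable_EFinP; exact: integrableR_meas.
  - apply: filterS ZB => t h _; by rewrite funeposE ge_max h lee_fin B0.
have fB : (\int[Pr]_t (B t)%:E < +oo)%E by rewrite ltey_eq integrable_fin_num.
have iX : integrableR X.
  apply/integrableP; split; first exact/measurable_EFinP.
  under eq_integral do rewrite /= ger0_norm //.
  exact: le_lt_trans le1 fB.
split=> //; rewrite /mean /Rintegral; apply: fine_le => //; exact: integrable_fin_num.
Qed.

End Conditional.
End Moments.

(** * Nonnegative systems of dimension two *)

Section TwoByTwo.
Variable R : realType.

(** Finitely many smallness conditions become one threshold on the step-size. *)
Lemma small_step (s : seq (R * R)) :
  all (fun p => (0 <= p.1) && (0 < p.2)) s ->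
  exists2 mu0 : R, 0 < mu0 &
    forall mu, 0 < mu -> mu <= mu0 -> all (fun p => p.1 * mu <= p.2) s.
Proof.
elim: s => [|[c e] s IH] /=; first by exists 1.
move=> /andP[/andP[c0 e0] /IH[mu0 mu0p h]].
exists (Num.min mu0 (e / (c + 1))).
  by rewrite lt_min mu0p divr_gt0 // ltr_wpDl.
move=> mu mup; rewrite le_min => /andP[h1 h2]; rewrite h // andbT.
have c1 : 0 < c + 1 by rewrite ltr_wpDl.
move: h2; rewrite ler_pdivlMr // => h2; nra.
Qed.

Definition mx2 (a b c d : R) : 'M[R]_2 :=
  \matrix_(i, j) (if i == 0 then if j == 0 then a else b
                  else if j == 0 then c else d).

Lemma mulrv2 n (v : 'rV[R[i]]_2) (B : 'M[R[i]]_(2, n)) j :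
  (v *m B) 0 j = v 0 0 * B 0 j + v 0 1 * B 1 j.
Proof.
rewrite mxE big_ord_recl big_ord1; congr (_ + v _ _ * B _ _); exact: val_inj.
Qed.

Import ComplexField.Normc.

(** A nonnegative matrix is bounded by its weighted maximal column sums. *)
Lemma normc_eigenvalue2 (a b c d s B : R) (l : R[i]) :
  0 <= a -> 0 <= b -> 0 <= c -> 0 <= d -> 0 < s ->
  a + s * c <= B -> d + b / s <= B ->
  eigenvalue (toC (mx2 a b c d)) l -> normc l <= B.
Proof.
move=> a0 b0 c0 d0 s0 h1 h2 /eigenvalueP[v vE v0].
have e0 := congr1 (fun w : 'rV_2 => w 0 0) vE.
have e1 := congr1 (fun w : 'rV_2 => w 0 1) vE.
rewrite /= mulrv2 !mxE /= in e0; rewrite /= mulrv2 !mxE /= in e1.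
set x := normc (v 0 0); set y := normc (v 0 1).
have x0 : 0 <= x by exact: normc_ge0.
have y0 : 0 <= y by exact: normc_ge0.
have nr (z : R) : 0 <= z -> normc (real_complex R z) = z.
  by move=> z0; rewrite normc_real ger0_norm.
have f0 : normc l * x <= a * x + c * y.
  rewrite -normcM -e0; apply: le_trans (le_normcD _ _) _.
  by rewrite !normcM !nr // [x * _]mulrC [y * _]mulrC.
have f1 : normc l * y <= b * x + d * y.
  rewrite -normcM -e1; apply: le_trans (le_normcD _ _) _.
  by rewrite !normcM !nr // [x * _]mulrC [y * _]mulrC.
have xy : 0 < x + y.
  rewrite lt0r addr_ge0 // andbT; apply: contra v0 => /eqP xy0.
  have [x00 y00] : x = 0 /\ y = 0 by split; lra.
  apply/eqP/matrixP => i j; rewrite ord1 mxE.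
  have [->|->] : j = 0 \/ j = 1.
    by case: j => -[|[|//]] ?; [left|right]; apply: val_inj.
    exact: eq0_normc x00.
  exact: eq0_normc y00.
have l0 := normc_ge0 l; set q := b / s in h2; have bE : b = q * s by rewrite /q divfK // gt_eqF.
have q0 : 0 <= q by rewrite divr_ge0 // ltW.
rewrite bE in f1; have [ys|ys] := leP y (s * x).
  have xp : 0 < x by nra.
  rewrite -(ler_pM2r xp); apply: le_trans f0 _; nra.
have yp : 0 < y by nra.
rewrite -(ler_pM2r yp); apply: le_trans f1 _; nra.
Qed.

(** The larger root of the characteristic polynomial; for b c > 0 it has the
    positive left eigenvector (c, l - a). *)
Lemma perron2 (a b c d : R) : 0 <= a -> 0 < b -> 0 < c -> 0 <= d ->
  exists l : R, [/\ 0 <= l, a < l, (l - a) * (l - d) = b * c &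
    eigenvalue (toC (mx2 a b c d)) (real_complex R l)].
Proof.
move=> a0 b0 c0 d0; have bc : 0 < b * c by exact: mulr_gt0.
pose r := Num.sqrt ((a - d) ^+ 2 + 4 * (b * c)).
have r2 : r ^+ 2 = (a - d) ^+ 2 + 4 * (b * c).
  by rewrite sqr_sqrtr // addr_ge0 ?sqr_ge0 // mulr_ge0 // ltW.
have r0 : 0 <= r by exact: sqrtr_ge0.
pose l := (a + d + r) / 2.
have lE : 2 * l = a + d + r by rewrite /l; field.
have ll : (l - a) * (l - d) = b * c by nra.
have al : a < l by nra.
exists l; split=> //; first by lra.
rewrite /toC eigenvalue_map; apply/eigenvalueP.
exists (\row_j (if j == 0 then c else l - a)); last first.
  by apply/eqP => /matrixP /(_ 0 0); rewrite !mxE /= => c00; move: c0; rewrite c00 ltxx.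
apply/matrixP => i j; rewrite ord1 [RHS]mxE mxE big_ord_recl big_ord1 !mxE /=.
by case: ifP => _; [ring|nra].
Qed.

(** Subtracting a supersolution and taking positive parts leaves a homogeneous
    recursion, which the positive left eigenvector turns into a scalar one. *)
Lemma decay2 (a b c d e f p1 p2 l : R) (x y : nat -> R) :
  0 <= a -> 0 < b -> 0 < c -> 0 <= d -> a < l -> (l - a) * (l - d) = b * c ->
  a * p1 + b * p2 + e <= p1 -> c * p1 + d * p2 + f <= p2 ->
  (forall i, x i.+1 <= a * x i + b * y i + e) ->
  (forall i, y i.+1 <= c * x i + d * y i + f) ->
  exists2 C, 0 <= C & forall i, x i + y i <= C * l ^+ i + (p1 + p2).
Proof.
move=> a0 b0 c0 d0 al ll h1 h2 hx hy.
pose g i := Num.max 0 (x i - p1); pose h i := Num.max 0 (y i - p2).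
have g0 i : 0 <= g i by rewrite le_max lexx.
have h0 i : 0 <= h i by rewrite le_max lexx.
have gx i : x i - p1 <= g i by rewrite le_max lexx orbT.
have hy' i : y i - p2 <= h i by rewrite le_max lexx orbT.
have gS i : g i.+1 <= a * g i + b * h i.
  rewrite ge_max addr_ge0 ?mulr_ge0 ?(ltW b0) //=.
  have := hx i; have := ler_wpM2l a0 (gx i); have := ler_wpM2l (ltW b0) (hy' i); lra.
have hS i : h i.+1 <= c * g i + d * h i.
  rewrite ge_max addr_ge0 ?mulr_ge0 ?(ltW c0) //=.
  have := hy i; have := ler_wpM2l (ltW c0) (gx i); have := ler_wpM2l d0 (hy' i); lra.
pose u := l - a; have u0 : 0 < u by rewrite subr_gt0.
have l0 : 0 <= l by lra.
pose W := c * g 0%N + u * h 0%N.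
have W0 : 0 <= W by rewrite addr_ge0 // mulr_ge0 // ltW.
have key i : c * g i + u * h i <= W * l ^+ i.
  elim: i => [|i IH]; first by rewrite expr0 mulr1.
  rewrite exprSr mulrA; apply: le_trans (ler_wpM2r l0 IH).
  have := ler_wpM2l (ltW c0) (gS i); have := ler_wpM2l (ltW u0) (hS i).
  have -> : (c * g i + u * h i) * l = c * (a * g i + b * h i) + u * (c * g i + d * h i).
    by rewrite /u; transitivity (c * g i * l + ((l - a) * (l - d) + (l - a) * d) * h i);
      [ring|rewrite ll; ring].
  lra.
exists (W / c + W / u); first by rewrite addr_ge0 // divr_ge0 // ltW.
move=> i; rewrite mulrDl.
have k1 : g i <= W / c * l ^+ i.
  rewrite mulrAC ler_pdivlMr // mulrC; apply: le_trans (key i).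
  by rewrite lerDl mulr_ge0 // ltW.
have k2 : h i <= W / u * l ^+ i.
  rewrite mulrAC ler_pdivlMr // mulrC; apply: le_trans (key i).
  by rewrite lerDr mulr_ge0 // ltW.
have := gx i; have := hy' i; lra.
Qed.

End TwoByTwo.

(** * Scalar inequalities *)

Lemma ler_sqr_mono (R : realDomainType) (x y : R) : 0 <= x -> x <= y -> x ^+ 2 <= y ^+ 2.
Proof. by move=> x0 xy; rewrite ler_pXn2r // nnegrE //; apply: le_trans xy. Qed.

Section Scalars.
Variable R : realFieldType.

(** Convexity of the square, with y written as t (y / t); as nothing is divided by
    1 - t, the contraction factor is allowed to vanish. *)
Lemma split_square (t x y z : R) : 0 < t -> t <= 1 -> 0 <= z ->
  z <= (1 - t) * x + y -> z ^+ 2 <= (1 - t) * x ^+ 2 + y ^+ 2 / t.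
Proof.
move=> t0 t1 z0 h; apply: le_trans (ler_sqr_mono z0 h) _.
rewrite -(ler_pM2r t0) [in leRHS]mulrDl divfK ?gt_eqF //.
have s1 : 0 <= 1 - t by lra.
suff : 0 <= (1 - t) * (t * x - y) ^+ 2 by nra.
by rewrite mulr_ge0 ?sqr_ge0.
Qed.

Lemma sqrD_le_weighted (u w y z : R) : 0 <= u -> u + z ^+ 2 <= w ->
  (y + z) ^+ 2 <= 3 * y ^+ 2 + 3 / 2 * w.
Proof. by move=> h1 h2; have := sqr_ge0 (2 * y - z); nra. Qed.

Lemma sqrD3_le (a mu y z : R) : (a + mu * (y + z)) ^+ 2 <=
  2 * a ^+ 2 + 4 * mu ^+ 2 * y ^+ 2 + 4 * mu ^+ 2 * z ^+ 2.
Proof.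
by have := sqr_ge0 (a - mu * (y + z)); have := sqr_ge0 (mu * (y - z)); nra.
Qed.

Lemma quantizer_input_scalar (m2 u z2 w ck n2 i2 t : R) :
  0 <= m2 -> 0 <= u -> 0 <= n2 -> u + z2 <= w ->
  t <= 2 * (i2 * ck) + 4 * m2 * n2 + 4 * m2 * z2 ->
  m2 * u + t <= 2 * i2 * ck + 6 * m2 * n2 + 4 * m2 * w.
Proof.
move=> m0 u0 n0 h ht; have := ler_wpM2l m0 h; have := mulr_ge0 m0 u0.
by have := mulr_ge0 m0 n0; rewrite mulrDr; lra.
Qed.

Lemma recursion_scalar (a1 a2 B bm s1 q1 m2 n2 b2 l x y Nb Qb En Eq Ed : R) :
  0 <= a1 -> 0 <= bm -> 0 <= s1 -> 0 <= m2 -> 1 <= a1 * a2 ->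
  Nb <= a1 * En -> Qb <= a1 * Eq ->
  En <= B * (a2 * (x + y)) + s1 -> Eq <= bm * (Ed + m2 * En) + q1 ->
  Ed <= a2 * (2 * n2 * y + 6 * m2 * b2 + 4 * m2 * l * (x + y)) ->
  m2 * Nb + Qb <=
    m2 * (a1 * B * a2 + a1 * bm * (4 * a2 * l + B * a2)) * (x + y)
    + 2 * a1 * a2 * bm * n2 * y
    + m2 * (6 * b2 * a1 * a2 * bm + a1 ^+ 2 * a2 * s1 * bm + a1 * s1) + a1 * q1.
Proof.
move=> a10 bm0 s0 m0 a12 hN hQ hE hq hd.
have k1 := ler_wpM2l m0 hN; have k2 := ler_wpM2l (mulr_ge0 m0 a10) hE.
have k3 := ler_wpM2l a10 hq; have k4 := ler_wpM2l (mulr_ge0 a10 bm0) hd.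
have k5 := ler_wpM2l (mulr_ge0 (mulr_ge0 a10 bm0) m0) hE.
have k6 := ler_wpM2l (mulr_ge0 (mulr_ge0 (mulr_ge0 a10 bm0) m0) s0) a12.
lra.
Qed.

Lemma check_scalar (m2 l j d b2 a1 a2 bm n2 a4 s1 q1 K x y : R) :
  m2 * d * (3 / 2 * l) * x + (j + m2 * d * (3 / 2 * l)) * y + m2 * d * (3 * b2) +
  (m2 * K * (x + y) + 2 * a1 * a2 * bm * n2 * y +
   m2 * (6 * b2 * a1 * a2 * bm + a4 * a2 * s1 * bm + a1 * s1) + a1 * q1) =
  m2 * (3 / 2 * l * d + K) * x +
  (j + 2 * a1 * a2 * bm * n2 + m2 * (3 / 2 * l * d + K)) * y +
  (m2 * (3 * b2 * d + 6 * a1 * a2 * bm * b2 + a4 * a2 * s1 * bm + a1 * s1) + a1 * q1).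
Proof. by ring. Qed.

End Scalars.

Opaque gradient hessian opnorm.

(** * Deterministic part of the error dynamics *)

Section ErrorDynamics.
Variables (R : realType) (N : nat) (m : 'I_N -> nat) (P : nat).
Local Notation M := (\sum_k m k)%N.
Local Notation Q := (M - P)%N.
Variable J : forall k, 'cV[R]_(m k) -> R.
Arguments J : clear implicits.
Variables (U : 'M[R]_(M, P)) (A : 'M[R]_M) (wo : forall k, 'cV[R]_(m k)).
Variables (lkmin lkmax : 'I_N -> R) (lmin lmax eps gamma : R).
Variables (VR VL : 'M[R[i]]_(M, Q)) (Jeps : 'M[R[i]]_Q).
Hypothesis hJ : cost_assumption J U lkmin lkmax lmin lmax.
Hypothesis hwo : unique_minimizer J U wo.
Hypothesis hAU : U^T *m A = U^T.
Hypothesis hdec : jordan_decomposition U A eps VR VL Jeps.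

Local Notation v1 := (opnorm (Vinv U VL)).
Local Notation v2 := (opnorm (Veps U VR)).
Local Notation nJ' := (opnorm (Jprime gamma Jeps)).
Local Notation nIJ' := (opnorm (1%:M - Jprime gamma Jeps)).
Local Notation nb := (cenorm (bcheck J wo VL)).
Local Notation W0 := (\mxcol_k wo k).

Hypothesis hnJ' : nJ' < 1.

(** The two modal energies of an error: U^T x holds its coordinates along Range(U),
    VL^T x those along the complementary invariant subspace of A, in a Jordan
    basis that is complex in general. *)
Definition barsq (x : 'cV[R]_M) : R := enorm (U^T *m x) ^+ 2.

Definition checksq (x : 'cV[R]_M) : R := cenorm (VL^T *m toC x) ^+ 2.

Lemma barsq_ge0 x : 0 <= barsq x. Proof. exact: sqr_ge0. Qed.

Lemma checksq_ge0 x : 0 <= checksq x. Proof. exact: sqr_ge0. Qed.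

Lemma toCM n p q (B : 'M[R]_(n, p)) (C : 'M[R]_(p, q)) : toC (B *m C) = toC B *m toC C.
Proof. exact: map_mxM. Qed.

Lemma toCD n p (B C : 'M[R]_(n, p)) : toC (B + C) = toC B + toC C.
Proof. exact: map_mxD. Qed.

Lemma toCN n p (B : 'M[R]_(n, p)) : toC (- B) = - toC B.
Proof. exact: map_mxN. Qed.

Lemma toCZ n p c (B : 'M[R]_(n, p)) : toC (c *: B) = real_complex R c *: toC B.
Proof. exact: map_mxZ. Qed.

Lemma toC_tr n p (B : 'M[R]_(n, p)) : toC B^T = (toC B)^T.
Proof. by rewrite /toC map_trmx. Qed.

Lemma Vinv_toC (x : 'cV[R]_M) :
  Vinv U VL *m toC x = col_mx (toC (U^T *m x)) (VL^T *m toC x).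
Proof. by rewrite /Vinv mul_col_mx toCM toC_tr. Qed.

Lemma Veps_decomposition (x : 'cV[R]_M) :
  toC x = toC (U *m (U^T *m x)) + VR *m (VL^T *m toC x).
Proof.
case: hdec => h _ _ _; rewrite -[LHS]mul1mx -h -mulmxA Vinv_toC.
by rewrite /Veps mul_row_col !toCM.
Qed.

(** A change of basis: v1 bounds the passage to the components, and v2 the way back
    in enorm_components. *)
Lemma components_le (x : 'cV[R]_M) : barsq x + checksq x <= v1 ^+ 2 * enorm x ^+ 2.
Proof.
rewrite /barsq /checksq -cenorm_toC -cenorm_col_mx -Vinv_toC -(cenorm_toC x) -exprMn.
by rewrite ler_pXn2r ?nnegrE ?cenorm_mulmx ?mulr_ge0 ?cenorm_ge0 ?opnorm_ge0.
Qed.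

Lemma barsq_le (x : 'cV[R]_M) : barsq x <= v1 ^+ 2 * enorm x ^+ 2.
Proof. by apply: le_trans (components_le x); rewrite lerDl checksq_ge0. Qed.

Lemma checksq_le (x : 'cV[R]_M) : checksq x <= v1 ^+ 2 * enorm x ^+ 2.
Proof. by apply: le_trans (components_le x); rewrite lerDr barsq_ge0. Qed.

Lemma enorm_components (x : 'cV[R]_M) : enorm x ^+ 2 <= v2 ^+ 2 * (barsq x + checksq x).
Proof.
have -> : enorm x ^+ 2 = cenorm (Veps U VR *m (Vinv U VL *m toC x)) ^+ 2.
  by case: hdec => h _ _ _; rewrite mulmxA h mul1mx cenorm_toC.
rewrite /barsq /checksq -cenorm_toC -cenorm_col_mx -Vinv_toC -exprMn.
by rewrite ler_pXn2r ?nnegrE ?cenorm_mulmx ?mulr_ge0 ?cenorm_ge0 ?opnorm_ge0.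
Qed.

Definition mixA : 'M[R]_M := (1 - gamma) *: 1%:M + gamma *: A.

Lemma VL_A : VL^T *m toC A = Jeps *m VL^T.
Proof.
case: hdec => _ h _ hA.
have : Vinv U VL *m toC A = block_mx 1%:M 0 0 Jeps *m Vinv U VL.
  by rewrite hA !mulmxA h mul1mx.
rewrite /Vinv mul_col_mx mul_block_col => /eq_col_mx[_ ->].
by rewrite mul0mx add0r.
Qed.

Lemma bar_mixA (x : 'cV[R]_M) : U^T *m (mixA *m x) = U^T *m x.
Proof.
rewrite /mixA mulmxDl mulmxDr -!scalemxAl -!scalemxAr mul1mx mulmxA hAU.
by rewrite -scalerDl subrK scale1r.
Qed.

Lemma check_mixA (x : 'cV[R]_M) :
  VL^T *m toC (mixA *m x) = Jprime gamma Jeps *m (VL^T *m toC x).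
Proof.
rewrite /mixA /Jprime toCM toCD !toCZ !mulmxDl mulmxDr -!scalemxAl -!scalemxAr.
rewrite !mul1mx [VL^T *m (toC A *m _)]mulmxA VL_A -mulmxA.
by rewrite (_ : toC 1%:M = 1%:M) ?mul1mx // /toC map_mx1.
Qed.

Lemma checksq_mixA (x : 'cV[R]_M) : checksq (mixA *m x) <= nJ' ^+ 2 * checksq x.
Proof.
rewrite /checksq check_mixA -exprMn.
by rewrite ler_pXn2r ?nnegrE ?cenorm_mulmx ?mulr_ge0 ?cenorm_ge0 ?opnorm_ge0.
Qed.

Lemma checksq_mixA1 (x : 'cV[R]_M) : checksq (mixA *m x) <= checksq x.
Proof.
apply: le_trans (checksq_mixA x) _; rewrite ler_piMl ?checksq_ge0 //.
by rewrite expr_le1 ?opnorm_ge0 // ltW.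
Qed.

Lemma enorm_mixA (x : 'cV[R]_M) : enorm (mixA *m x) ^+ 2 <= v2 ^+ 2 * (barsq x + checksq x).
Proof.
apply: le_trans (enorm_components _) _; apply: ler_wpM2l; first exact: sqr_ge0.
by rewrite {1}/barsq bar_mixA lerD2l; exact: checksq_mixA1.
Qed.

(** The conditional mean, given the past, of the error after one adaptation step
    started from the quantized error x. *)
Definition adapt (mu : R) (x : 'cV[R]_M) : 'cV[R]_M :=
  mixA *m x + mu *: stacked_gradient J (W0 - mixA *m x).

Definition gradgap (x : 'cV[R]_M) : 'cV[R]_M :=
  stacked_gradient J W0 - stacked_gradient J (W0 - mixA *m x).

Local Notation L := (stacked_lipschitz lkmax).

(** The squared Lipschitz constant of the stacked gradient, once the error before
    mixing and the increment are both measured by their modal energies. *)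
Definition modal_lipschitz : R := (v1 * L * v2) ^+ 2.

Lemma adaptE mu x : adapt mu x = mixA *m x + mu *: (stacked_gradient J W0 - gradgap x).
Proof. by rewrite /adapt /gradgap subKr. Qed.

Lemma gradgap_components x :
  barsq (gradgap x) + checksq (gradgap x) <= modal_lipschitz * (barsq x + checksq x).
Proof.
apply: le_trans (components_le _) _.
have -> : modal_lipschitz * (barsq x + checksq x) =
    v1 ^+ 2 * (L ^+ 2 * (v2 ^+ 2 * (barsq x + checksq x))) by rewrite /modal_lipschitz; ring.
apply: ler_wpM2l; first exact: sqr_ge0.
apply: le_trans (_ : (L * enorm (mixA *m x)) ^+ 2 <= _).
  apply: ler_sqr_mono; first exact: enorm_ge0.
  by have := stacked_gradient_lipschitz hJ (W0 - mixA *m x) (mixA *m x); rewrite subrK.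
by rewrite exprMn; apply: ler_wpM2l (enorm_mixA x); exact: sqr_ge0.
Qed.

(** The gradient increment is split at W0 - U (U^T x). The first part is a gradient
    step along Range(U), a contraction. The second is Lipschitz in the
    complementary component alone; splitting the square with t = mu * lmin divides
    its square, of order mu ^+ 2, by mu * lmin. *)
Lemma barsq_adapt (mu : R) x : 0 < mu -> mu * lmax <= 1 ->
  barsq (adapt mu x) <= (1 - mu * lmin) * barsq x + mu / lmin * modal_lipschitz * checksq x.
Proof.
move=> mu0 mu1; case: (hJ) => _ _ /andP[l0 l1] _.
have mul0 : 0 < mu * lmin by exact: mulr_gt0.
have mul1 : mu * lmin <= 1 by apply: le_trans mu1; rewrite ler_pM2l.
set b := U^T *m x; pose r := mixA *m x - U *m b.
have rE : mixA *m x = U *m b + r by rewrite addrC subrK.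
have nr : enorm r <= v2 * cenorm (VL^T *m toC x).
  rewrite -cenorm_toC (_ : toC r = Veps U VR *m col_mx 0 (VL^T *m toC (mixA *m x))).
    apply: le_trans (cenorm_mulmx _ _) _; rewrite ler_wpM2l ?opnorm_ge0 //.
    rewrite -(@ler_pXn2r _ 2) ?nnegrE ?cenorm_ge0 // cenorm_col_mx cenorm0.
    by rewrite expr0n add0r; exact: checksq_mixA1.
  rewrite /Veps mul_row_col mulmx0 add0r /r toCD toCN {1}(Veps_decomposition (mixA *m x)).
  by rewrite bar_mixA addrAC subrr add0r.
pose g1 := stacked_gradient J W0 - stacked_gradient J (W0 - U *m b).
pose g2 := stacked_gradient J (W0 - U *m b) - stacked_gradient J (W0 - mixA *m x).
have E : U^T *m adapt mu x = (b - mu *: (U^T *m g1)) - mu *: (U^T *m g2).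
  rewrite /adapt mulmxDr bar_mixA -/b -scalemxAr -addrA -opprD -scalerDr -mulmxDr.
  rewrite /g1 /g2 addrA subrK mulmxBr (stacked_gradient_optimal hJ hwo) sub0r scalerN opprK //.
rewrite /barsq E.
have h1 : enorm (b - mu *: (U^T *m g1)) <= (1 - mu * lmin) * enorm b.
  exact: (stacked_gradient_contract hJ W0 b (ltW mu0) mu1).
have h2 : enorm (U^T *m g2) <= v1 * (L * (v2 * cenorm (VL^T *m toC x))).
  apply: le_trans (_ : v1 * enorm g2 <= _).
    rewrite -(@ler_pXn2r _ 2) ?nnegrE ?mulr_ge0 ?enorm_ge0 ?opnorm_ge0 // exprMn.
    exact: barsq_le.
  rewrite ler_wpM2l ?opnorm_ge0 //; apply: le_trans (_ : L * enorm r <= _); last first.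
    by rewrite ler_wpM2l ?stacked_lipschitz_ge0.
  have := stacked_gradient_lipschitz hJ (W0 - mixA *m x) r.
  suff -> : W0 - mixA *m x + r = W0 - U *m b by [].
  by rewrite /r addrA subrK.
have -> : mu / lmin * modal_lipschitz * checksq x =
    (mu * (v1 * (L * (v2 * cenorm (VL^T *m toC x))))) ^+ 2 / (mu * lmin).
  by rewrite /modal_lipschitz /checksq; field; rewrite !gt_eqF.
apply: split_square => //; first exact: enorm_ge0.
apply: le_trans (enormB _ _) _; apply: lerD => //.
by rewrite enormZ gtr0_norm // ler_pM2l.
Qed.

Lemma check_grad0 : VL^T *m toC (stacked_gradient J W0) = bcheck J wo VL.
Proof.
rewrite /bcheck /stacked_gradient; congr (_ *m toC _).
by congr mxcol; apply: functional_extensionality_dep => k; rewrite mxcolK.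
Qed.

(** The contraction by Jprime leaves the room 1 - nJ' for the gradient term. Unlike
    along Range(U), the gradient at W0 does not vanish here and contributes nb. *)
Lemma checksq_adapt (mu : R) x : 0 < mu ->
  checksq (adapt mu x) <= nJ' * checksq x +
    mu ^+ 2 / (1 - nJ') * (3 * nb ^+ 2 + 3 / 2 * modal_lipschitz * (barsq x + checksq x)).
Proof.
move=> mu0; have j0 : 0 < 1 - nJ' by rewrite subr_gt0.
set c := VL^T *m toC x; set gg := VL^T *m toC (gradgap x).
have E : VL^T *m toC (adapt mu x) =
    Jprime gamma Jeps *m c + real_complex R mu *: (bcheck J wo VL - gg).
  rewrite adaptE /gg; move: (gradgap x) => G.
  rewrite toCD toCZ toCD toCN mulmxDr check_mixA -scalemxAr mulmxDr mulmxN.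
  by rewrite check_grad0.
have h : cenorm (VL^T *m toC (adapt mu x)) <=
    (1 - (1 - nJ')) * cenorm c + mu * (nb + cenorm gg).
  rewrite E subKr; apply: le_trans (cenormD _ _) _; apply: lerD; first exact: cenorm_mulmx.
  by rewrite cenormZ normc_real gtr0_norm //; apply: ler_wpM2l (cenormB _ _); exact: ltW.
have j1 : 1 - nJ' <= 1 by rewrite lerBlDr lerDl opnorm_ge0.
apply: le_trans (split_square j0 j1 (cenorm_ge0 _) h) _.
rewrite subKr; apply: lerD; first exact: lexx.
rewrite exprMn mulrAC; apply: ler_wpM2l; first exact: divr_ge0 (sqr_ge0 _) (ltW j0).
have := gradgap_components x; have := barsq_ge0 (gradgap x).
have -> : checksq (gradgap x) = cenorm gg ^+ 2 by [].
by rewrite -mulrA => h1 h2; exact: sqrD_le_weighted h1 h2.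
Qed.

(** This is the mean increment that the quantizer sees. Mixing fixes the component
    along Range(U), so that only I - Jprime on the complement survives as mu
    tends to 0. *)
Lemma enorm_adapt_sub (mu : R) x : 0 < mu ->
  enorm (x - adapt mu x) ^+ 2 <= v2 ^+ 2 * (2 * nIJ' ^+ 2 * checksq x +
    6 * mu ^+ 2 * nb ^+ 2 + 4 * mu ^+ 2 * modal_lipschitz * (barsq x + checksq x)).
Proof.
move=> mu0; apply: le_trans (enorm_components _) _; rewrite ler_wpM2l ?sqr_ge0 //.
set c := VL^T *m toC x; set gg := VL^T *m toC (gradgap x).
have Eb : U^T *m (x - adapt mu x) = mu *: (U^T *m gradgap x).
  rewrite adaptE; move: (gradgap x) => G.
  rewrite opprD addrA mulmxBr mulmxBr bar_mixA subrr sub0r -scalemxAr.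
  by rewrite mulmxBr (stacked_gradient_optimal hJ hwo) sub0r scalerN opprK.
have Ec : VL^T *m toC (x - adapt mu x) =
    (1%:M - Jprime gamma Jeps) *m c - real_complex R mu *: (bcheck J wo VL - gg).
  rewrite adaptE /gg; move: (gradgap x) => G.
  rewrite opprD addrA toCD toCN toCZ (toCD _ (- G)) (toCN G) mulmxBr -scalemxAr mulmxBr.
  by rewrite check_grad0 toCD toCN mulmxBr check_mixA mulmxBl mul1mx.
have hb : barsq (x - adapt mu x) = mu ^+ 2 * barsq (gradgap x).
  by rewrite /barsq Eb enormZ exprMn gtr0_norm.
have hc : cenorm (VL^T *m toC (x - adapt mu x)) <= nIJ' * cenorm c + mu * (nb + cenorm gg).
  rewrite Ec; apply: le_trans (cenormB _ _) _; apply: lerD; first exact: cenorm_mulmx.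
  by rewrite cenormZ normc_real gtr0_norm //; apply: ler_wpM2l (cenormB _ _); exact: ltW.
rewrite hb.
have hc2 : checksq (x - adapt mu x) <= 2 * (nIJ' * cenorm c) ^+ 2 +
    4 * mu ^+ 2 * nb ^+ 2 + 4 * mu ^+ 2 * cenorm gg ^+ 2.
  apply: le_trans (ler_sqr_mono (cenorm_ge0 _) hc) _.
  exact: sqrD3_le.
rewrite exprMn in hc2; rewrite -[4 * _ * modal_lipschitz * _]mulrA.
exact: quantizer_input_scalar (sqr_ge0 _) (barsq_ge0 _) (sqr_ge0 _) (gradgap_components x) hc2.
Qed.

(** * Error of a run of the strategy *)

Section Run.
Variables (nbh : 'I_N -> {set 'I_N}) (bs2 ss2 bq2 sq2 : 'I_N -> R) (mu : R).
Hypothesis hA : combination_matrix nbh U A.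
Hypothesis hcoef : forall k, [/\ 0 <= bs2 k, 0 <= ss2 k & 0 <= bq2 k].
Hypothesis hsq2 : forall k, 0 <= sq2 k.
Hypothesis mu_gt0 : 0 < mu.
Context d (T : measurableType d) (Pr : probability T R).
Variables (ghat q : forall k : 'I_N, nat -> T -> 'cV[R]_(m k) -> 'cV[R]_(m k)).
Variables (phi psi w : forall k : 'I_N, nat -> T -> 'cV[R]_(m k)).
Arguments ghat : clear implicits.
Arguments q : clear implicits.
Arguments phi : clear implicits.
Arguments psi : clear implicits.
Arguments w : clear implicits.
Hypothesis hrun : strategyQ mu gamma nbh A ghat q phi psi w.
Hypothesis hinit : admissible_init Pr phi.
Hypothesis hnoise : noise_assumption Pr J wo bs2 ss2 ghat phi w.
Hypothesis hquant : quantizer_assumption Pr bq2 sq2 q phi psi.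

Definition err i t : 'cV[R]_M := \mxcol_k (wo k - phi k i t).

Definition agent_noise k i t : 'cV[R]_(m k) :=
  gradient (J k) (w k i t) - ghat k i.+1 t (w k i t).

Definition noise i t : 'cV[R]_M := \mxcol_k agent_noise k i t.

Definition qin k i t : 'cV[R]_(m k) := psi k i.+1 t - phi k i t.

Definition agent_qerr k i t : 'cV[R]_(m k) := qin k i t - q k i.+1 t (qin k i t).

Definition qerr i t : 'cV[R]_M := \mxcol_k agent_qerr k i t.

Lemma mxcolD n (B C : forall k, 'M[R]_(m k, n)) :
  \mxcol_k (B k + C k) = \mxcol_k B k + \mxcol_k C k.
Proof. by apply/matrixP => i j; rewrite !mxE. Qed.

Lemma mxcolB n (B C : forall k, 'M[R]_(m k, n)) :
  \mxcol_k (B k - C k) = \mxcol_k B k - \mxcol_k C k.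
Proof. by apply/matrixP => i j; rewrite !mxE. Qed.

Lemma mxcolZ n c (B : forall k, 'M[R]_(m k, n)) :
  \mxcol_k (c *: B k) = c *: \mxcol_k B k.
Proof. by apply/matrixP => i j; rewrite !mxE. Qed.

Lemma mixA_wo : mixA *m W0 = W0.
Proof.
case: hA => _ AU _ _; case: hwo => -[x0 ->] _.
rewrite /mixA mulmxDl -!scalemxAl mul1mx mulmxA AU.
by rewrite -scalerDl subrK scale1r.
Qed.

Lemma stacked_w i t : \mxcol_k w k i t = mixA *m \mxcol_k phi k i t.
Proof.
rewrite /mixA mulmxDl -!scalemxAl mul1mx.
have -> : A *m \mxcol_k phi k i t =
    \mxcol_k \sum_(l in nbh k) submxblock A k l *m phi l i t.
  rewrite -[in LHS](submxblockK A) mul_mxblock_mxrow; congr mxcol.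
  apply: functional_extensionality_dep => k; rewrite [RHS]big_mkcond /=.
  apply: eq_bigr => l _; case: ifPn => // lk.
  by case: hA => hz _ _ _; rewrite hz // mul0mx.
rewrite -!mxcolZ -mxcolD; congr mxcol.
by apply: functional_extensionality_dep => k; case: (hrun k i t).
Qed.

Lemma stacked_werr i t : \mxcol_k (wo k - w k i t) = mixA *m err i t.
Proof. by rewrite mxcolB stacked_w /err mxcolB mulmxBr mixA_wo. Qed.

Lemma stacked_psi i t :
  \mxcol_k (wo k - psi k i.+1 t) = adapt mu (err i t) + (- mu) *: noise i t.
Proof.
have -> : adapt mu (err i t) = \mxcol_k (wo k - w k i t) + mu *: \mxcol_k gradient (J k) (w k i t).
  rewrite /adapt -stacked_werr; congr (_ + _ *: _).
  rewrite -mxcolB; congr mxcol; apply: functional_extensionality_dep => k.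
  by rewrite mxcolK subKr.
rewrite /noise -!mxcolZ -!mxcolD; congr mxcol; apply: functional_extensionality_dep => k.
case: (hrun k i t) => -> _ _; rewrite /agent_noise scalerBr !scaleNr opprK addrA.
by rewrite addrK opprB addrA addrAC.
Qed.

Lemma err_step i t : err i.+1 t = (adapt mu (err i t) + (- mu) *: noise i t) + qerr i t.
Proof.
rewrite -stacked_psi -mxcolD; congr mxcol; apply: functional_extensionality_dep => k.
case: (hrun k i t) => _ -> _; rewrite /agent_qerr /qin.
by rewrite addrA addrA subrK opprD addrA.
Qed.

Lemma stacked_qin i t :
  \mxcol_k qin k i t = (err i t - adapt mu (err i t)) + mu *: noise i t.
Proof.
have -> : \mxcol_k qin k i t = err i t - \mxcol_k (wo k - psi k i.+1 t).
  rewrite -mxcolB; congr mxcol; apply: functional_extensionality_dep => k.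
  by rewrite opprB addrC addrA subrK.
by rewrite stacked_psi opprD addrA scaleNr opprK.
Qed.

(** * Measurability and finite second moments *)

Lemma stacked_gradient_measurable d' (T' : measurableType d') (X : T' -> 'cV[R]_M) :
  (forall j, measurable_fun [set: T'] (fun t => X t j 0)) ->
  forall j, measurable_fun [set: T'] (fun t => stacked_gradient J (X t) j 0).
Proof.
move=> mX j.
pose k := tagnat.sig1 j; pose j' := tagnat.sig2 j.
have -> : (fun t => stacked_gradient J (X t) j 0) =
    (fun t => gradient (J k) (submxcol (X t) k) j' 0).
  by apply/funext => t; rewrite mxE.
apply: (measurable_continuous_comp (X := fun t => submxcol (X t) k)
  (g := fun y => gradient (J k) y j' 0)).
  by move=> i; under eq_fun do rewrite mxE; exact: mX.
move=> y; apply: (@continuous_comp _ _ _ (gradient (J k)) (fun N : 'cV[R]_(m k) => N j' 0 : R^o)).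
  apply: differentiable_continuous.
  by case: (hJ) => h _ _ _; case: (h k) => -[].
exact: coord_continuous.
Qed.

Lemma mulmx_measurable d' (T' : measurableType d') n p (B : 'M[R]_(p, n)) (X : T' -> 'cV[R]_n) :
  (forall j, measurable_fun [set: T'] (fun t => X t j 0)) ->
  forall j, measurable_fun [set: T'] (fun t => (B *m X t) j 0).
Proof.
move=> mX j; under eq_fun do rewrite mxE.
by apply: measurable_sum => i; apply: measurable_funM.
Qed.

Lemma adapt_measurable d' (T' : measurableType d') (X : T' -> 'cV[R]_M) :
  (forall j, measurable_fun [set: T'] (fun t => X t j 0)) ->
  forall j, measurable_fun [set: T'] (fun t => adapt mu (X t) j 0).
Proof.
move=> mX j; have mA := mulmx_measurable mixA mX.
have -> : (fun t => adapt mu (X t) j 0) =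
    (fun t => (mixA *m X t) j 0 + mu * stacked_gradient J (W0 - mixA *m X t) j 0).
  by apply/funext => t; rewrite /adapt !mxE.
apply: measurable_funD; first exact: mA.
apply: measurable_funM => //; apply: stacked_gradient_measurable => i.
have -> : (fun t => (W0 - mixA *m X t) i 0) = (fun t => W0 i 0 - (mixA *m X t) i 0).
  by apply/funext => t; rewrite !mxE.
exact: measurable_funB.
Qed.

Lemma sqvec_mxcol (X : forall k, T -> 'cV[R]_(m k)) :
  (forall k, sqvec Pr (X k)) -> sqvec Pr (fun t => \mxcol_k X k t).
Proof.
move=> sX j; have := sX (tagnat.sig1 j) (tagnat.sig2 j).
by congr sqint; apply/funext => t; rewrite mxE.
Qed.

Lemma eq_sqvec n (X Y : T -> 'cV[R]_n) : X =1 Y -> sqvec Pr X -> sqvec Pr Y.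
Proof. by move=> /funext ->. Qed.

Lemma sqvec_submxcol (X : T -> 'cV[R]_M) k :
  sqvec Pr X -> sqvec Pr (fun t => submxcol (X t) k).
Proof.
by move=> sX j; have := sX (tagnat.Rank k j); congr sqint; apply/funext => t; rewrite mxE.
Qed.

Lemma sqvec_random n (X : T -> 'cV[R]_n) : sqvec Pr X -> random_vector X.
Proof. by move=> sX j; case: (sX j). Qed.

Lemma sqvec_gradgap (X : T -> 'cV[R]_M) :
  sqvec Pr X -> sqvec Pr (fun t => gradgap (X t)).
Proof.
move=> sX; have sA := sqvec_mul mixA sX.
have mG : random_vector (fun t => gradgap (X t)).
  move=> j; have -> : (fun t => gradgap (X t) j 0) =
      (fun t => stacked_gradient J W0 j 0 - stacked_gradient J (W0 - mixA *m X t) j 0).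
    by apply/funext => t; rewrite /gradgap !mxE.
  apply: measurable_funB => //; apply: stacked_gradient_measurable => i.
  have -> : (fun t => (W0 - mixA *m X t) i 0) = (fun t => W0 i 0 - (mixA *m X t) i 0).
    by apply/funext => t; rewrite !mxE.
  by apply: measurable_funB => //; case: (sA i).
apply: sqvec_of_integrableR => //.
apply: integrableR_le (integrableRZ (stacked_lipschitz lkmax ^+ 2) (sqvec_integrableR sA)) => [|t].
  exact: random_vector_enorm.
rewrite ger0_norm ?sqr_ge0 // -exprMn; apply: ler_sqr_mono; first exact: enorm_ge0.
by have := stacked_gradient_lipschitz hJ (W0 - mixA *m X t) (mixA *m X t); rewrite subrK.
Qed.

Lemma sqvec_adapt (X : T -> 'cV[R]_M) :
  sqvec Pr X -> sqvec Pr (fun t => adapt mu (X t)).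
Proof.
move=> sX; apply: (eq_sqvec (fun t => esym (adaptE _ (X t)))).
apply: sqvecD; first exact: sqvec_mul.
by apply: sqvecZ; apply: sqvecB; [exact: sqvec_cst|exact: sqvec_gradgap].
Qed.

Lemma events_measurable n (X : T -> 'cV[R]_n) :
  random_vector X -> events X `<=` (measurable : set (set T)).
Proof.
by move=> mX E [j [B [mB ->]]]; rewrite -[X in measurable X]setTI; exact: mX.
Qed.

Lemma coef_ge0 k : 0 <= bs2 k /\ 0 <= ss2 k /\ 0 <= bq2 k.
Proof. by case: (hcoef k). Qed.

Definition past i : set (set T) := \bigcup_(l in [set: 'I_N]) events (phi l i).

Section GivenPhi.
Variable i : nat.
Hypothesis sphi : forall k, sqvec Pr (phi k i).
Arguments sphi : clear implicits.

Lemma sqvec_err_given : sqvec Pr (err i).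
Proof. by apply: sqvec_mxcol => k; exact: (sqvecB (sqvec_cst Pr (wo k)) (sphi k)). Qed.

Lemma past_measurable : <<s past i >> `<=` (measurable : set (set T)).
Proof.
apply: smallest_sub; first exact: sigma_algebra_measurable.
by move=> E [l _]; apply: events_measurable; exact: sqvec_random.
Qed.

Lemma phi_past k j : meas_wrt (past i) (fun t => phi k i t j 0).
Proof.
move=> _ B mB; rewrite setTI; apply: sub_gen_smallest.
by exists k => //; exists j, B.
Qed.

Lemma err_past j : meas_wrt (past i) (fun t => err i t j 0).
Proof.
rewrite /meas_wrt; under eq_fun do rewrite !mxE.
by apply: measurable_funB; [exact: measurable_cst|exact: phi_past].
Qed.

(** Finiteness of the second moment is a conclusion: conditional expectations of
    nonnegative variables may be infinite. *)
Lemma agent_noise_moment k :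
  sqvec Pr (agent_noise k i) /\
  mean Pr (fun t => enorm (agent_noise k i t) ^+ 2) <=
    bs2 k * mean Pr (fun t => enorm (wo k - w k i t) ^+ 2) + ss2 k.
Proof.
have [rs _ [Z cZ hZ]] := hnoise k i.
have [b0 [s0 _]] := coef_ge0 k.
have sw : sqvec Pr (fun t => wo k - w k i t).
  have := sqvec_submxcol (k := k) (sqvec_mul mixA sqvec_err_given); congr sqvec; apply/funext => t.
  by rewrite -stacked_werr mxcolK.
have iw := sqvec_integrableR sw.
have iB : integrableR Pr (fun t => bs2 k * enorm (wo k - w k i t) ^+ 2 + ss2 k).
  by apply: integrableRD; [exact: integrableRZ|exact: integrableR_cst].
have [] := condexp_le (random_vector_enorm rs) _ _ iB cZ hZ.
- by move=> t; exact: sqr_ge0.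
- by move=> t; exact: addr_ge0 (mulr_ge0 b0 (sqr_ge0 _)) s0.
move=> iX; rewrite meanD ?meanZ ?mean_cst //; [|exact: integrableRZ|exact: integrableR_cst].
move=> h; split; last exact h.
exact: (sqvec_of_integrableR (X := agent_noise k i) rs iX).
Qed.

Lemma sqvec_noise : sqvec Pr (noise i).
Proof. by apply: sqvec_mxcol => k; case: (agent_noise_moment k). Qed.

Lemma uncorrelated_mxcol n (X : T -> 'cV[R]_n) (Z : forall k, T -> 'cV[R]_(m k)) :
  (forall k, uncorrelated Pr X (Z k)) -> uncorrelated Pr X (fun t => \mxcol_k Z k t).
Proof.
move=> h a b; have := h (tagnat.sig1 b) a (tagnat.sig2 b).
by move=> h0; rewrite -[RHS]h0; apply: eq_mean => t; rewrite [X in _ * X = _]mxE.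
Qed.

Lemma uncorrelatedZ n p c (X : T -> 'cV[R]_n) (Z : T -> 'cV[R]_p) :
  sqvec Pr X -> sqvec Pr Z -> uncorrelated Pr X Z ->
  uncorrelated Pr X (fun t => c *: Z t).
Proof.
move=> sX sZ h a b; transitivity (mean Pr (fun t => c * (X t a 0 * Z t b 0))).
  by apply: eq_mean => t; rewrite mxE mulrCA.
by rewrite meanZ ?h ?mulr0 //; exact: sqint_mul.
Qed.

Lemma noise_uncorrelated (X : T -> 'cV[R]_M) :
  sqvec Pr X -> (forall j, meas_wrt (past i) (fun t => X t j 0)) ->
  uncorrelated Pr X (noise i).
Proof.
move=> sX mX; apply: uncorrelated_mxcol => k.
have [_ cs _] := hnoise k i.
exact: (condexp_vec0_uncorrelated past_measurable sX mX (agent_noise_moment k).1 cs).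
Qed.

Lemma adapt_past j : meas_wrt (past i) (fun t => adapt mu (err i t) j 0).
Proof. exact: (adapt_measurable err_past). Qed.

Lemma adapt_noise_uncorrelated :
  uncorrelated Pr (fun t => adapt mu (err i t)) (fun t => (- mu) *: noise i t).
Proof.
exact: (uncorrelatedZ _ (sqvec_adapt sqvec_err_given) sqvec_noise
  (noise_uncorrelated (sqvec_adapt sqvec_err_given) adapt_past)).
Qed.

Lemma diff_noise_uncorrelated :
  uncorrelated Pr (fun t => err i t - adapt mu (err i t)) (fun t => mu *: noise i t).
Proof.
have sD := sqvecB sqvec_err_given (sqvec_adapt sqvec_err_given).
apply: (uncorrelatedZ _ sD sqvec_noise); apply: (noise_uncorrelated sD) => j.
rewrite /meas_wrt; have -> : (fun t => (err i t - adapt mu (err i t)) j 0) =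
    (fun t => err i t j 0 - adapt mu (err i t) j 0).
  by apply/funext => t; rewrite !mxE.
exact: (measurable_funB (err_past j) (adapt_past j)).
Qed.

Lemma sqvec_psi_err : sqvec Pr (fun t => \mxcol_k (wo k - psi k i.+1 t)).
Proof.
apply: (eq_sqvec (fun t => esym (stacked_psi i t))).
exact: (sqvecD (sqvec_adapt sqvec_err_given) (sqvecZ _ sqvec_noise)).
Qed.

Lemma sqvec_psi k : sqvec Pr (psi k i.+1).
Proof.
have := sqvecB (sqvec_cst Pr (wo k)) (sqvec_submxcol (k := k) sqvec_psi_err).
by congr sqvec; apply/funext => t; rewrite mxcolK subKr.
Qed.

Lemma sqvec_qin k : sqvec Pr (qin k i).
Proof. exact: (sqvecB (sqvec_psi (k := k)) (sphi k)). Qed.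

Lemma agent_qerr_moment k :
  sqvec Pr (agent_qerr k i) /\
  mean Pr (fun t => enorm (agent_qerr k i t) ^+ 2) <=
    bq2 k * mean Pr (fun t => enorm (qin k i t) ^+ 2) + sq2 k.
Proof.
have [_ /(_ k i)[rz _ _ [Z [_ cZ hZ]]]] := hquant.
have [_ [_ b0]] := coef_ge0 k.
have iq := sqvec_integrableR (sqvec_qin (k := k)).
have iB : integrableR Pr (fun t => bq2 k * enorm (qin k i t) ^+ 2 + sq2 k).
  by apply: integrableRD; [exact: integrableRZ|exact: integrableR_cst].
have [] := condexp_le (random_vector_enorm rz) _ _ iB cZ hZ.
- by move=> t; exact: sqr_ge0.
- by move=> t; exact: addr_ge0 (mulr_ge0 b0 (sqr_ge0 _)) (hsq2 k).
move=> iX; rewrite meanD ?meanZ ?mean_cst //; [|exact: integrableRZ|exact: integrableR_cst].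
move=> h; split; last exact h.
exact: (sqvec_of_integrableR (X := agent_qerr k i) rz iX).
Qed.

Lemma sqvec_qerr : sqvec Pr (qerr i).
Proof. by apply: sqvec_mxcol => k; case: (agent_qerr_moment k). Qed.

Lemma sqvec_phi_next k : sqvec Pr (phi k i.+1).
Proof.
have := sqvecB (sqvec_cst Pr (wo k))
  (sqvec_submxcol (k := k) (sqvecD sqvec_psi_err sqvec_qerr)).
congr sqvec; apply/funext => t; rewrite stacked_psi -err_step mxcolK subKr //.
Qed.

End GivenPhi.

(** By induction: the noise bounds turn moments at one iteration into moments at the
    next. *)
Lemma sqvec_phi i k : sqvec Pr (phi k i).
Proof.
elim: i k => [|i IH] k; last exact: sqvec_phi_next.
have [r0 h0] := hinit k; apply: sqvec_of_integrableR => //.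
apply/integrableP; split; first by apply/measurable_EFinP; exact: random_vector_enorm.
move: h0; rewrite unlock; apply: le_lt_trans.
rewrite le_eqVlt; apply/orP; left; apply/eqP; apply: eq_integral => t _ /=.
by rewrite ger0_norm ?sqr_ge0.
Qed.

Lemma sqvec_err i : sqvec Pr (err i).
Proof.
by apply: sqvec_mxcol => k; apply: sqvecB; [exact: sqvec_cst|exact: sqvec_phi].
Qed.

(** The first vector is the error of psi at iteration i + 1, which belongs to the
    history given which the quantization error is centered. *)
Lemma qerr_uncorrelated i :
  uncorrelated Pr (fun t => adapt mu (err i t) + (- mu) *: noise i t) (qerr i).
Proof.
apply: uncorrelated_mxcol => k.
have [_ /(_ k i)[_ cz _ _]] := hquant.
apply: (condexp_vec0_uncorrelated _ _ _ _ cz).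
- apply: smallest_sub; first exact: sigma_algebra_measurable.
  move=> E [[l _ [j _]]|[l _ [[|j] //= _]]]; apply: events_measurable; apply: sqvec_random.
    exact: sqvec_phi.
  by apply: sqvec_psi => k'; exact: sqvec_phi.
- have := sqvec_psi_err (sqvec_phi i); congr sqvec; apply/funext => t.
  by rewrite stacked_psi.
- move=> j; rewrite /meas_wrt.
  have -> : (fun t => (adapt mu (err i t) + (- mu) *: noise i t) j 0) =
      (fun t => wo (tagnat.sig1 j) (tagnat.sig2 j) 0 -
                psi (tagnat.sig1 j) i.+1 t (tagnat.sig2 j) 0).
    by apply/funext => t; rewrite -stacked_psi !mxE.
  apply: measurable_funB; first exact: measurable_cst.
  move=> _ B mB; rewrite setTI; apply: sub_gen_smallest; right.
  exists (tagnat.sig1 j) => //; exists i.+1; first by rewrite /= leqnn.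
  by exists (tagnat.sig2 j), B.
- by case: (agent_qerr_moment (sqvec_phi i) k).
Qed.

(** * Mean-square recursion *)

Definition msq p (B : 'M[R]_(p, M)) (X : T -> 'cV[R]_M) := 
  mean Pr (fun t => enorm (B *m X t) ^+ 2).

Lemma sqvec_adapt_err i : sqvec Pr (fun t => adapt mu (err i t)).
Proof. exact: sqvec_adapt (sqvec_err i). Qed.

Lemma sqvec_noise_run i : sqvec Pr (noise i).
Proof. exact: sqvec_noise (sqvec_phi i). Qed.

Lemma sqvec_qerr_run i : sqvec Pr (qerr i).
Proof. exact: sqvec_qerr (sqvec_phi i). Qed.

(** Two perturbations, each uncorrelated with what precedes it: Pythagoras twice. *)
Lemma msq_step p (B : 'M[R]_(p, M)) i :
  msq B (err i.+1) = msq B (fun t => adapt mu (err i t)) + mu ^+ 2 * msq B (noise i)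
                     + msq B (qerr i).
Proof.
rewrite /msq; under eq_mean do rewrite err_step.
rewrite (mean_pythagoras B (sqvecD (sqvec_adapt_err i) (sqvecZ (- mu) (sqvec_noise_run i)))
  (sqvec_qerr_run i) (@qerr_uncorrelated i)).
rewrite (mean_pythagoras B (sqvec_adapt_err i) (sqvecZ (- mu) (sqvec_noise_run i))
  (adapt_noise_uncorrelated (sqvec_phi i))).
congr (_ + _ + _); rewrite -meanZ; last first.
  exact: (sqvec_integrableR (sqvec_mul B (sqvec_noise_run i))).
by apply: eq_mean => t; rewrite -scalemxAr enormZ exprMn normrN gtr0_norm.
Qed.

Definition mean_bar i := mean Pr (fun t => barsq (err i t)).
Definition mean_check i := mean Pr (fun t => checksq (err i t)).

Lemma checksq_realify x : checksq x = enorm (realify VL^T *m x) ^+ 2.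
Proof. by rewrite /checksq cenorm_realify realify_mul. Qed.

Lemma integrableR_barsq (X : T -> 'cV[R]_M) :
  sqvec Pr X -> integrableR Pr (fun t => barsq (X t)).
Proof. by move=> sX'; apply: sqvec_integrableR; exact: sqvec_mul. Qed.

Lemma integrableR_checksq (X : T -> 'cV[R]_M) :
  sqvec Pr X -> integrableR Pr (fun t => checksq (X t)).
Proof.
move=> sX'; under eq_fun do rewrite checksq_realify.
by apply: sqvec_integrableR; exact: sqvec_mul.
Qed.

Lemma integrableR_barsq_err i : integrableR Pr (fun t => barsq (err i t)).
Proof. exact: integrableR_barsq (sqvec_err i). Qed.

Lemma integrableR_checksq_err i : integrableR Pr (fun t => checksq (err i t)).
Proof. exact: integrableR_checksq (sqvec_err i). Qed.

Lemma mean_bar_ge0 i : 0 <= mean_bar i.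
Proof. by apply: mean_ge0 => t; exact: barsq_ge0. Qed.

Lemma mean_check_ge0 i : 0 <= mean_check i.
Proof. by apply: mean_ge0 => t; exact: checksq_ge0. Qed.

Lemma mean_affine i (f : T -> R) (a b c : R) : integrableR Pr f ->
  (forall t, f t <= a * barsq (err i t) + b * checksq (err i t) + c) ->
  mean Pr f <= a * mean_bar i + b * mean_check i + c.
Proof.
move=> iF h.
have i1 := integrableRZ a (integrableR_barsq_err i).
have i2 := integrableRZ b (integrableR_checksq_err i).
have -> : a * mean_bar i + b * mean_check i + c =
    mean Pr (fun t => a * barsq (err i t) + b * checksq (err i t) + c).
  rewrite (meanD (integrableRD i1 i2) (integrableR_cst Pr c)) (meanD i1 i2) mean_cst.
  by rewrite (meanZ _ (integrableR_barsq_err i)) (meanZ _ (integrableR_checksq_err i)).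
exact: (le_mean iF (integrableRD (integrableRD i1 i2) (integrableR_cst Pr c)) h).
Qed.

Local Notation Bs := (\sum_k bs2 k).
Local Notation ss := (\sum_k ss2 k).
Local Notation sq := (\sum_k sq2 k).
Local Notation bmax := (maxcoef bq2).

Lemma mean_enorm_mxcol (X : forall k, T -> 'cV[R]_(m k)) : (forall k, sqvec Pr (X k)) ->
  mean Pr (fun t => enorm (\mxcol_k X k t) ^+ 2) = \sum_k mean Pr (fun t => enorm (X k t) ^+ 2).
Proof.
move=> sX'; under eq_mean do rewrite enorm_mxcol.
by rewrite mean_sum // => k; exact: sqvec_integrableR.
Qed.

Lemma sqvec_werr i k : sqvec Pr (fun t => wo k - w k i t).
Proof.
have := sqvec_submxcol (k := k) (sqvec_mul mixA (sqvec_err i)); congr sqvec; apply/funext => t.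
by rewrite -stacked_werr mxcolK.
Qed.

Lemma mean_werr i :
  \sum_k mean Pr (fun t => enorm (wo k - w k i t) ^+ 2) <= v2 ^+ 2 * (mean_bar i + mean_check i).
Proof.
rewrite -(mean_enorm_mxcol (sqvec_werr i)); under eq_mean do rewrite stacked_werr.
rewrite mulrDr -[leRHS]addr0; apply: mean_affine.
  by apply: sqvec_integrableR; apply: sqvec_mul; exact: sqvec_err.
by move=> t; rewrite addr0 -mulrDr; exact: enorm_mixA.
Qed.

Lemma sum_coef_le (b x : 'I_N -> R) (C : R) : (forall k, 0 <= x k) -> (forall k, b k <= C) ->
  \sum_k b k * x k <= C * \sum_k x k.
Proof. by move=> x0 bC; rewrite mulr_sumr; apply: ler_sum => k _; exact: ler_wpM2r. Qed.

Lemma noise_moment i :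
  mean Pr (fun t => enorm (noise i t) ^+ 2) <= Bs * (v2 ^+ 2 * (mean_bar i + mean_check i)) + ss.
Proof.
have hk k := agent_noise_moment (sqvec_phi i) k.
rewrite mean_enorm_mxcol => [|k]; last by case: (hk k).
apply: le_trans (_ : \sum_k (bs2 k * mean Pr (fun t => enorm (wo k - w k i t) ^+ 2) + ss2 k) <= _).
  by apply: ler_sum => k _; case: (hk k).
rewrite big_split lerD2r /=.
apply: le_trans (sum_coef_le (C := Bs) _ _) _.
- by move=> k; apply: mean_ge0 => t; exact: sqr_ge0.
- move=> k; rewrite (bigD1 k) //= lerDl; apply: sumr_ge0 => l _.
  by case: (coef_ge0 l).
by apply: ler_wpM2l (mean_werr i); apply: sumr_ge0 => k _; case: (coef_ge0 k).
Qed.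

Lemma maxcoef_ge k : bq2 k <= bmax.
Proof. exact: le_bigmax. Qed.

Lemma maxcoef_ge0 : 0 <= bmax.
Proof. exact: bigmax_ge_id. Qed.

Lemma qerr_moment i :
  mean Pr (fun t => enorm (qerr i t) ^+ 2) <=
  bmax * (mean Pr (fun t => enorm (err i t - adapt mu (err i t)) ^+ 2)
          + mu ^+ 2 * mean Pr (fun t => enorm (noise i t) ^+ 2)) + sq.
Proof.
have hk k := agent_qerr_moment (sqvec_phi i) k.
have sq' k := sqvec_qin (sqvec_phi i) k.
rewrite mean_enorm_mxcol => [|k]; last by case: (hk k).
apply: le_trans (_ : \sum_k (bq2 k * mean Pr (fun t => enorm (qin k i t) ^+ 2) + sq2 k) <= _).
  by apply: ler_sum => k _; case: (hk k).
rewrite big_split lerD2r /=.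
apply: le_trans (sum_coef_le (C := bmax) _ _) _; last 1 first.
- rewrite -(mean_enorm_mxcol sq'); under eq_mean do rewrite stacked_qin.
  apply: ler_wpM2l; first exact: maxcoef_ge0.
  have sD := sqvecB (sqvec_err i) (sqvec_adapt_err i).
  have := mean_pythagoras 1%:M sD (sqvecZ mu (sqvec_noise_run i))
    (diff_noise_uncorrelated (sqvec_phi i)).
  under eq_mean do rewrite mul1mx; move=> ->.
  under eq_mean do rewrite mul1mx; apply: lerD; first exact: lexx.
  rewrite -(meanZ _ (sqvec_integrableR (sqvec_noise_run i))).
  rewrite le_eqVlt; apply/orP; left; apply/eqP; apply: eq_mean => t.
  by rewrite mul1mx enormZ exprMn gtr0_norm.
- by move=> k; apply: mean_ge0 => t; exact: sqr_ge0.
- exact: maxcoef_ge.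
Qed.

Hypothesis M_gt0 : (0 < M)%N.

(** The change of basis and its inverse compose to the identity. Gradient noise that
    passes through a quantizer can thus be charged with the factor
    v1 ^+ 4 * v2 ^+ 2 that it carries in the driving terms. *)
Lemma v1v2_ge1 : 1 <= v1 ^+ 2 * v2 ^+ 2.
Proof.
have [x x1] : exists x : 'cV[R]_M, enorm x ^+ 2 = 1.
  exists (delta_mx (Ordinal M_gt0) 0); rewrite enorm_sqr (bigD1 (Ordinal M_gt0)) //=.
  rewrite mxE !eqxx expr1n big1 ?addr0 // => j ji.
  by rewrite mxE (negbTE ji) expr0n.
have := components_le x; rewrite x1 mulr1 => h1.
have := enorm_components x; rewrite x1 => h2.
by apply: le_trans h2 _; rewrite mulrC ler_wpM2r ?sqr_ge0.
Qed.

(** The order mu ^+ 2 part of the two noises is proportional to the error energy,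
    with this coefficient. *)
Definition feedback_gain : R := v1 ^+ 2 * Bs * v2 ^+ 2 +
  v1 ^+ 2 * bmax * (4 * v2 ^+ 2 * modal_lipschitz + Bs * v2 ^+ 2).

Lemma adapt_diff_moment i :
  mean Pr (fun t => enorm (err i t - adapt mu (err i t)) ^+ 2) <=
  v2 ^+ 2 * (2 * nIJ' ^+ 2 * mean_check i + 6 * mu ^+ 2 * nb ^+ 2
             + 4 * mu ^+ 2 * modal_lipschitz * (mean_bar i + mean_check i)).
Proof.
have -> : v2 ^+ 2 * (2 * nIJ' ^+ 2 * mean_check i + 6 * mu ^+ 2 * nb ^+ 2
      + 4 * mu ^+ 2 * modal_lipschitz * (mean_bar i + mean_check i)) =
    (v2 ^+ 2 * (4 * mu ^+ 2 * modal_lipschitz)) * mean_bar i +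
    (v2 ^+ 2 * (2 * nIJ' ^+ 2 + 4 * mu ^+ 2 * modal_lipschitz)) * mean_check i +
    v2 ^+ 2 * (6 * mu ^+ 2 * nb ^+ 2) by ring.
apply: mean_affine => [|t].
  exact: (sqvec_integrableR (sqvecB (sqvec_err i) (sqvec_adapt_err i))).
apply: le_trans (enorm_adapt_sub _ mu_gt0) _.
by rewrite le_eqVlt; apply/orP; left; apply/eqP; ring.
Qed.

(** Used with f = barsq and with f = checksq. Gradient noise counts twice, directly
    and through the quantizer, whose input it perturbs. *)
Lemma noise_qerr_component (f : 'cV[R]_M -> R) i :
  (forall x, f x <= v1 ^+ 2 * enorm x ^+ 2) ->
  (forall X : T -> 'cV[R]_M, sqvec Pr X -> integrableR Pr (fun t => f (X t))) ->
  mu ^+ 2 * mean Pr (fun t => f (noise i t)) + mean Pr (fun t => f (qerr i t)) <=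
  mu ^+ 2 * feedback_gain * (mean_bar i + mean_check i) +
  2 * v1 ^+ 2 * v2 ^+ 2 * bmax * nIJ' ^+ 2 * mean_check i +
  mu ^+ 2 * (6 * nb ^+ 2 * v1 ^+ 2 * v2 ^+ 2 * bmax +
     v1 ^+ 4 * v2 ^+ 2 * ss * bmax + v1 ^+ 2 * ss) + v1 ^+ 2 * sq.
Proof.
move=> hf iF.
have fm (X : T -> 'cV[R]_M) : sqvec Pr X ->
    mean Pr (fun t => f (X t)) <= v1 ^+ 2 * mean Pr (fun t => enorm (X t) ^+ 2).
  move=> sX; rewrite -(meanZ _ (sqvec_integrableR sX)).
  exact: (le_mean (iF _ sX) (integrableRZ _ (sqvec_integrableR sX)) (fun t => hf (X t))).
rewrite (_ : v1 ^+ 4 = (v1 ^+ 2) ^+ 2); last by rewrite -exprM.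
have s0 : 0 <= ss by apply: sumr_ge0 => k _; case: (coef_ge0 k) => _ [].
exact: (recursion_scalar (sqr_ge0 _) maxcoef_ge0 s0 (sqr_ge0 mu) v1v2_ge1
  (fm _ (sqvec_noise_run i)) (fm _ (sqvec_qerr_run i))
  (noise_moment i) (qerr_moment i) (adapt_diff_moment i)).
Qed.

Hypothesis mu_lmax : mu * lmax <= 1.

Lemma bar_recursion i :
  mean_bar i.+1 <= (1 - mu * lmin + mu ^+ 2 * feedback_gain) * mean_bar i +
    (2 * v1 ^+ 2 * v2 ^+ 2 * bmax * nIJ' ^+ 2 +
     (mu / lmin * modal_lipschitz + mu ^+ 2 * feedback_gain)) * mean_check i +
    (mu ^+ 2 * (6 * nb ^+ 2 * v1 ^+ 2 * v2 ^+ 2 * bmax +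
       v1 ^+ 4 * v2 ^+ 2 * ss * bmax + v1 ^+ 2 * ss) + v1 ^+ 2 * sq).
Proof.
have h0 := noise_qerr_component i barsq_le integrableR_barsq.
have h1 : mean Pr (fun t => barsq (adapt mu (err i t))) <=
    (1 - mu * lmin) * mean_bar i + mu / lmin * modal_lipschitz * mean_check i + 0.
  apply: mean_affine => [|t]; first exact: integrableR_barsq (sqvec_adapt_err i).
  by rewrite addr0; exact: barsq_adapt.
have E := msq_step U^T i.
have -> : mean_bar i.+1 = mean Pr (fun t => barsq (adapt mu (err i t))) +
    mu ^+ 2 * mean Pr (fun t => barsq (noise i t)) + mean Pr (fun t => barsq (qerr i t)).
  exact: E.
rewrite -[leLHS]addrA; apply: le_trans (lerD h1 h0) _.
rewrite le_eqVlt; apply/orP; left; apply/eqP; ring.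
Qed.

Lemma check_recursion i :
  mean_check i.+1 <=
    (mu ^+ 2 * (3 / 2 * modal_lipschitz / (1 - nJ') + feedback_gain)) * mean_bar i +
    (nJ' + 2 * v1 ^+ 2 * v2 ^+ 2 * bmax * nIJ' ^+ 2 +
     mu ^+ 2 * (3 / 2 * modal_lipschitz / (1 - nJ') + feedback_gain)) * mean_check i +
    (mu ^+ 2 * (3 * nb ^+ 2 / (1 - nJ') + 6 * v1 ^+ 2 * v2 ^+ 2 * bmax * nb ^+ 2 +
       v1 ^+ 4 * v2 ^+ 2 * ss * bmax + v1 ^+ 2 * ss) + v1 ^+ 2 * sq).
Proof.
have h0 := noise_qerr_component i checksq_le integrableR_checksq.
pose k := mu ^+ 2 / (1 - nJ') * (3 / 2 * modal_lipschitz).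
have h1 : mean Pr (fun t => checksq (adapt mu (err i t))) <=
    k * mean_bar i + (nJ' + k) * mean_check i + mu ^+ 2 / (1 - nJ') * (3 * nb ^+ 2).
  apply: mean_affine => [|t]; first exact: integrableR_checksq (sqvec_adapt_err i).
  apply: le_trans (checksq_adapt (err i t) mu_gt0) _.
  by rewrite le_eqVlt; apply/orP; left; apply/eqP; rewrite /k; ring.
have E := msq_step (realify VL^T) i.
have -> : mean_check i.+1 = mean Pr (fun t => checksq (adapt mu (err i t))) +
    mu ^+ 2 * mean Pr (fun t => checksq (noise i t)) + mean Pr (fun t => checksq (qerr i t)).
  have e X : mean Pr (fun t => checksq (X t)) = msq (realify VL^T) X.
    by apply: eq_mean => t; exact: checksq_realify.
  transitivity (msq (realify VL^T) (err i.+1)); first exact: e.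
  by rewrite E -(e (fun t => adapt mu (err i t))) -(e (noise i)) -(e (qerr i)).
rewrite -[leLHS]addrA; apply: le_trans (lerD h1 h0) _.
rewrite le_eqVlt /k; apply/orP; left; apply/eqP; exact: check_scalar.
Qed.

Lemma ms_barE i : ms_bar Pr wo U phi i = (mean_bar i)%:E.
Proof. exact: (expectation_mean (integrableR_barsq_err i)). Qed.

Lemma ms_checkE i : ms_check Pr wo VL phi i = (mean_check i)%:E.
Proof. exact: (expectation_mean (integrableR_checksq_err i)). Qed.

Lemma msd_le k i : (msd Pr wo w k i <= (v2 ^+ 2 * (mean_bar i + mean_check i))%:E)%E.
Proof.
have -> : msd Pr wo w k i = (mean Pr (fun t => enorm (wo k - w k i t) ^+ 2))%:E.
  exact: (expectation_mean (sqvec_integrableR (@sqvec_werr i k))).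
rewrite lee_fin; apply: le_trans (mean_werr i).
rewrite (bigD1 k) //= lerDl; apply: sumr_ge0 => l _.
by apply: mean_ge0 => t; exact: sqr_ge0.
Qed.

End Run.
End ErrorDynamics.

(** * Small step-sizes *)

Section SmallSteps.
Variable R : realType.

Definition Gamma11 (sigma K mu : R) := 1 - mu * sigma + K * mu ^+ 2.
Definition Gamma12 (b0 K mu : R) := b0 + K * mu.
Definition Gamma21 (K mu : R) := K * mu ^+ 2.
Definition Gamma22 (d0 K mu : R) := d0 + K * mu ^+ 2.

(** The first column of Gamma leaves a gap of order mu only, hence a supersolution
    (X S / mu, Y S): Y is taken large against the gap 1 - d0 of the second row,
    then X large against sigma in the first. The weight s is that of the column
    sums which bound the spectral radius. *)
Lemma small_steps (sigma b0 d0 K s B2 lmax : R) :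
  0 < sigma -> 0 <= b0 -> 0 <= d0 -> 0 < K -> 0 < s -> B2 < 1 -> 0 <= lmax ->
  d0 + b0 / s <= B2 ->
  exists mu0 X Y : R, [/\ 0 < mu0, 0 < X, 0 < Y &
    forall mu, 0 < mu -> mu <= mu0 ->
    [/\ mu <= 1 /\ mu * lmax <= 1, 0 <= Gamma11 sigma K mu,
        Gamma11 sigma K mu + s * Gamma21 K mu <= 1 - mu * sigma + (K + s * K) * mu ^+ 2 /\
        1 - mu * sigma + (K + s * K) * mu ^+ 2 < 1,
        Gamma22 d0 K mu + Gamma12 b0 K mu / s <= B2 + (K * mu ^+ 2 + K / s * mu) /\
        B2 + (K * mu ^+ 2 + K / s * mu) < 1 &
        forall S, 0 <= S ->
          Gamma11 sigma K mu * (X * S / mu) + Gamma12 b0 K mu * (Y * S) + S <= X * S / mu /\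
          Gamma21 K mu * (X * S / mu) + Gamma22 d0 K mu * (Y * S) + S <= Y * S]].
Proof.
move=> sg0 b00 d00 K0 s0 B21 l0 hB2.
have bs : 0 <= b0 / s by rewrite divr_ge0 // ltW.
have d1 : d0 < 1 by lra.
pose eta := (1 - d0) / 2; have e0 : 0 < eta by rewrite /eta; lra.
have eE : d0 = 1 - 2 * eta by rewrite /eta; field.
(* half of the gap 1 - d0 absorbs K * mu ^+ 2, so that eta * Y pays for S and for
   the term in X, which is at most S *)
pose Y := 2 / eta; have Y0 : 0 < Y by rewrite divr_gt0.
have YE : eta * Y = 2 by rewrite /Y mulrC divfK // gt_eqF.
pose X := 2 * ((b0 + K) * Y + 1) / sigma.
have bK : 0 < b0 + K by lra.
have X0 : 0 < X by rewrite divr_gt0 // mulr_gt0 // addr_gt0 // mulr_gt0.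
have XE : sigma * X = 2 * ((b0 + K) * Y + 1) by rewrite /X mulrC divfK // gt_eqF.
have Ks : 0 <= K / s by rewrite divr_ge0 // ltW.
have sK : 0 <= s * K by rewrite mulr_ge0 // ltW.
have [|mu0 mu00 hmu] := @small_step R [:: (1, 1); (lmax, 1); (sigma, 1 / 2);
   (K + s * K, sigma / 2); (K, eta); (K + K / s, (1 - B2) / 2); (K * X, 1)].
  rewrite /= !ltr01 l0 ltW ?e0 //=.
  have -> : (0 < 1 / 2 :> R) by lra.
  have -> : 0 < sigma / 2 by lra.
  have -> : 0 < (1 - B2) / 2 by lra.
  have -> : 0 <= K + s * K by lra.
  have -> : 0 <= K + K / s by lra.
  have -> : 0 <= K * X by rewrite mulr_ge0 // ltW.
  have -> : 0 <= sigma by lra.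
  by have -> : 0 <= K by lra.
exists mu0, X, Y; split=> // mu mup mule.
have /= := hmu mu mup mule.
rewrite andbT => /andP[m1 /andP[m2 /andP[m3 /andP[m4 /andP[m5 /andP[m6 m7]]]]]].
rewrite mul1r in m1.
have mm : mu ^+ 2 <= mu by rewrite expr2 ler_piMl // ltW.
have mm0 : 0 <= mu ^+ 2 by exact: sqr_ge0.
have Kmm : K * mu ^+ 2 <= K * mu by rewrite ler_wpM2l // ltW.
have Kmm0 : 0 <= K * mu ^+ 2 by rewrite mulr_ge0 // ltW.
rewrite /Gamma11 /Gamma12 /Gamma21 /Gamma22; split.
- by split=> //; rewrite mulrC.
- lra.
- split; first by rewrite le_eqVlt; apply/orP; left; apply/eqP; ring.
  have : (K + s * K) * mu ^+ 2 <= mu * (sigma / 2).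
    by rewrite expr2 mulrA [leRHS]mulrC ler_wpM2r // ltW.
  have : 0 < mu * sigma by rewrite mulr_gt0.
  lra.
- split; last first.
    have : K * mu ^+ 2 + K / s * mu <= (K + K / s) * mu by rewrite mulrDl lerD2r.
    lra.
  by rewrite mulrDl mulrAC; lra.
- move=> S S0.
  have XS : X * S / mu * mu = X * S by rewrite divfK // gt_eqF.
  set x := X * S / mu in XS *.
  have XS0 : 0 <= X * S by rewrite mulr_ge0 // ltW.
  have YS0 : 0 <= Y * S by rewrite mulr_ge0 // ltW.
  have f1 : sigma * (X * S) = 2 * ((b0 + K) * (Y * S) + S).
    by rewrite mulrA XE; ring.
  have f2 : eta * (Y * S) = 2 * S by rewrite mulrA YE.
  have g1 : K * mu * (X * S) <= sigma / 2 * (X * S).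
    rewrite ler_wpM2r //; apply: le_trans m4; rewrite mulrDl lerDl mulr_ge0 //.
    exact: ltW.
  have g2 : K * mu * (Y * S) <= K * (Y * S).
    by rewrite ler_wpM2r // ler_piMr // ltW.
  have g3 : K * mu * (X * S) <= S.
    have -> : K * mu * (X * S) = K * X * mu * S by ring.
    by rewrite -[leRHS]mul1r ler_wpM2r.
  have g4 : K * mu ^+ 2 * (Y * S) <= eta * (Y * S).
    by rewrite ler_wpM2r //; lra.
  have h1 : mu * sigma * x = sigma * (X * S) by rewrite -XS; ring.
  have h2 : K * mu ^+ 2 * x = K * mu * (X * S) by rewrite -XS; ring.
  split; last by rewrite h2 eE; lra.
  have -> : (1 - mu * sigma + K * mu ^+ 2) * x = x - sigma * (X * S) + K * mu * (X * S).
    by rewrite -h1 -h2; ring.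
  lra.
Qed.

Lemma bigO_le (p : nat) (f : R -> R) (c : R) :
  (forall mu, 0 < mu -> mu <= 1 -> `|f mu| <= c * mu ^+ p) -> is_bigO p f.
Proof.
move=> h; exists (Num.max c 1), 1; split=> //; first by rewrite lt_max ltr01 orbT.
move=> mu m0 m1; apply: le_trans (h mu m0 m1) _.
by rewrite ler_wpM2r ?exprn_ge0 ?le_max ?lexx // ltW.
Qed.

Lemma limn_esup_geometric (u : nat -> \bar R) (c r l : R) :
  0 <= r -> r < 1 -> (forall i, (u i <= (c * r ^+ i + l)%:E)%E) ->
  (limn_esup u <= l%:E)%E.
Proof.
move=> r0 r1 h.
have cv : (fun i => (c * r ^+ i + l)%:E) @ \oo --> l%:E.
  apply: cvg_EFin; first by near=> n.
  rewrite -[X in _ --> X]add0r; apply: cvgD; last exact: cvg_cst.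
  rewrite -[X in _ --> X](mulr0 c); apply: cvgMr; apply: cvg_expr.
  by rewrite ger0_norm.
have [_ <-] := cvg_limn_einf_sup cv.
rewrite !limn_esup_lim; apply: lee_lim; [exact: is_cvg_esups|exact: is_cvg_esups|].
apply: nearW => n; apply: ge_ereal_sup => _ [k nk <-].
by apply: le_trans (h k) _; apply: ereal_sup_ubound; exists k.
Unshelve. all: by end_near. Qed.

Lemma margin_scalar (nj ni g r z v1 v2 b : R) :
  0 < g -> r < 1 -> 0 <= ni -> nj <= 1 - g + g * r -> ni <= g * z -> 0 <= b ->
  b = 0 \/ (g%:E < ((1 - r) / (4 * v1 ^+ 2 * v2 ^+ 2 * b * z ^+ 2))%:E)%E ->
  nj < 1 /\ nj + 2 * v1 ^+ 2 * v2 ^+ 2 * b * ni ^+ 2 < 1.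
Proof.
move=> g0 r1 n0 hj hi b0 hb.
have gr : 0 < g * (1 - r) by rewrite mulr_gt0 // subr_gt0.
split; first by lra.
have q0 (c : R) : 0 <= c -> 0 <= c * v1 ^+ 2 * v2 ^+ 2 * b.
  by move=> c0; exact: mulr_ge0 (mulr_ge0 (mulr_ge0 c0 (sqr_ge0 _)) (sqr_ge0 _)) b0.
have h3 : 2 * v1 ^+ 2 * v2 ^+ 2 * b * ni ^+ 2 <= 2 * v1 ^+ 2 * v2 ^+ 2 * b * (g * z) ^+ 2.
  by apply: ler_wpM2l; [exact: q0|exact: ler_sqr_mono].
suff h4 : 2 * v1 ^+ 2 * v2 ^+ 2 * b * (g * z) ^+ 2 <= g * (1 - r) / 2 by lra.
case: hb => [->|]; first by rewrite mulr0 mul0r; lra.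
rewrite lte_fin; set D := 4 * _ * _ * _ * _ => hg.
have D0 : 0 <= D by apply: mulr_ge0 (sqr_ge0 _); exact: q0.
have {}D0 : 0 < D.
  rewrite lt0r D0 andbT; apply/eqP => D00; move: hg; rewrite D00 invr0 mulr0.
  by rewrite ltNge (ltW g0).
move: hg; rewrite ltr_pdivlMr // => hg.
have -> : 2 * v1 ^+ 2 * v2 ^+ 2 * b * (g * z) ^+ 2 = g * (g * D) / 2.
  by rewrite /D; field.
by rewrite ler_pM2r ?invr_gt0 // ler_pM2l // ltW.
Qed.

End SmallSteps.

(** * Stability margin *)

Section Margin.
Import ComplexField.Normc.
Variables (R : realType) (N : nat) (m : 'I_N -> nat) (P : nat).
Local Notation M := (\sum_k m k)%N.
Local Notation Q := (M - P)%N.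

(** The upper bound on gamma leaves room for the quantization noise that is fed
    back through the complement of Range(U). *)
Lemma stability_margin (v1 v2 b2 eps gamma : R) (Jeps : 'M[R[i]]_Q) :
  (0 < Q)%N -> 0 <= b2 -> jordan_matrix eps Jeps -> 0 < eps ->
  0 < rho Jeps + eps < 1 -> 0 < gamma <= 1 ->
  (gamma%:E < Order.min 1 (gamma_bound v1 v2 b2 eps Jeps))%E ->
  opnorm (Jprime gamma Jeps) < 1 /\
  opnorm (Jprime gamma Jeps) +
    2 * v1 ^+ 2 * v2 ^+ 2 * b2 * opnorm (1%:M - Jprime gamma Jeps) ^+ 2 < 1.
Proof.
move=> Q0 b0 hj e0 /andP[r0 r1] /andP[g0 g1]; rewrite lt_min => /andP[_ hg].
have [_ h1] : 0 <= rho Jeps /\ opnorm Jeps <= rho Jeps + eps.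
  apply: opnorm_bidiagonal => // [|i j ij ij1|i j ij]; first exact: ltW.
    by case: (hj i j) => h _; exact: h.
  case: (hj i j) => _ /(_ ij)[->|[-> _]]; first by rewrite normc0 ltW.
  by rewrite normc_real gtr0_norm.
have [rI h2] : 0 <= rho (1%:M - Jeps) /\ opnorm (1%:M - Jeps) <= rho (1%:M - Jeps) + eps.
  apply: opnorm_bidiagonal => // [|i j ij ij1|i j ij]; first exact: ltW.
    case: (hj i j) => h _; rewrite !mxE h // subr0.
    by rewrite (_ : (i == j) = false) //; apply/negbTE; rewrite eq_sym.
  rewrite !mxE (_ : (i == j) = false); last first.
    by apply/negbTE/eqP => ij'; move: ij; rewrite ij' => /n_Sn.
  rewrite sub0r normcN.
  case: (hj i j) => _ /(_ ij)[->|[-> _]]; first by rewrite normc0 ltW.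
  by rewrite normc_real gtr0_norm.
have hJ : opnorm (Jprime gamma Jeps) <= 1 - gamma + gamma * (rho Jeps + eps).
  apply: le_trans (opnorm_lin _ _ _) _; [by rewrite subr_ge0|exact: ltW|].
  by rewrite lerD2l; exact: ler_wpM2l (ltW g0) _ _ h1.
have hI : opnorm (1%:M - Jprime gamma Jeps) <= gamma * (rho (1%:M - Jeps) + eps).
  have -> : 1%:M - Jprime gamma Jeps =
      real_complex R 0 *: 1%:M + real_complex R gamma *: (1%:M - Jeps).
    apply/matrixP => i j; rewrite /Jprime rmorphB rmorph1 rmorph0 !mxE; ring.
  apply: le_trans (opnorm_lin _ (lexx 0) (ltW g0)) _.
  by rewrite add0r; exact: ler_wpM2l (ltW g0) _ _ h2.
apply: (margin_scalar g0 r1 (opnorm_ge0 _) hJ hI b0).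
by move: hg; rewrite /gamma_bound; case: eqP => [|_]; [left|right].
Qed.

End Margin.

(** * Rate and steady state *)

Section FinalScalars.
Variable R : realType.

(** As mu <= 1, one constant dominates the perturbations of all entries of Gamma. *)
Lemma coef_bar (mu sigma lv kq jj b0 x y x' e : R) :
  0 < mu -> mu <= 1 -> 0 < sigma -> 0 <= lv -> 0 <= kq -> 0 <= jj -> 0 <= x -> 0 <= y ->
  x' <= (1 - mu * sigma + mu ^+ 2 * kq) * x + (b0 + (mu / sigma * lv + mu ^+ 2 * kq)) * y + e ->
  x' <= Gamma11 sigma (lv / sigma + kq + jj + 1) mu * x +
        Gamma12 b0 (lv / sigma + kq + jj + 1) mu * y + e.
Proof.
move=> m0 m1 s0 lv0 kq0 jj0 x0 y0 h; apply: le_trans h _; rewrite lerD2r.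
have ls : 0 <= lv / sigma by rewrite divr_ge0 // ltW.
have mm : mu ^+ 2 <= mu by rewrite expr2 ler_piMl // ltW.
have -> : mu / sigma * lv = lv / sigma * mu by rewrite mulrAC [lv / _ * _]mulrC mulrA.
rewrite /Gamma11 /Gamma12; apply: lerD; apply: ler_wpM2r => //.
  by rewrite lerD2l mulrC ler_wpM2r ?sqr_ge0 //; lra.
rewrite lerD2l; set z := lv / sigma in ls *.
have := ler_wpM2r kq0 mm; have := mulr_ge0 jj0 (ltW m0); lra.
Qed.

Lemma coef_check (mu sigma lv kq jj d0 x y x' e : R) :
  0 < sigma -> 0 <= lv -> 0 <= x -> 0 <= y ->
  x' <= mu ^+ 2 * (jj + kq) * x + (d0 + mu ^+ 2 * (jj + kq)) * y + e ->
  x' <= Gamma21 (lv / sigma + kq + jj + 1) mu * x +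
        Gamma22 d0 (lv / sigma + kq + jj + 1) mu * y + e.
Proof.
move=> s0 lv0 x0 y0 h; apply: le_trans h _; rewrite lerD2r.
have ls : 0 <= lv / sigma by rewrite divr_ge0 // ltW.
rewrite /Gamma21 /Gamma22.
have k : mu ^+ 2 * (jj + kq) <= (lv / sigma + kq + jj + 1) * mu ^+ 2.
  by rewrite mulrC ler_wpM2r ?sqr_ge0 //; lra.
by apply: lerD; apply: ler_wpM2r => //; rewrite lerD2l.
Qed.

Lemma steady_scalar (mu X Y w v delta sq S : R) :
  0 < mu -> mu <= 1 -> 0 <= X -> 0 <= Y -> 0 <= w -> 0 <= v -> 0 <= delta -> 0 <= sq ->
  S = mu ^+ 2 * delta + 2 * v * sq ->
  w * (X * S / mu + Y * S) <= (w * (X + Y) * (1 + 2 * v) + 1) * (delta * mu + sq / mu).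
Proof.
move=> m0 m1 X0 Y0 w0 v0 de0 sq0 ->.
pose t := sq / mu; have t0 : 0 <= t by rewrite divr_ge0 // ltW.
have -> : sq = t * mu by rewrite /t divfK // gt_eqF.
have -> : t * mu / mu = t by rewrite mulfK // gt_eqF.
pose u := mu * delta + 2 * v * t.
have vt : 0 <= v * t by exact: mulr_ge0.
have dm : 0 <= mu * delta by rewrite mulr_ge0 // ltW.
have u0 : 0 <= u by rewrite /u; lra.
have -> : mu ^+ 2 * delta + 2 * v * (t * mu) = u * mu by rewrite /u; ring.
have -> : X * (u * mu) / mu = X * u by rewrite mulrA mulfK // gt_eqF.
have uY : Y * (u * mu) <= Y * u by rewrite ler_wpM2l // ler_piMr.
have wXY : 0 <= w * (X + Y) by rewrite mulr_ge0 // addr_ge0.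
apply: le_trans (_ : w * (X + Y) * u <= _).
  by rewrite -mulrA; apply: ler_wpM2l => //; rewrite [(X + Y) * u]mulrDl lerD2l.
have uu : u <= (1 + 2 * v) * (delta * mu + t).
  by rewrite /u; have := mulr_ge0 v0 dm; lra.
rewrite mulrDl mul1r; apply: le_trans (ler_wpM2l wXY uu) _.
by rewrite mulrA lerDl; lra.
Qed.

Lemma driving_terms (m2 b2 a1 a2 a4 bm s1 d : R) :
  a4 = a1 ^+ 2 ->
  0 <= m2 -> 0 <= b2 -> 0 <= a1 -> 0 <= a2 -> 0 <= bm -> 0 <= s1 -> 0 <= d ->
  [/\ 0 <= m2 * (6 * b2 * a1 * a2 * bm + a4 * a2 * s1 * bm + a1 * s1),
      0 <= m2 * (3 * b2 * d + 6 * a1 * a2 * bm * b2 + a4 * a2 * s1 * bm + a1 * s1),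
      0 <= 2 * a1 * s1 + 3 * b2 * d + bm * a1 * a2 * (2 * a1 * s1 + 12 * b2) &
      m2 * (6 * b2 * a1 * a2 * bm + a4 * a2 * s1 * bm + a1 * s1) +
      m2 * (3 * b2 * d + 6 * a1 * a2 * bm * b2 + a4 * a2 * s1 * bm + a1 * s1) =
      m2 * (2 * a1 * s1 + 3 * b2 * d + bm * a1 * a2 * (2 * a1 * s1 + 12 * b2))].
Proof.
move=> -> m0 b0 a0 a20 bm0 s0 d0.
have p1 : 0 <= b2 * a1 * a2 * bm by rewrite !mulr_ge0.
have p2 : 0 <= a1 ^+ 2 * a2 * s1 * bm by rewrite !mulr_ge0 ?sqr_ge0.
have p3 : 0 <= a1 * s1 by rewrite mulr_ge0.
have p4 : 0 <= b2 * d by rewrite mulr_ge0.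
split; [apply: mulr_ge0 => //; lra|apply: mulr_ge0 => //; lra|lra|ring].
Qed.

(** Any kappa = beta + eta above beta leaves room for the weighted off-diagonal term
    beta * n2 / s once s is large; eta is so small that at least half of the margin
    remains. *)
Lemma kappa_margin (nj n2 beta : R) :
  0 <= n2 -> 0 <= beta -> nj + beta * n2 < 1 ->
  exists eta s : R, [/\ 0 < eta, 0 < s,
    nj + beta * n2 + beta * n2 / s <= nj + (beta + eta) * n2 &
    nj + (beta + eta) * n2 < 1].
Proof.
move=> n0 b0 h; pose z := 1 - (nj + beta * n2); have z0 : 0 < z by rewrite subr_gt0.
have c0 : 0 < 2 * (n2 + 1) by lra.
pose eta := z / (2 * (n2 + 1)); have e0 : 0 < eta by rewrite divr_gt0.
pose s := beta / eta + 1; have s0 : 0 < s by rewrite ltr_wpDl // divr_ge0 // ltW.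
have es : eta * s = beta + eta by rewrite /s mulrDr mulr1 mulrC divfK // gt_eqF.
have ez : eta * (2 * (n2 + 1)) = z by rewrite /eta divfK // gt_eqF.
exists eta, s; split=> //.
  rewrite mulrDl addrA lerD2l ler_pdivrMr // mulrAC es.
  by have := mulr_ge0 (ltW e0) n0; lra.
by rewrite mulrDl addrA; move: ez; rewrite /z; lra.
Qed.

Lemma gain_expr_ge0 (a1 a2 B bm l : R) :
  0 <= a1 -> 0 <= a2 -> 0 <= B -> 0 <= bm -> 0 <= l ->
  0 <= a1 * B * a2 + a1 * bm * (4 * a2 * l + B * a2).
Proof. by move=> *; rewrite !(addr_ge0, mulr_ge0). Qed.

(** Perron's eigenvector gives the rate, a supersolution the steady state. *)
Lemma recursion_rate (a b c d e f p1 p2 : R) (x y : nat -> R) :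
  0 <= a -> 0 < b -> 0 < c -> 0 <= d ->
  a * p1 + b * p2 + e <= p1 -> c * p1 + d * p2 + f <= p2 ->
  (forall i, x i.+1 <= a * x i + b * y i + e) ->
  (forall i, y i.+1 <= c * x i + d * y i + f) ->
  exists2 C, 0 <= C &
    forall i, x i + y i <= C * rho (toC (mx2 a b c d)) ^+ i + (p1 + p2).
Proof.
move=> a0 b0 c0 d0 h1 h2 hx hy.
have [l [l0 al ll ev]] := perron2 a0 b0 c0 d0.
have [C C0 hC] := decay2 a0 b0 c0 d0 al ll h1 h2 hx hy.
exists C => // i; apply: le_trans (hC i) _; rewrite lerD2r ler_wpM2l //.
apply: lerXn2r; rewrite ?nnegrE //; last first.
  by have := normc_le_rho ev; rewrite normc_real ger0_norm.
by apply: le_trans (normc_le_rho ev); exact: normc_ge0.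
Qed.

(** Perron's eigenvalue shows that the set of moduli is inhabited; the weighted
    column sums bound it. *)
Lemma rho_mx2_bounds (a b c d s B : R) :
  0 <= a -> 0 < b -> 0 < c -> 0 <= d -> 0 < s ->
  a + s * c <= B -> d + b / s <= B ->
  0 <= rho (toC (mx2 a b c d)) <= B.
Proof.
move=> a0 b0 c0 d0 s0 h1 h2.
have [l [l0 al ll ev]] := perron2 a0 b0 c0 d0.
apply/andP; split.
  by apply: le_trans (normc_le_rho ev); exact: normc_ge0.
apply: ge_sup; first by exists (ComplexField.Normc.normc (real_complex R l)), (real_complex R l).
by move=> _ [z /= ez <-]; exact: (normc_eigenvalue2 a0 (ltW b0) (ltW c0) d0 s0 h1 h2 ez).
Qed.

End FinalScalars.

Theorem theorem1 (R : realType) (N : nat) (m : 'I_N -> nat) (P : nat)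
    (J : forall k, 'cV[R]_(m k) -> R) (nbh : 'I_N -> {set 'I_N})
    (U : 'M[R]_(\sum_k m k, P)) (A : 'M[R]_(\sum_k m k))
    (wo : forall k, 'cV[R]_(m k))
    (lkmin lkmax : 'I_N -> R) (lmin lmax : R)
    (bs2 ss2 bq2 : 'I_N -> R) (eps gamma : R)
    (VR VL : 'M[R[i]]_(\sum_k m k, \sum_k m k - P))
    (Jeps : 'M[R[i]]_(\sum_k m k - P))
    (hP : (P < \sum_k m k)%N)
    (hU : U^T *m U = 1%:M)
    (hnbh : forall k, k \in nbh k)
    (hA : combination_matrix nbh U A)
    (hJ : cost_assumption J U lkmin lkmax lmin lmax)
    (hwo : unique_minimizer J U wo)
    (hcoef : forall k, [/\ 0 <= bs2 k, 0 <= ss2 k & 0 <= bq2 k])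
    (heps : 0 < eps)
    (hdec : jordan_decomposition U A eps VR VL Jeps)
    (hrho : 0 < rho Jeps + eps < 1)
    (hgamma01 : 0 < gamma <= 1) :
  let v1 := opnorm (Vinv U VL) in
  let v2 := opnorm (Veps U VR) in
  let bmax := maxcoef bq2 in
  (gamma%:E < Order.min 1 (gamma_bound v1 v2 bmax eps Jeps))%E ->
  let nJ' := opnorm (Jprime gamma Jeps) in
  let nIJ' := opnorm (1%:M - Jprime gamma Jeps) in
  let nb := cenorm (bcheck J wo VL) in
  let ss := \sum_k ss2 k in
  let delta := 2 * v1 ^+ 2 * ss + 3 * nb ^+ 2 / (1 - nJ') +
    bmax * v1 ^+ 2 * v2 ^+ 2 * (2 * v1 ^+ 2 * ss + 12 * nb ^+ 2) in
  let e mu := mu ^+ 2 *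
    (6 * nb ^+ 2 * v1 ^+ 2 * v2 ^+ 2 * bmax +
     v1 ^+ 4 * v2 ^+ 2 * ss * bmax + v1 ^+ 2 * ss) in
  let f mu := mu ^+ 2 *
    (3 * nb ^+ 2 / (1 - nJ') + 6 * v1 ^+ 2 * v2 ^+ 2 * bmax * nb ^+ 2 +
     v1 ^+ 4 * v2 ^+ 2 * ss * bmax + v1 ^+ 2 * ss) in
  is_bigO 0 (fun _ : R => nb) /\
  exists (C mu0 sigma11 kappa : R) (Gamma : R -> 'M[R]_2) (g1 g2 : R -> R),
  [/\ [/\ 0 < C, 0 < mu0, 0 < sigma11 & 0 < kappa],
      [/\ is_bigO 2 (fun mu => Gamma mu 0 0 - (1 - mu * sigma11)),
          is_bigO 1 (fun mu => Gamma mu 0 1 -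
            2 * v1 ^+ 2 * v2 ^+ 2 * bmax * nIJ' ^+ 2),
          is_bigO 2 (fun mu => Gamma mu 1 0) &
          is_bigO 2 (fun mu => Gamma mu 1 1 -
            (nJ' + 2 * v1 ^+ 2 * v2 ^+ 2 * bmax * nIJ' ^+ 2))],
      is_bigO 2 g1 /\ is_bigO 1 g2,
      forall mu, 0 < mu -> mu <= mu0 ->
        let bound := Num.max (1 - mu * sigma11 + g1 mu)
                             (nJ' + kappa * nIJ' ^+ 2 + g2 mu) in
        [/\ forall a b, 0 <= Gamma mu a b,
            rho (toC (Gamma mu)) <= bound & bound < 1] &
      forall (mu : R) (sq2 : 'I_N -> R),
        0 < mu -> mu <= mu0 -> (forall k, 0 <= sq2 k) ->
      forall (d : measure_display) (T : measurableType d)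
        (Pr : probability T R)
        (ghat q : forall k : 'I_N, nat -> T -> 'cV[R]_(m k) -> 'cV[R]_(m k))
        (phi psi w : forall k : 'I_N, nat -> T -> 'cV[R]_(m k)),
        strategyQ mu gamma nbh A ghat q phi psi w ->
        admissible_init Pr phi ->
        noise_assumption Pr J wo bs2 ss2 ghat phi w ->
        quantizer_assumption Pr bq2 sq2 q phi psi ->
      let sq := \sum_k sq2 k in
      [/\ forall i,
            (ms_bar Pr wo U phi i.+1 <=
               (Gamma mu 0 0)%:E * ms_bar Pr wo U phi i +
               (Gamma mu 0 1)%:E * ms_check Pr wo VL phi i +
               (e mu + v1 ^+ 2 * sq)%:E)%E /\
            (ms_check Pr wo VL phi i.+1 <=
               (Gamma mu 1 0)%:E * ms_bar Pr wo U phi i +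
               (Gamma mu 1 1)%:E * ms_check Pr wo VL phi i +
               (f mu + v1 ^+ 2 * sq)%:E)%E,
          forall k, (limn_esup (msd Pr wo w k) <=
                       (C * (delta * mu + sq * mu^-1))%:E)%E &
          exists C' : R, forall k i,
            (msd Pr wo w k i <=
               (C' * rho (toC (Gamma mu)) ^+ i +
                C * (delta * mu + sq * mu^-1))%:E)%E]].
Proof.
move=> v1 v2 bmax hg nJ' nIJ' nb ss delta e f.
have Q0 : (0 < \sum_k m k - P)%N by rewrite subn_gt0.
have M0 : (0 < \sum_k m k)%N by exact: leq_ltn_trans (leq0n _) hP.
have bm0 : 0 <= bmax by exact: maxcoef_ge0.
have hj : jordan_matrix eps Jeps by case: hdec.
have [nJ1 margin] := stability_margin Q0 bm0 hj heps hrho hgamma01 hg.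
rewrite -/nJ' -/nIJ' in nJ1 margin.
have hAU : U^T *m A = U^T by case: hA.
have [l0 l1] : 0 < lmin /\ 0 <= lmax.
  by case: (hJ) => _ _ /andP[h1 h2] _; split=> //; exact: le_trans (ltW h1) h2.
have nJ0 : 0 <= nJ' by exact: opnorm_ge0.
have nb0 : 0 <= nb by exact: cenorm_ge0.
have ss0 : 0 <= ss by apply: sumr_ge0 => k _; case: (hcoef k).
split.
  by apply: (@bigO_le _ _ _ nb) => mu _ _; rewrite expr0 mulr1 ger0_norm.
pose n2 := nIJ' ^+ 2; have n20 : 0 <= n2 by exact: sqr_ge0.
pose beta := 2 * v1 ^+ 2 * v2 ^+ 2 * bmax.
have beta0 : 0 <= beta.
  by apply: mulr_ge0 bm0; apply: mulr_ge0 (sqr_ge0 _); apply: mulr_ge0 (sqr_ge0 _).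
pose b0 := beta * n2; have b00 : 0 <= b0 by exact: mulr_ge0.
pose d0 := nJ' + b0; have d00 : 0 <= d0 by exact: addr_ge0.
have d01 : d0 < 1 by exact: margin.
pose lv := modal_lipschitz U lkmax VR VL; have lv0 : 0 <= lv by exact: sqr_ge0.
pose kq := feedback_gain U lkmax VR VL bs2 bq2.
have bs0 : 0 <= \sum_k bs2 k by apply: sumr_ge0 => k _; case: (hcoef k).
have kq0 : 0 <= kq by exact: gain_expr_ge0 (sqr_ge0 _) (sqr_ge0 _) bs0 bm0 lv0.
pose jj := 3 / 2 * lv / (1 - nJ').
have jj0 : 0 <= jj by apply: divr_ge0; [apply: mulr_ge0|rewrite subr_ge0 ltW].
(* K dominates the perturbations of all entries of Gamma; the summand 1 makes it
   positive, and so the off-diagonal entries, even if the other terms vanish. *)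
pose K := lv / lmin + kq + jj + 1.
have K0 : 0 < K.
  apply: ltr_wpDl ltr01; apply: addr_ge0 jj0; apply: addr_ge0 kq0.
  exact: divr_ge0 lv0 (ltW l0).
have [eta [s [eta0 s0 hs hk]]] := kappa_margin n20 beta0 d01.
(* kappa exceeds the coefficient beta of nIJ' ^+ 2 in d0, so as to absorb the
   off-diagonal entry b0 / s of the weighted column sum. *)
pose kappa := beta + eta.
have [mu0 [X [Y [mu00 X0 Y0 hmu]]]] := small_steps l0 b00 d00 K0 s0 hk l1 hs.
(* v2 ^+ 2 converts modal energies into mean-square errors, 1 + 2 * v1 ^+ 2
   compares the driving terms with delta and sq. *)
pose C := v2 ^+ 2 * (X + Y) * (1 + 2 * v1 ^+ 2) + 1.
exists C, mu0, lmin, kappa,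
  (fun mu => mx2 (Gamma11 lmin K mu) (Gamma12 b0 K mu) (Gamma21 K mu) (Gamma22 d0 K mu)),
  (fun mu => (K + s * K) * mu ^+ 2), (fun mu => K * mu ^+ 2 + K / s * mu).
have Cp : 0 < C.
  apply: ltr_wpDl ltr01; apply: mulr_ge0; last by rewrite addr_ge0 // mulr_ge0 ?sqr_ge0.
  by rewrite mulr_ge0 ?sqr_ge0 // addr_ge0 // ltW.
have mxE2 (a b c d : R) : [/\ mx2 a b c d 0 0 = a, mx2 a b c d 0 1 = b,
    mx2 a b c d 1 0 = c & mx2 a b c d 1 1 = d] by rewrite !mxE.
have pos mu : 0 < mu -> [/\ 0 < Gamma12 b0 K mu, 0 < Gamma21 K mu & 0 <= Gamma22 d0 K mu].
  move=> mup; have Km : 0 < K * mu by exact: mulr_gt0.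
  have Kmm : 0 < K * mu ^+ 2 by rewrite mulr_gt0 // exprn_gt0.
  by split; rewrite /Gamma12 /Gamma22 //; [rewrite ltr_wpDl|rewrite addr_ge0 // ltW].
split.
- by split=> //; rewrite ltr_wpDl.
- have KnormE (p : nat) (mu : R) : 0 < mu -> `|K * mu ^+ p| = K * mu ^+ p.
    by move=> mup; rewrite ger0_norm // mulr_ge0 ?exprn_ge0 // ltW.
  split; apply: (@bigO_le _ _ _ K) => mu mup mu1; have [E1 E2 E3 E4] := mxE2
    (Gamma11 lmin K mu) (Gamma12 b0 K mu) (Gamma21 K mu) (Gamma22 d0 K mu).
  + by rewrite E1 /Gamma11 addrAC subrr add0r KnormE.
  + by rewrite E2 /Gamma12 -/beta -/n2 -/b0 addrAC subrr add0r -[X in `|_ * X|]expr1 KnormE.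
  + by rewrite E3 /Gamma21 KnormE.
  + by rewrite E4 /Gamma22 -/beta -/n2 -/b0 -/d0 addrAC subrr add0r KnormE.
- have Ks : 0 <= K / s by rewrite divr_ge0 // ltW.
  have sK : 0 <= s * K by rewrite mulr_ge0 // ltW.
  split; first (apply: (@bigO_le _ _ _ (K + s * K)) => mu mup mu1).
    by rewrite ger0_norm // mulr_ge0 ?sqr_ge0 // addr_ge0 // ltW.
  apply: (@bigO_le _ _ _ (K + K / s)) => mu mup mu1.
  rewrite ger0_norm; last by rewrite addr_ge0 // mulr_ge0 ?sqr_ge0 // ltW.
  rewrite expr1 [(K + K / s) * mu]mulrDl lerD2r; apply: ler_wpM2l; first exact: ltW.
  by rewrite expr2 ler_piMl // ltW.
- move=> mu mup mule bound.
  have [[m1 ml] A0 [A1 A2] [D1 D2] _] := hmu mu mup mule.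
  have [B0 C0 D0] := pos mu mup.
  have /andP[_ hr] : 0 <= rho (toC (mx2 (Gamma11 lmin K mu) (Gamma12 b0 K mu)
      (Gamma21 K mu) (Gamma22 d0 K mu))) <= bound.
    by apply: (rho_mx2_bounds A0 B0 C0 D0 s0); rewrite /bound le_max ?A1 // ?D1 ?orbT.
  split=> //; last by rewrite gt_max A2.
  move=> a b; rewrite mxE; case: ifP => _; case: ifP => _ //; exact: ltW.
move=> mu sq2 mup mule hsq2 d T Pr ghat q phi psi w hrun hinit hnoise hquant sq.
have [[m1 ml] A0 [A1 A2] [D1 D2] hS] := hmu mu mup mule.
have [B0 C0 D0] := pos mu mup.
have [-> -> -> ->] := mxE2 (Gamma11 lmin K mu) (Gamma12 b0 K mu) (Gamma21 K mu) (Gamma22 d0 K mu).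
have sq0 : 0 <= sq by apply: sumr_ge0 => k _.
pose x := mean_bar U wo Pr phi; pose y := mean_check wo VL Pr phi.
have x0 i : 0 <= x i by exact: mean_bar_ge0.
have y0 i : 0 <= y i by exact: mean_check_ge0.
have hx i : x i.+1 <= Gamma11 lmin K mu * x i + Gamma12 b0 K mu * y i + (e mu + v1 ^+ 2 * sq).
  have h := bar_recursion hJ hwo hAU hdec nJ1 hA hcoef hsq2 mup hrun hinit hnoise hquant M0 ml i.
  exact: (coef_bar mup m1 l0 lv0 kq0 jj0 (x0 i) (y0 i) h).
have hy i : y i.+1 <= Gamma21 K mu * x i + Gamma22 d0 K mu * y i + (f mu + v1 ^+ 2 * sq).
  have h := check_recursion hJ hwo hAU hdec nJ1 hA hcoef hsq2 mup hrun hinit hnoise hquant M0 i.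
  exact: (coef_check l0 lv0 (x0 i) (y0 i) h).
have v14 : v1 ^+ 4 = (v1 ^+ 2) ^+ 2 by rewrite -exprM.
have j0 : 0 <= (1 - nJ')^-1 by rewrite invr_ge0 subr_ge0 ltW.
have [e0 f0 delta0 efE] := driving_terms v14 (sqr_ge0 mu) (sqr_ge0 nb) (sqr_ge0 v1)
  (sqr_ge0 v2) bm0 ss0 j0.
rewrite -/(e mu) in e0 efE; rewrite -/(f mu) in f0 efE; rewrite -/delta in delta0 efE.
(* a common bound of both driving terms: by efE, S is mu ^+ 2 * delta up to the
   quantization noise *)
pose S := e mu + f mu + 2 * v1 ^+ 2 * sq.
have vs : 0 <= v1 ^+ 2 * sq by exact: mulr_ge0 (sqr_ge0 _) sq0.
have v2s : 2 * v1 ^+ 2 * sq = v1 ^+ 2 * sq + v1 ^+ 2 * sq by rewrite -mulrA mulr_natl mulr2n.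
have S0 : 0 <= S by rewrite /S v2s !addr_ge0.
have eS : e mu + v1 ^+ 2 * sq <= S by rewrite /S v2s addrACA lerDl addr_ge0.
have fS : f mu + v1 ^+ 2 * sq <= S by rewrite /S v2s addrACA lerDr addr_ge0.
have [h1 h2] := hS S S0.
have h1' := le_trans (lerD (lexx _) eS) h1.
have h2' := le_trans (lerD (lexx _) fS) h2.
have [C1 C10 hC1] := recursion_rate A0 B0 C0 D0 h1' h2' hx hy.
have v20 : 0 <= v2 ^+ 2 by exact: sqr_ge0.
have steady : v2 ^+ 2 * (X * S / mu + Y * S) <= C * (delta * mu + sq / mu).
  apply: steady_scalar mup m1 (ltW X0) (ltW Y0) v20 (sqr_ge0 v1) delta0 sq0 _.
  by rewrite /S efE.
set G := toC _; pose C' := v2 ^+ 2 * C1.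
have hmsd k i : (msd Pr wo w k i <= (C' * rho G ^+ i + C * (delta * mu + sq / mu))%:E)%E.
  apply: le_trans (msd_le hJ hwo hAU hdec nJ1 hA hcoef hsq2 hrun hinit hnoise hquant k i) _.
  rewrite lee_fin; apply: le_trans (ler_wpM2l v20 (hC1 i)) _.
  by rewrite mulrDr mulrA; exact: lerD (lexx _) steady.
have maxl_ge (u z : R) : u <= Num.max u z by rewrite le_max lexx.
have maxr_ge (u z : R) : z <= Num.max u z by rewrite le_max lexx orbT.
have /andP[G0 G1] := rho_mx2_bounds A0 B0 C0 D0 s0
  (le_trans A1 (maxl_ge _ _)) (le_trans D1 (maxr_ge _ _)).
split.
- move=> i.
  rewrite !(ms_barE hJ hwo hA hcoef hsq2 hrun hinit hnoise hquant).
  rewrite !(ms_checkE _ hJ hwo hA hcoef hsq2 hrun hinit hnoise hquant).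
  by rewrite -!EFinM -!EFinD !lee_fin; split; [exact: hx|exact: hy].
- move=> k; apply: (limn_esup_geometric G0 _ (hmsd k)).
  by apply: le_lt_trans G1 _; rewrite gt_max A2 D2.
- by exists C' => k i; exact: hmsd.
Qed.
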